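(* Let $(\Sigma,\mathrm{ar})$ be a mixed binding signature. Then: (1) The nominal set $(T_\Sigma^\infty)_{\mathrm{fs}}$ is the nominal metric completion of $T_\Sigma$ (for the Arnold–Nivat metric $d$), and it is the terminal coalgebra $\nu Y.\mu X.T_\Sigma(X,Y)$ in $\mathbf{Nom}$. (2) The nominal set $(T_\Sigma/{\approx_\alpha})^\infty_{\mathrm{fs}}$ is the nominal metric completion of $T_\Sigma/{\approx_\alpha}$ (for $d_\alpha$), and it is the terminal coalgebra $\nu Y.\mu X.T^\alpha_\Sigma(X,Y)$ in $\mathbf{Nom}$. (3) In $\mathbf{Set}$ one has $(T_\Sigma/{\approx_\alpha})^\infty_{\mathrm{fs}}=(T_\Sigma^\infty)_{\mathrm{ffv}}/{\approx_\alpha}$, and the following diagram commutes: the top row is $T_\Sigma\to(T_\Sigma^\infty)_{\mathrm{fs}}\hookrightarrow(T_\Sigma^\infty)_{\mathrm{ffv}}\hookrightarrow T_\Sigma^\infty$ (the first arrow being the nominal metric completion, and the composite being the metric completion $T_\Sigma\rightarrowtail T_\Sigma^\infty$); the bottom row is $T_\Sigma/{\approx_\alpha}\to(T_\Sigma/{\approx_\alpha})^\infty_{\mathrm{fs}}=(T_\Sigma^\infty)_{\mathrm{ffv}}/{\approx_\alpha}\hookrightarrow(T_\Sigma/{\approx_\alpha})^\infty$ (the first arrow the nominal metric completion, the composite the metric completion); the vertical arrows $T_\Sigma\twoheadrightarrow T_\Sigma/{\approx_\alpha}$, $(T_\Sigma^\infty)_{\mathrm{fs}}\to(T_\Sigma/{\approx_\alpha})^\infty_{\mathrm{fs}}$,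 $(T_\Sigma^\infty)_{\mathrm{ffv}}\twoheadrightarrow(T_\Sigma^\infty)_{\mathrm{ffv}}/{\approx_\alpha}$ and $T_\Sigma^\infty\to(T_\Sigma/{\approx_\alpha})^\infty$ are the canonical quotient maps; moreover the rightmost square, with corners $(T_\Sigma^\infty)_{\mathrm{ffv}}$, $T_\Sigma^\infty$, $(T_\Sigma^\infty)_{\mathrm{ffv}}/{\approx_\alpha}$, $(T_\Sigma/{\approx_\alpha})^\infty$, is a pullback.
   Context: Fix a set $\mathcal{V}$ of variables; $\mathrm{Perm}(\mathcal{V})$ is the group of permutations generated by transpositions $(x\,x')$. A nominal set is a set with a $\mathrm{Perm}(\mathcal{V})$-action in which each element $a$ has a finite support (least finite $S\subseteq\mathcal{V}$ such that permutations fixing $S$ pointwise fix $a$); $\mathbf{Nom}$ is the category of nominal sets and equivariant maps. For a set $S$ with a $\mathrm{Perm}(\mathcal{V})$-action, $S_{\mathrm{fs}}$ is the nominal set of its finitely supported elements. The abstraction functor $[\mathcal{V}]A=(\mathcal{V}\times A)/\sim$, with $(x,a)\sim(x',a')$ iff some $y\notin\mathrm{supp}(a)\cup\mathrm{supp}(a')\cup\{x,x'\}$ satisfies $(x\,y)\cdot a=(x'\,y)\cdot a'$, action $\sigma\cdot\langle x\rangle a=\langle\sigma(x)\rangle(\sigma\cdot a)$. A mixed binding signature (MBS) is $(\Sigma,\mathrm{ar})$ with $\Sigma$ an at most countable set of constructors and $\mathrm{ar}:\Sigma\to(\mathbb{N}\times\{0,1\})^*$; for $\mathrm{ar}(c)=((n_1,b_1),\dots,(n_k,b_k))$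 argument $i$ binds $n_i$ variables and is inductive ($b_i=0$) or coinductive ($b_i=1$). Term functor (on $\mathbf{Set}$ or $\mathbf{Nom}$): $T_\Sigma(X,Y)=\mathcal{V}+\coprod_c\prod_{i=1}^k\mathcal{V}^{n_i}\times\pi_{b_i}(X,Y)$ with $\pi_0(X,Y)=X$, $\pi_1(X,Y)=Y$; quotient term functor on $\mathbf{Nom}$: $T^\alpha_\Sigma(X,Y)=\mathcal{V}+\coprod_c\prod_{i=1}^k[\mathcal{V}]^{n_i}\pi_{b_i}(X,Y)$. $\mu$ and $\nu$ denote initial algebras and terminal coalgebras. Raw finite terms $T_\Sigma=\mu Z.T_\Sigma(Z,Z)$: finite trees of variables and nodes $c(\bar x_1.t_1,\dots,\bar x_k.t_k)$, $\bar x_i\in\mathcal{V}^{n_i}$. Raw mixed terms $T_\Sigma^\infty=\nu Y.\mu X.T_\Sigma(X,Y)$ (in $\mathbf{Set}$): possibly infinite such trees where every infinite branch passes through infinitely many coinductive positions. Permutations act (inductively on finite, coinductively on mixed terms) by $\sigma\cdot x=\sigma(x)$, $\sigma\cdot c(\bar x_1.t_1,\dots)=c(\sigma(\bar x_1).\sigma\cdot t_1,\dots)$; the support of a mixed term, when finite, is the set of variables occurring in it. $(T_\Sigma^\infty)_{\mathrm{ffv}}$ is the set of mixed terms with finitely many free variables. $\alpha$-equivalence on finite terms (also over $\Sigma\cup\{*\}$, $*$ a new constant): $x\approx_\alpha x$, $*\approx_\alpha *$, and $c(\bar x_1.t_1,\dots)\approx_\alpha c(\bar y_1.u_1,\dots)$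 whenever $(\bar x_i\,\bar z_i)\cdot t_i\approx_\alpha(\bar y_i\,\bar z_i)\cdot u_i$ for fresh $\bar z_i$, for all $i$. Truncation: $[t]_0=*$, $[x]_{n+1}=x$, $[c(\bar x_1.t_1,\dots,\bar x_k.t_k)]_{n+1}=c(\bar x_1.[t_1]_{n+1-b_1},\dots,\bar x_k.[t_k]_{n+1-b_k})$. Mixed terms $t,u$ are $\alpha$-equivalent iff $[t]_n\approx_\alpha[u]_n$ for all $n$. Arnold–Nivat metric $d(t,u)=\inf\{2^{-n}:[t]_n=[u]_n\}$; on $T_\Sigma/{\approx_\alpha}$, $d_\alpha(t,u)=\inf\{2^{-n}:[t]_n\approx_\alpha[u]_n\}$, with Cauchy completion $(T_\Sigma/{\approx_\alpha})^\infty$ (carrying the induced permutation action). The nominal metric completion of a nominal set with an equivariant metric is obtained by adding the limits of all finitely supported Cauchy sequences (sequences whose elements' supports are all contained in a common finite set). *)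

(* Defs.v *)
From Stdlib Require Import Relation_Operators.
From mathcomp Require Import all_boot all_order all_algebra.
From mathcomp Require Import all_classical all_reals.
From mathcomp Require Import topology normedtype sequences.

Set Implicit Arguments.
Unset Strict Implicit.
Unset Printing Implicit Defensive.

Import Order.TTheory GRing.Theory Num.Theory.
Import numFieldNormedType.Exports.

Local Open Scope classical_set_scope.

Lemma sig_ext (T : Type) (P : T -> Prop) (a b : {x | P x}) :
  sval a = sval b -> a = b.
Proof.
case: a b => [x px] [y py] /= xy; case: y / xy py => py.
by congr exist; apply: Prop_irrelevance.
Qed.

(* The quotient of T by the equivalence relation generated by r, as the type
   of equivalence classes. *)
Section Quotient.
Context {T : Type} (r : T -> T -> Prop).

Definition quot := {P : T -> Prop | exists x, P = clos_refl_sym_trans T r x}.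

Definition qpi (x : T) : quot := exist _ _ (ex_intro _ x erefl).

Lemma qpi_surj (p : quot) : exists x, qpi x = p.
Proof.
by case: p => P [x Px]; exists x; apply: sig_ext; symmetry.
Qed.

Lemma qpi_eqP x y : qpi x = qpi y <-> clos_refl_sym_trans T r x y.
Proof.
split=> [/(congr1 sval)/= ->|xy]; first exact: rst_refl.
apply: sig_ext => /=; apply/funext => z; apply/propext.
by split=> h; apply: rst_trans h => //; apply: rst_sym.
Qed.

Lemma qpi_eq x y : r x y -> qpi x = qpi y.
Proof. by move=> xy; apply/qpi_eqP; apply: rst_step. Qed.

Definition qrepr (p : quot) : T := sval (cid (qpi_surj p)).

Lemma qreprK p : qpi (qrepr p) = p.
Proof. by rewrite /qrepr; case: cid. Qed.

Definition qlift (U : Type) (f : T -> U) (p : quot) : U := f (qrepr p).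

Lemma qliftE (U : Type) (f : T -> U) :
  (forall x y, r x y -> f x = f y) -> forall x, qlift f (qpi x) = f x.
Proof.
have E (x y : T) : (forall a b, r a b -> f a = f b) ->
    clos_refl_sym_trans T r x y -> f x = f y.
  by move=> fr; elim=> [a b /fr|a|a b _ ->|a b c _ -> _ ->].
by move=> fr x; apply: E => //; apply/qpi_eqP/qreprK.
Qed.

End Quotient.

Arguments quot {T} r.
Arguments qpi {T} r x.
Arguments qlift {T r U} f p.

Section Perm.
Context {V : eqType}.

Definition transp (x y z : V) : V :=
  if z == x then y else if z == y then x else z.

Definition swaps (s : seq (V * V)) : V -> V :=
  foldr (fun p f => transp p.1 p.2 \o f) id s.

Record vperm := VPerm {
  vfun :> V -> V;
  vfun_gen : exists s, vfun = swaps s }.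

Lemma vperm_ext (s t : vperm) : s =1 t -> s = t.
Proof.
case: s t => [f fP] [g gP] /= /funext fg; case: g / fg gP => gP.
by congr VPerm; apply: Prop_irrelevance.
Qed.

Lemma vperm_app (s t : vperm) x : s = t -> s x = t x.
Proof. by move=> ->. Qed.

Definition pid : vperm := VPerm (ex_intro _ [::] erefl).

Lemma swaps_cat s t : swaps (s ++ t) = swaps s \o swaps t.
Proof. by elim: s => //= p s ->. Qed.

Lemma pmul_subproof (s t : vperm) : exists l, s \o t = swaps l.
Proof.
have [u su] := vfun_gen s; have [v tv] := vfun_gen t; exists (u ++ v).
by rewrite swaps_cat su tv.
Qed.
Definition pmul (s t : vperm) : vperm := VPerm (pmul_subproof s t).

Definition pswap (x y : V) : vperm := VPerm (ex_intro _ [:: (x, y)] erefl).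

(* The multiple transposition (xs zs) is (x1 z1) o ... o (xn zn): when xs has
   repeated entries, the last (innermost) one takes precedence. *)
Definition pswaps (xs zs : seq V) : vperm :=
  VPerm (ex_intro _ (zip xs zs) erefl).

Lemma swapK x y : involutive (transp x y).
Proof.
move=> z; rewrite /transp.
have [->|zx] := eqVneq z x; first by case: eqVneq => [->|]; rewrite ?eqxx.
have [->|zy] := eqVneq z y; first by rewrite eqxx.
by rewrite (negbTE zx) (negbTE zy).
Qed.

Lemma vperm_inv (s : vperm) : exists t, pmul s t = pid /\ pmul t s = pid.
Proof.
case: s => [f fP]; have [l fl] := fP.
exists (VPerm (ex_intro _ (rev l) erefl)).
suff h : (swaps l \o swaps (rev l) = id) /\ (swaps (rev l) \o swaps l = id).
  by case: h => h1 h2; split; apply: vperm_ext => x /=; rewrite fl;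
    [rewrite -[RHS](congr1 (@^~ x) h1)|rewrite -[RHS](congr1 (@^~ x) h2)].
elim: l {f fP fl} => //= p l [h1 h2].
rewrite rev_cons -cats1 swaps_cat /=; split; apply/funext => x /=.
  by rewrite -[swaps l _]/((swaps l \o swaps (rev l)) _) h1 /= swapK.
by rewrite swapK -[swaps _ _]/((swaps (rev l) \o swaps l) _) h2.
Qed.

End Perm.

Arguments vperm V : clear implicits.

Record pset (V : eqType) := PSet {
  carrier :> Type;
  act : vperm V -> carrier -> carrier;
  act1 : forall a, act pid a = a;
  actM : forall s t a, act (pmul s t) a = act s (act t a) }.

Arguments act {V p}.

Section Nominal.
Context {V : eqType}.
Implicit Types (A B C : pset V).

Definition supports A (S : seq V) (a : A) :=
  forall s : vperm V, (forall x, x \in S -> s x = x) -> act s a = a.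

(* The least finite support of a, when a has a finite support and V is
   infinite: see supp_supports. *)
Definition supp A (a : A) : set V :=
  [set x | forall S, supports S a -> x \in S].

Lemma actK A (s t : vperm V) (a : A) : pmul s t = pid -> act s (act t a) = a.
Proof. by move=> st; rewrite -actM st act1. Qed.

Lemma supports_act A (S : seq V) (a : A) (s : vperm V) :
  supports S a -> supports (map s S) (act s a).
Proof.
move=> Sa t tS; have [s' [ss' s's]] := vperm_inv s.
rewrite -[RHS](congr1 (act s) (Sa (pmul s' (pmul t s)) _)).
  by rewrite !actM (actK _ ss').
move=> x xS /=; rewrite tS ?map_f//.
exact: (vperm_app x s's).
Qed.

Lemma supports_sub A (S S' : seq V) (a : A) :
  {subset S <= S'} -> supports S a -> supports S' a.
Proof. by move=> SS' Sa s sS'; apply: Sa => x /SS' /sS'. Qed.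

Lemma supp_act A (a : A) (s : vperm V) x : supp a x -> supp (act s a) (s x).
Proof.
move=> ax S Ssa; have [s' [ss' s's]] := vperm_inv s.
have /ax : supports (map s' S) a.
  by rewrite -(actK a s's); apply: supports_act.
by case/mapP => y yS ->; have /= -> := vperm_app y ss'.
Qed.

Lemma supp_actE A (a : A) (s : vperm V) x : supp (act s a) (s x) <-> supp a x.
Proof.
split; last exact: supp_act.
have [s' [ss' s's]] := vperm_inv s.
by move=> /(supp_act (s := s')); rewrite actK//; have /= -> := vperm_app x s's.
Qed.

Lemma vperm_finite (s : vperm V) : exists S : seq V, forall x, x \notin S -> s x = x.
Proof.
have [l ->] := vfun_gen s; exists (unzip1 l ++ unzip2 l).
elim: l => //= p l IH x; rewrite inE mem_cat inE !negb_or.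
move=> /and4P[xp1 xl1 xp2 xl2]; rewrite IH; last by rewrite mem_cat negb_or xl1.
by rewrite /transp (negbTE xp1) (negbTE xp2).
Qed.

Lemma supp_supports A (Vinf : infinite_set [set: V]) (S : seq V) (a : A) :
  supports S a -> exists2 S', supports S' a & forall x, x \in S' <-> supp a x.
Proof.
have fresh (W : seq V) : exists z, z \notin W.
  apply/not_existsP => h; apply: Vinf.
  apply: sub_finite_set (finite_seq W) => z _ /=.
  by have /negP := h z; rewrite negbK.
have rem1 W x : supports W a -> ~ supp a x -> supports [seq y <- W | y != x] a.
  move=> Wa /existsNP[S' /not_implyP[S'a /negP xS']] s sW.
  have [F sF] := vperm_finite s.
  have [z] := fresh (x :: W ++ S' ++ F).
  rewrite inE !mem_cat !negb_or => /and4P[zx zW zS' zF].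
  have xza : act (pswap x z) a = a.
    apply: S'a => y yS'; rewrite /= /transp.
    by case: eqP yS' xS' => [-> ->//|_ yS' _]; case: eqP yS' zS' => [-> ->|].
  have xz2 : pmul (pswap x z) (pswap x z) = pid :> vperm V.
    by apply: vperm_ext => y; rewrite /= swapK.
  have : act (pmul (pswap x z) (pmul s (pswap x z))) a = a.
    apply: Wa => y yW; rewrite /= {2}/transp.
    have [->|yx] := eqVneq y x; first by rewrite sF// /transp eqxx (negbTE zx).
    have [yz|yz] := eqVneq y z; first by rewrite -yz yW in zW.
    by rewrite sW ?mem_filter ?yx// /transp (negbTE yx) (negbTE yz).
  by rewrite !actM xza => /(congr1 (act (pswap x z))); rewrite (actK _ xz2) xza.
move=> Sa; suff : forall l : seq V, exists2 S', supports S' a &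
    forall x, x \in S' -> supp a x \/ (x \in S /\ x \notin l).
  move=> /(_ S)[S' S'a S'P]; exists S' => // x.
  by split=> [/S'P[//|[-> //]]|]; apply.
elim=> [|x l [S' S'a S'P]]; first by exists S => // x xS; right.
have [ax|ax] := pselect (supp a x).
  exists S' => // y /S'P[|[yS yl]]; first by left.
  have [->|yx] := eqVneq y x; first by left.
  by right; rewrite inE (negbTE yx).
exists [seq y <- S' | y != x]; first exact: rem1.
move=> y; rewrite mem_filter => /andP[yx /S'P[|[yS yl]]]; first by left.
by right; rewrite inE (negbTE yx).
Qed.

End Nominal.

Record nom (V : eqType) := Nom {
  npset :> pset V;
  nomP : forall a : npset, exists S : seq V, supports S a }.

Record nhom (V : eqType) (A B : pset V) := Hom {
  hfun :> A -> B;
  homP : forall s a, hfun (act s a) = act s (hfun a) }.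

Section NomCategory.
Context {V : eqType}.

Lemma hom_ext (A B : pset V) (f g : nhom A B) : f =1 g -> f = g.
Proof.
case: f g => [f fP] [g gP] /= /funext fg; case: g / fg gP => gP.
by congr Hom; apply: Prop_irrelevance.
Qed.

Definition hid (A : pset V) : nhom A A := @Hom V A A id (fun _ _ => erefl).

Lemma hcomp_subproof (A B C : pset V) (g : nhom B C) (f : nhom A B) s a :
  (g \o f) (act s a) = act s ((g \o f) a).
Proof. by rewrite /= !homP. Qed.
Definition hcomp (A B C : pset V) (g : nhom B C) (f : nhom A B) : nhom A C :=
  Hom (hcomp_subproof g f).

Record functor := Functor {
  fobj :> nom V -> nom V;
  fmap : forall X Y : nom V, nhom X Y -> nhom (fobj X) (fobj Y);
  fmap1 : forall X : nom V, fmap (hid X) = hid (fobj X);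
  fmapM : forall (X Y Z : nom V) (g : nhom Y Z) (f : nhom X Y),
    fmap (hcomp g f) = hcomp (fmap g) (fmap f) }.

Record bifunctor := Bifunctor {
  bobj :> nom V -> nom V -> nom V;
  bmap : forall X X' Y Y' : nom V,
    nhom X X' -> nhom Y Y' -> nhom (bobj X Y) (bobj X' Y');
  bmap1 : forall X Y : nom V, bmap (hid X) (hid Y) = hid (bobj X Y);
  bmapM : forall (X X' X'' Y Y' Y'' : nom V) (g : nhom X' X'') (f : nhom X X')
      (k : nhom Y' Y'') (h : nhom Y Y'),
    bmap (hcomp g f) (hcomp k h) = hcomp (bmap g k) (bmap f h) }.

Program Definition slice (F : bifunctor) (Y : nom V) : functor :=
  @Functor (fun X => F X Y) (fun X X' f => bmap F f (hid Y)) _ _.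
Next Obligation. by move=> F Y X; apply: bmap1. Qed.
Next Obligation.
move=> F Y X X' X'' g f; rewrite -bmapM; congr (bmap _ _ _).
exact: hom_ext.
Qed.

Definition initial_algebra (F : functor) (A : nom V) (a : nhom (F A) A) :=
  forall (B : nom V) (b : nhom (F B) B),
    exists! h : nhom A B, hcomp h a = hcomp b (fmap F h).

Definition terminal_coalgebra (F : functor) (B : nom V) (b : nhom B (F B)) :=
  forall (C : nom V) (c : nhom C (F C)),
    exists! h : nhom C B, hcomp b h = hcomp (fmap F h) c.

(* A choice of initial algebras mu X. F(X,Y), for all Y. *)
Record mu_of (F : bifunctor) := MuOf {
  mu_obj :> nom V -> nom V;
  mu_in : forall Y : nom V, nhom (F (mu_obj Y) Y) (mu_obj Y);
  mu_init : forall Y : nom V, @initial_algebra (slice F Y) (mu_obj Y) (mu_in Y) }.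

Section MuFunctor.
Context (F : bifunctor) (M : mu_of F).

Lemma mu_map_subproof (Y Y' : nom V) (g : nhom Y Y') : exists! h : nhom (M Y) (M Y'),
  hcomp h (mu_in M Y) = hcomp (mu_in M Y') (bmap F h g).
Proof.
have [h [hE hU]] :=
  mu_init M (Y := Y) (hcomp (mu_in M Y') (bmap F (hid (M Y')) g)).
have E (k : nhom (M Y) (M Y')) :
    hcomp (hcomp (mu_in M Y') (bmap F (hid (M Y')) g)) (fmap (slice F Y) k) =
    hcomp (mu_in M Y') (bmap F k g).
  have -> : bmap F k g = hcomp (bmap F (hid (M Y')) g) (bmap F k (hid Y)).
    by rewrite -bmapM; congr (bmap _ _ _); apply: hom_ext.
  exact: hom_ext.
by exists h; split=> [|k kE]; [rewrite hE E|apply: hU; rewrite kE E].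
Qed.

(* The action of Y |-> mu X. F(X,Y) on maps, by initiality. *)
Definition mu_map (Y Y' : nom V) (g : nhom Y Y') : nhom (M Y) (M Y') :=
  sval (cid (mu_map_subproof g)).

Lemma mu_mapE (Y Y' : nom V) (g : nhom Y Y') :
  hcomp (mu_map g) (mu_in M Y) = hcomp (mu_in M Y') (bmap F (mu_map g) g).
Proof. by rewrite /mu_map; case: cid => h []. Qed.

Lemma mu_map_uniq (Y Y' : nom V) (g : nhom Y Y') (h : nhom (M Y) (M Y')) :
  hcomp h (mu_in M Y) = hcomp (mu_in M Y') (bmap F h g) -> mu_map g = h.
Proof.
move=> hE; rewrite /mu_map; case: cid => k kP /=.
by case: (kP) => _ kU; apply: kU.
Qed.

Program Definition mu_functor : functor := @Functor M mu_map _ _.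
Next Obligation.
move=> Y; apply: mu_map_uniq; rewrite bmap1.
exact: hom_ext.
Qed.
Next Obligation.
move=> X Y Z g f; apply: mu_map_uniq; rewrite bmapM.
transitivity (hcomp (mu_map g) (hcomp (mu_map f) (mu_in M X))).
  exact: hom_ext.
rewrite mu_mapE; transitivity
  (hcomp (hcomp (mu_map g) (mu_in M Y)) (bmap F (mu_map f) f)).
  exact: hom_ext.
by rewrite mu_mapE; apply: hom_ext.
Qed.

End MuFunctor.

End NomCategory.

Arguments functor V : clear implicits.
Arguments bifunctor V : clear implicits.

Section NomConstructions.
Context {V : eqType}.

Section Fs.
Context (A : pset V).

Definition fs_type := {a : A | exists S, supports S a}.

Lemma fs_act_subproof (s : vperm V) (a : fs_type) :
  exists S, supports S (act s (sval a)).
Proof. by case: a => a [S Sa]; exists (map s S); apply: supports_act. Qed.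

Program Definition fs_pset : pset V :=
  @PSet V fs_type (fun s a => exist _ _ (fs_act_subproof s a)) _ _.
Next Obligation. by move=> a; apply: sig_ext; rewrite /= act1. Qed.
Next Obligation. by move=> s t a; apply: sig_ext; rewrite /= actM. Qed.

Program Definition fs : nom V := @Nom V fs_pset _.
Next Obligation.
by case=> a [S Sa]; exists S => s sS; apply: sig_ext => /=; apply: Sa.
Qed.

Lemma fs_hom_subproof (B : nom V) (f : nhom B A) (b : B) :
  exists S, supports S (f b).
Proof.
by have [S Sb] := nomP b; exists S => s sS; rewrite -homP Sb.
Qed.

Program Definition fs_hom (B : nom V) (f : nhom B A) : nhom B fs :=
  @Hom V B fs (fun b => exist _ (f b) (fs_hom_subproof f b)) _.
Next Obligation. by move=> B f s b; apply: sig_ext; rewrite /= homP. Qed.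

End Fs.

Section QuotientPset.
Context (A : pset V) (r : A -> A -> Prop).
Context (rP : forall s a b, r a b -> r (act s a) (act s b)).

Definition qact (s : vperm V) : quot r -> quot r :=
  qlift (fun a => qpi r (act s a)).

Lemma qactE s a : qact s (qpi r a) = qpi r (act s a).
Proof. by rewrite /qact qliftE// => x y xy; apply/qpi_eq/rP. Qed.

Program Definition quot_pset : pset V := @PSet V (quot r) qact _ _.
Next Obligation. by move=> p; have [a <-] := qpi_surj p; rewrite qactE act1. Qed.
Next Obligation.
by move=> s t p; have [a <-] := qpi_surj p; rewrite !qactE actM.
Qed.

End QuotientPset.

Program Definition quot_nom (A : nom V) (r : A -> A -> Prop)
    (rP : forall s a b, r a b -> r (act s a) (act s b)) : nom V :=
  @Nom V (quot_pset rP) _.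
Next Obligation.
move=> A r rP p; have [a <-] := qpi_surj p; have [S Sa] := nomP a.
by exists S => s sS /=; rewrite qactE// Sa.
Qed.

Program Definition qpi_hom (A : nom V) (r : A -> A -> Prop)
    (rP : forall s a b, r a b -> r (act s a) (act s b)) : nhom A (quot_nom rP) :=
  @Hom V A (quot_nom rP) (qpi r) _.
Next Obligation. by move=> A r rP s a /=; rewrite qactE. Qed.

Program Definition prod_pset (A B : pset V) : pset V :=
  @PSet V (A * B)%type (fun s ab => (act s ab.1, act s ab.2)) _ _.
Next Obligation. by move=> A B [a b] /=; rewrite !act1. Qed.
Next Obligation. by move=> A B s t [a b] /=; rewrite !actM. Qed.

Program Definition prod_nom (A B : nom V) : nom V := @Nom V (prod_pset A B) _.
Next Obligation.
move=> A B [a b]; have [S Sa] := nomP a; have [S' Sb] := nomP b.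
exists (S ++ S') => s sS /=; rewrite (Sa s) ?(Sb s)// => x xS;
  by apply: sS; rewrite mem_cat xS ?orbT.
Qed.

Program Definition var_nom : nom V :=
  @Nom V (@PSet V V (fun s x => s x) _ _) _.
Next Obligation. by []. Qed.
Next Obligation. by []. Qed.
Next Obligation. by move=> x; exists [:: x] => s; apply; rewrite inE. Qed.

Program Definition vars_nom (n : nat) : nom V :=
  @Nom V (@PSet V (n.-tuple V) (fun s xs => [tuple of map s xs]) _ _) _.
Next Obligation. by move=> n xs; apply: val_inj; rewrite /= map_id. Qed.
Next Obligation. by move=> n s t xs; apply: val_inj; rewrite /= map_comp. Qed.
Next Obligation.
move=> n xs; exists xs => s sS; apply: val_inj => /=.
by rewrite (eq_in_map _ id _).1 ?map_id.
Qed.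

Section Abstraction.
Context (A : nom V).

Definition abs_rel (xa yb : prod_nom var_nom A) : Prop :=
  exists z : V, [/\ ~ supp xa.2 z, ~ supp yb.2 z, z != xa.1, z != yb.1 &
    act (pswap xa.1 z) xa.2 = act (pswap yb.1 z) yb.2].

Lemma vperm_inj (s : vperm V) : injective s.
Proof.
have [s' [_ s's]] := vperm_inv s; apply: (@can_inj _ _ _ s') => x.
exact: (vperm_app x s's).
Qed.

Lemma swap_inj (f : V -> V) x y z : injective f ->
  f (transp x y z) = transp (f x) (f y) (f z).
Proof. by move=> fi; rewrite /transp !(inj_eq fi); do 2?case: ifP. Qed.

Lemma act_pswap (B : pset V) (s : vperm V) x z (b : B) :
  act s (act (pswap x z) b) = act (pswap (s x) (s z)) (act s b).
Proof.
rewrite -!actM; congr (act _ _); apply: vperm_ext => y /=.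
exact/swap_inj/vperm_inj.
Qed.

Lemma abs_relP s xa yb : abs_rel xa yb -> abs_rel (act s xa) (act s yb).
Proof.
case: xa yb => [x a] [y b] [z /= [za zb zx zy E]]; exists (s z); split=> /=.
- by move=> /supp_actE.
- by move=> /supp_actE.
- by rewrite (inj_eq (@vperm_inj s)).
- by rewrite (inj_eq (@vperm_inj s)).
- by rewrite -!act_pswap E.
Qed.

Definition abs_nom : nom V := quot_nom abs_relP.

Definition abst (x : V) (a : A) : abs_nom := qpi abs_rel (x, a).

End Abstraction.

Lemma supp_hom (A B : nom V) (f : nhom A B) (a : A) x : supp (f a) x -> supp a x.
Proof. by move=> h S Sa; apply: h => s sS; rewrite -homP Sa. Qed.

Definition abs_fun (A B : nom V) (f : nhom A B) : abs_nom A -> abs_nom B :=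
  qlift (fun xa => abst xa.1 (f xa.2)).

Lemma abs_funE (A B : nom V) (f : nhom A B) x a :
  abs_fun f (abst x a) = abst x (f a).
Proof.
rewrite /abs_fun /abst qliftE// => -[y b] [y' b'] [z /= [za zb zx zy E]].
apply: qpi_eq; exists z; split=> //=.
- by move=> /supp_hom.
- by move=> /supp_hom.
- by rewrite -!homP E.
Qed.

Lemma abst_surj (A : nom V) (p : abs_nom A) : exists x a, p = abst x a.
Proof. by have [[x a] <-] := qpi_surj p; exists x, a. Qed.

Lemma abst_act (A : nom V) s x (a : A) :
  act s (abst x a) = abst (s x) (act s a).
Proof. by rewrite /abst /= qactE//; apply: abs_relP. Qed.

Program Definition abs_map (A B : nom V) (f : nhom A B) :
  nhom (abs_nom A) (abs_nom B) := @Hom V (abs_nom A) (abs_nom B) (abs_fun f) _.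
Next Obligation.
move=> A B f s p; have [x [a ->]] := abst_surj p.
by rewrite abst_act !abs_funE abst_act homP.
Qed.

Fixpoint absn_nom (n : nat) (A : nom V) : nom V :=
  if n is m.+1 then abs_nom (absn_nom m A) else A.

Fixpoint abstn (n : nat) (A : nom V) : n.-tuple V -> A -> absn_nom n A :=
  match n with
  | 0 => fun _ a => a
  | m.+1 => fun xs a => abst (thead xs) (abstn [tuple of behead xs] a)
  end.

Fixpoint absn_map (n : nat) (A B : nom V) (f : nhom A B) :
    nhom (absn_nom n A) (absn_nom n B) :=
  match n with 0 => f | m.+1 => abs_map (absn_map m f) end.

Lemma absn_map1 n (A : nom V) : absn_map n (hid A) = hid (absn_nom n A).
Proof.
elim: n => //= n ->; apply: hom_ext => p /=.
by have [x [a ->]] := abst_surj p; rewrite abs_funE.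
Qed.

Lemma absn_mapM n (A B C : nom V) (g : nhom B C) (f : nhom A B) :
  absn_map n (hcomp g f) = hcomp (absn_map n g) (absn_map n f).
Proof.
elim: n => //= n ->; apply: hom_ext => p /=.
by have [x [a ->]] := abst_surj p; rewrite !abs_funE.
Qed.

End NomConstructions.

Record mbs := Mbs {
  constr :> countType;
  ar : constr -> seq (nat * bool) }.

Section Signature.
Context (V : eqType) (Sg : mbs).

(* Argument positions of c; argument i binds nbind i variables, and is
   coinductive iff coind i. *)
Definition slot (c : Sg) := 'I_(size (ar c)).
Definition nbind (c : Sg) (i : slot c) : nat := (tnth (in_tuple (ar c)) i).1.
Definition coind (c : Sg) (i : slot c) : bool := (tnth (in_tuple (ar c)) i).2.

Section SumProd.

Lemma fin_supports (I : finType) (H : I -> nom V) (a : forall i, H i) :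
  exists S, forall i, supports S (a i).
Proof.
have [S Sa] := choice (fun i => nomP (a i)).
exists (flatten [seq S i | i <- enum I]) => i; apply: supports_sub (Sa i) => x xS.
by apply/flattenP; exists (S i) => //; apply/map_f; rewrite mem_enum.
Qed.

Definition sp_type (H : forall c : Sg, slot c -> nom V) :=
  (V + {c : Sg & forall i : slot c, H c i})%type.

Definition sp_fun (H K : forall c : Sg, slot c -> nom V) (v : V -> V)
    (f : forall c (i : slot c), H c i -> K c i) (a : sp_type H) : sp_type K :=
  match a with
  | inl x => inl (v x)
  | inr (existT c t) => inr (existT _ c (fun i => f c i (t i)))
  end.

Program Definition sp_pset (H : forall c : Sg, slot c -> nom V) : pset V :=
  @PSet V (sp_type H)
    (fun s => @sp_fun H H s (fun c i => act s)) _ _.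
Next Obligation.
move=> H [x//|[c t]] /=; congr (inr (existT _ _ _)).
by apply/functional_extensionality_dep => i; rewrite act1.
Qed.
Next Obligation.
move=> H s s' [x//|[c t]] /=; congr (inr (existT _ _ _)).
by apply/functional_extensionality_dep => i; rewrite actM.
Qed.

Program Definition sp_nom (H : forall c : Sg, slot c -> nom V) : nom V :=
  @Nom V (sp_pset H) _.
Next Obligation.
move=> H [x|[c t]].
  by exists [:: x] => s sS /=; rewrite sS// inE.
have [S St] := fin_supports t; exists S => s sS /=; congr (inr (existT _ _ _)).
by apply/functional_extensionality_dep => i; apply: St.
Qed.

Program Definition sp_map (H K : forall c : Sg, slot c -> nom V)
    (f : forall c (i : slot c), nhom (H c i) (K c i)) : nhom (sp_nom H) (sp_nom K) :=
  @Hom V (sp_nom H) (sp_nom K) (@sp_fun H K id (fun c i => f c i)) _.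
Next Obligation.
move=> H K f s [x//|[c t]] /=; congr (inr (existT _ _ _)).
by apply/functional_extensionality_dep => i; rewrite homP.
Qed.

Lemma sp_map1 (H : forall c : Sg, slot c -> nom V) :
  @sp_map H H (fun c i => hid _) = hid _.
Proof. by apply: hom_ext => -[x//|[c t]]. Qed.

Lemma sp_mapM (H K L : forall c : Sg, slot c -> nom V)
    (g : forall c (i : slot c), nhom (K c i) (L c i))
    (f : forall c (i : slot c), nhom (H c i) (K c i)) :
  sp_map (fun c i => hcomp (g c i) (f c i)) = hcomp (sp_map g) (sp_map f).
Proof. by apply: hom_ext => -[x//|[c t]]. Qed.

End SumProd.

(* \pi_b *)
Definition sel (b : bool) (X Y : nom V) : nom V := if b then Y else X.

Definition sel_elt (b : bool) (X Y : nom V) (x : X) (y : Y) : sel b X Y :=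
  match b return sel b X Y with true => y | false => x end.

Definition sel_map (b : bool) (X X' Y Y' : nom V) (f : nhom X X') (g : nhom Y Y') :
    nhom (sel b X Y) (sel b X' Y') :=
  match b return nhom (sel b X Y) (sel b X' Y') with true => g | false => f end.

Program Definition prod_map (A B B' : nom V) (f : nhom B B') :
    nhom (prod_nom A B) (prod_nom A B') :=
  @Hom V (prod_nom A B) (prod_nom A B') (fun ab => (ab.1, f ab.2)) _.
Next Obligation. by move=> A B B' f s [a b] /=; rewrite homP. Qed.

(* T_Sigma(X,Y) *)
Program Definition term_functor : bifunctor V :=
  @Bifunctor V
    (fun X Y => sp_nom (fun c (i : slot c) =>
       prod_nom (vars_nom (nbind i)) (sel (coind i) X Y)))
    (fun X X' Y Y' f g => sp_map (fun c (i : slot c) =>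
       prod_map _ (sel_map (coind i) f g))) _ _.
Next Obligation.
move=> X Y; rewrite -sp_map1; congr sp_map.
apply/functional_extensionality_dep => c; apply/functional_extensionality_dep => i.
by case: (coind i); apply: hom_ext => -[].
Qed.
Next Obligation.
move=> X X' X'' Y Y' Y'' g f k h; rewrite -sp_mapM; congr sp_map.
apply/functional_extensionality_dep => c; apply/functional_extensionality_dep => i.
by case: (coind i); apply: hom_ext => -[].
Qed.

(* T^alpha_Sigma(X,Y) *)
Program Definition alpha_functor : bifunctor V :=
  @Bifunctor V
    (fun X Y => sp_nom (fun c (i : slot c) =>
       absn_nom (nbind i) (sel (coind i) X Y)))
    (fun X X' Y Y' f g => sp_map (fun c (i : slot c) =>
       absn_map (nbind i) (sel_map (coind i) f g))) _ _.
Next Obligation.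
move=> X Y; rewrite -sp_map1; congr sp_map.
apply/functional_extensionality_dep => c; apply/functional_extensionality_dep => i.
by case: (coind i); apply: absn_map1.
Qed.
Next Obligation.
move=> X X' X'' Y Y' Y'' g f k h; rewrite -sp_mapM; congr sp_map.
apply/functional_extensionality_dep => c; apply/functional_extensionality_dep => i.
by case: (coind i); apply: absn_mapM.
Qed.

Inductive term : Type :=
| Var (x : V)
| Node (c : Sg) (xs : forall i : slot c, (nbind i).-tuple V)
    (ts : forall i : slot c, term).

Fixpoint term_act (s : vperm V) (t : term) : term :=
  match t with
  | Var x => Var (s x)
  | Node c xs ts =>
      Node (fun i => [tuple of map s (xs i)]) (fun i => term_act s (ts i))
  end.

Lemma Node_ext c (xs ys : forall i : slot c, (nbind i).-tuple V) ts us :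
  (forall i, xs i = ys i) -> (forall i, ts i = us i) -> Node xs ts = Node ys us.
Proof.
by move=> h h'; congr Node; apply/functional_extensionality_dep.
Qed.

Program Definition term_pset : pset V := @PSet V term term_act _ _.
Next Obligation.
elim=> //= c xs ts IH; apply: Node_ext => // i.
by apply: val_inj; rewrite /= map_id.
Qed.
Next Obligation.
move=> s s'; elim=> //= c xs ts IH; apply: Node_ext => // i.
by apply: val_inj; rewrite /= map_comp.
Qed.

Program Definition term_nom : nom V := @Nom V term_pset _.
Next Obligation.
elim=> [x|c xs ts /choice[S Sts]].
  by exists [:: x] => s sS /=; rewrite sS// inE.
have [S' Sxs] := fin_supports (H := fun i => vars_nom (nbind i)) xs.
exists (S' ++ flatten [seq S i | i <- enum (slot c)]) => s sS /=.
apply: Node_ext => i.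
  by apply: (Sxs i) => x xS; rewrite sS// mem_cat xS.
apply: (Sts i) => x xS; rewrite sS// mem_cat; apply/orP; right.
by apply/flattenP; exists (S i) => //; apply/map_f; rewrite mem_enum.
Qed.

Definition fresh_tuple (n : nat) (zs : n.-tuple V) (xs ys : n.-tuple V)
    (t u : term_nom) : Prop :=
  uniq zs /\ forall z, z \in zs ->
    [/\ z \notin xs, z \notin ys, ~ supp t z & ~ supp u z].

Inductive aeq : term -> term -> Prop :=
| aeq_var x : aeq (Var x) (Var x)
| aeq_node c (xs ys zs : forall i : slot c, (nbind i).-tuple V) ts us :
    (forall i, fresh_tuple (zs i) (xs i) (ys i) (ts i) (us i)) ->
    (forall i, aeq (term_act (pswaps (xs i) (zs i)) (ts i))
                   (term_act (pswaps (ys i) (zs i)) (us i))) ->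
    aeq (Node xs ts) (Node ys us).

Lemma term_act_pswaps (s : vperm V) (xs zs : seq V) (t : term) :
  term_act s (term_act (pswaps xs zs) t) =
  term_act (pswaps (map s xs) (map s zs)) (term_act s t).
Proof.
rewrite -[LHS]/(@act V term_pset s (@act V term_pset (pswaps xs zs) t)).
rewrite -[RHS]/(@act V term_pset _ (@act V term_pset s t)).
rewrite -!actM; congr (@act V term_pset _ t); apply: vperm_ext => y /=.
elim: xs zs => [|x xs IH] [|z zs] //=.
by rewrite (swap_inj _ _ _ (@vperm_inj _ s)) IH.
Qed.

Lemma aeqP (s : vperm V) (t u : term) :
  aeq t u -> aeq (term_act s t) (term_act s u).
Proof.
elim=> [x|c xs ys zs ts us fr _ IH] /=; first exact: aeq_var.
apply: (aeq_node (zs := fun i => [tuple of map s (zs i)])) => i.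
  have [uz zP] := fr i; split=> [|_ /mapP[z /zP[zx zy zt zu] ->]].
    by rewrite map_inj_uniq//; apply: vperm_inj.
  split; rewrite ?mem_map//; try exact: vperm_inj.
  - by move=> /(supp_actE (A := term_pset)).
  - by move=> /(supp_actE (A := term_pset)).
by rewrite -!term_act_pswaps.
Qed.

Lemma fresh_seq (Vinf : infinite_set [set: V]) (S : seq V) n :
  exists zs : n.-tuple V, uniq zs /\ forall z, z \in zs -> z \notin S.
Proof.
elim: n => [|n [zs [uzs zsS]]]; first by exists [tuple].
have [z zS] : exists z, z \notin S ++ zs.
  apply/not_existsP => h; apply: Vinf.
  apply: sub_finite_set (finite_seq (S ++ zs)) => z _ /=.
  by have /negP := h z; rewrite negbK.
move: zS; rewrite mem_cat negb_or => /andP[zS zzs].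
exists [tuple of z :: zs]; split=> [|y]; first by rewrite /= zzs.
by rewrite inE => /orP[/eqP ->|/zsS].
Qed.

Lemma aeq_refl (Vinf : infinite_set [set: V]) (t : term) : aeq t t.
Proof.
elim: t => [x|c xs ts IH]; first exact: aeq_var.
have H (i : slot c) :
    exists zs : (nbind i).-tuple V, fresh_tuple zs (xs i) (xs i) (ts i) (ts i).
  have [S St] := nomP (ts i : term_nom).
  have [zs [uzs zsS]] := fresh_seq Vinf (S ++ xs i) (nbind i).
  exists zs; split=> // z /zsS; rewrite mem_cat negb_or => /andP[zS zx].
  by split=> // /(_ _ St); apply/negP.
apply: (aeq_node (zs := fun i => sval (cid (H i)))) => i.
  exact: (svalP (cid (H i))).
exact: aeqP.
Qed.

Definition aterm_nom : nom V := quot_nom (A := term_nom) aeqP.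

Definition aclass : nhom term_nom aterm_nom := qpi_hom (A := term_nom) aeqP.

(* mu X. T_Sigma(X,Y) in Set, see muT_initial below. *)
Inductive muT (Y : Type) : Type :=
| MVar (x : V)
| MNode (c : Sg) (xs : forall i : slot c, (nbind i).-tuple V)
    (ts : forall i : slot c, ~~ coind i -> muT Y)
    (us : forall i : slot c, coind i -> Y).

Arguments MVar {Y} x.
Arguments MNode {Y} [c] xs ts us.

Fixpoint muT_map (Y Z : Type) (v : V -> V) (f : Y -> Z) (p : muT Y) : muT Z :=
  match p with
  | MVar x => MVar (v x)
  | MNode c xs ts us =>
      MNode (fun i => [tuple of map v (xs i)])
        (fun i e => muT_map v f (ts i e)) (fun i e => f (us i e))
  end.

Lemma MNode_ext Y c (xs xs' : forall i : slot c, (nbind i).-tuple V)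
    (ts ts' : forall i, ~~ coind i -> muT Y) (us us' : forall i, coind i -> Y) :
  (forall i, xs i = xs' i) -> (forall i e, ts i e = ts' i e) ->
  (forall i e, us i e = us' i e) -> MNode xs ts us = MNode xs' ts' us'.
Proof.
move=> h0 h h'; congr MNode.
- exact/functional_extensionality_dep.
- by apply/functional_extensionality_dep => i; apply/funext => e.
- by apply/functional_extensionality_dep => i; apply/funext => e.
Qed.

Lemma muT_map_id Y (p : muT Y) : muT_map id id p = p.
Proof.
elim: p => //= c xs ts IH us; apply: MNode_ext => // i.
by apply: val_inj; rewrite /= map_id.
Qed.

Lemma muT_map_comp X Y Z (w v : V -> V) (g : Y -> Z) (f : X -> Y) (p : muT X) :
  muT_map w g (muT_map v f p) = muT_map (w \o v) (g \o f) p.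
Proof.
elim: p => //= c xs ts IH us; apply: MNode_ext => // i.
by apply: val_inj; rewrite /= map_comp.
Qed.

Definition set_term (X Y : Type) : Type :=
  (V + {c : Sg & forall i : slot c,
          (nbind i).-tuple V * (if coind i then Y else X)})%type.

Definition set_term_map (X X' Y : Type) (f : X -> X') (a : set_term X Y) :
    set_term X' Y :=
  match a with
  | inl x => inl x
  | inr (existT c t) => inr (existT _ c (fun i => ((t i).1,
      (if coind i as b return (if b then Y else X) -> (if b then Y else X')
       then id else f) (t i).2)))
  end.

Definition case_ind (X Y : Type) (b : bool) :
    ~~ b -> (if b then Y else X) -> X :=
  match b with true => fun e => False_rect _ (notF e) | false => fun _ => id end.

Definition case_coi (X Y : Type) (b : bool) :
    b -> (if b then Y else X) -> Y :=
  match b with true => fun _ => id | false => fun e => False_rect _ (notF e) end.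

Definition muT_in (Y : Type) (a : set_term (muT Y) Y) : muT Y :=
  match a with
  | inl x => MVar x
  | inr (existT c t) => MNode (fun i => (t i).1)
      (fun i e => case_ind e (t i).2) (fun i e => case_coi e (t i).2)
  end.

Definition case_intro (X Y : Type) (b : bool) :
    (~~ b -> X) -> (b -> Y) -> (if b then Y else X) :=
  match b with true => fun _ g => g isT | false => fun f _ => f isT end.

Lemma muT_initial (Y B : Type) (f : set_term B Y -> B) :
  exists! h : muT Y -> B, forall a, h (muT_in a) = f (set_term_map h a).
Proof.
pose h := fix h (p : muT Y) : B := match p with
  | MVar x => f (inl x)
  | MNode c xs ts us => f (inr (existT _ c (fun i =>
      (xs i, case_intro (fun e => h (ts i e)) (us i)))))
  end.
exists h; split=> [[x//|[c t]] /=|k kE].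
  congr (f (inr (existT _ c _))); apply/functional_extensionality_dep => i.
  by congr pair; case: (coind i) (t i).2.
apply/funext; elim=> [x|c xs ts IH us] /=; first by rewrite (kE (inl x)).
have -> : MNode xs ts us = muT_in (inr (existT _ c (fun i =>
    (xs i, case_intro (ts i) (us i))))).
  apply: MNode_ext => // i e /=; case: (coind i) (ts i) (us i) e => //= g g' e;
    by rewrite (bool_irrelevance e isT).
rewrite kE /=; congr (f (inr (existT _ c _))).
apply/functional_extensionality_dep => i; congr pair.
case: (coind i) (ts i) (us i) (IH i) => //= g g' gE; exact: gE.
Qed.

(* nu Y. mu X. T_Sigma(X,Y) in Set.  The coinductive type below presents an
   element of muT Y as its shape, with holes at the coinductive positions,
   together with a filling of these holes; since Leibniz equality on a
   coinductive type is finer than bisimilarity, it is then quotiented. *)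

Fixpoint hole (p : muT unit) : Type :=
  match p with
  | MVar _ => Empty_set
  | MNode c xs ts us =>
      ({i : slot c & {e : ~~ coind i & hole (ts i e)}} +
       {i : slot c & is_true (coind i)})%type
  end.

Fixpoint fill (Y : Type) (p : muT unit) : (hole p -> Y) -> muT Y :=
  match p with
  | MVar x => fun _ => MVar x
  | MNode c xs ts us => fun k =>
      MNode xs
        (fun i e => fill (fun h => k (inl (existT _ i (existT _ e h)))))
        (fun i e => k (inr (existT _ i e)))
  end.

Definition shape (Y : Type) : muT Y -> muT unit := muT_map id (fun=> tt).

Fixpoint content (Y : Type) (p : muT Y) : hole (shape p) -> Y :=
  match p return hole (shape p) -> Y with
  | MVar x => fun h => match h with end
  | MNode c xs ts us => fun h =>
      match h with
      | inl (existT i (existT e h')) => content h'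
      | inr (existT i e) => us i e
      end
  end.

CoInductive mtree : Type := MTree (p : muT unit) (k : hole p -> mtree).

Definition mtree_out (t : mtree) : muT mtree :=
  let: MTree p k := t in fill k.

CoFixpoint mtree_unfold (Y : Type) (g : Y -> muT Y) (y : Y) : mtree :=
  MTree (fun h : hole (shape (g y)) => mtree_unfold g (content h)).

(* Bisimilarity: t and u are related by some r such that r-related trees have
   unfoldings which become equal modulo r. *)
Definition bisim (t u : mtree) : Prop :=
  exists2 r : mtree -> mtree -> Prop,
    forall a b, r a b ->
      muT_map id (qpi r) (mtree_out a) = muT_map id (qpi r) (mtree_out b) &
    r t u.

Definition mterm : Type := quot bisim.

Definition mout : mterm -> muT mterm :=
  qlift (fun t => muT_map id (qpi bisim) (mtree_out t)).

Definition munfold (Y : Type) (g : Y -> muT Y) (y : Y) : mterm :=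
  qpi bisim (mtree_unfold g y).


Lemma fill_content (Y Z : Type) (f : Y -> Z) (p : muT Y) :
  fill (fun h : hole (shape p) => f (content h)) = muT_map id f p.
Proof. by elim: p => //= c xs ts IH us; apply: MNode_ext => // i e; apply: IH. Qed.

Lemma muT_map_fill (Y Z : Type) (f : Y -> Z) (p : muT unit) (k : hole p -> Y) :
  muT_map id f (fill k) = fill (f \o k).
Proof.
elim: p k => //= c xs ts IH us k; apply: MNode_ext => i.
- by apply: val_inj; rewrite /= map_id.
- by move=> e; rewrite IH.
- by [].
Qed.

Lemma qpi_bisim (r : mtree -> mtree -> Prop) (p : muT mtree) :
  (forall a b, bisim a b -> r a b) ->
  muT_map id (qpi r) p = muT_map id (qlift (qpi r)) (muT_map id (qpi bisim) p).
Proof.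
move=> br; rewrite muT_map_comp; congr (muT_map id _ p).
by apply/funext => t /=; rewrite qliftE// => a b /br; apply: qpi_eq.
Qed.

Lemma bisim_out a b : bisim a b ->
  muT_map id (qpi bisim) (mtree_out a) = muT_map id (qpi bisim) (mtree_out b).
Proof.
case=> r rP rab.
have E p : muT_map id (qpi bisim) p =
    muT_map id (qlift (qpi bisim)) (muT_map id (qpi r) p).
  rewrite muT_map_comp; congr (muT_map id _ p); apply/funext => t /=.
  by rewrite qliftE// => u v ruv; apply: qpi_eq; exists r.
by rewrite !E (rP _ _ rab).
Qed.

Lemma moutE t : mout (qpi bisim t) = muT_map id (qpi bisim) (mtree_out t).
Proof. exact/qliftE/bisim_out. Qed.

Lemma mout_munfold (Y : Type) (g : Y -> muT Y) (y : Y) :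
  mout (munfold g y) = muT_map id (munfold g) (g y).
Proof. by rewrite moutE /= muT_map_fill; apply: fill_content. Qed.

Lemma munfold_uniq (Y : Type) (g : Y -> muT Y) (h h' : Y -> mterm) :
  (forall y, mout (h y) = muT_map id h (g y)) ->
  (forall y, mout (h' y) = muT_map id h' (g y)) -> h =1 h'.
Proof.
move=> hE hE' y.
have [a ay] := qpi_surj (h y); have [b bE] := qpi_surj (h' y).
rewrite -ay -bE; apply: qpi_eq.
pose r t u := bisim t u \/ exists2 z, qpi bisim t = h z & qpi bisim u = h' z.
have br u v : bisim u v -> r u v by left.
exists r; last by right; exists y.
move=> t u; rewrite !(qpi_bisim _ br) => -[/bisim_out -> //|[z tz uz]].
rewrite -!moutE tz uz hE hE' !muT_map_comp; congr (muT_map _ _ _).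
apply/funext => w /=.
have [a' a'w] := qpi_surj (h w); have [b' b'w] := qpi_surj (h' w).
rewrite -a'w -b'w !qliftE; try by move=> ? ? /br; apply: qpi_eq.
by apply: qpi_eq; right; exists w.
Qed.

(* mterm is nu Y. mu X. T_Sigma(X,Y) in Set. *)
Lemma mterm_terminal (Y : Type) (g : Y -> muT Y) :
  exists! h : Y -> mterm, forall y, mout (h y) = muT_map id h (g y).
Proof.
exists (munfold g); split=> [y|h hE]; first exact: mout_munfold.
apply/funext; apply: munfold_uniq hE; exact: mout_munfold.
Qed.

Definition mact (s : vperm V) : mterm -> mterm :=
  munfold (fun t => muT_map s id (mout t)).

Lemma mout_mact s t : mout (mact s t) = muT_map s (mact s) (mout t).
Proof. by rewrite mout_munfold muT_map_comp. Qed.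

Program Definition mterm_pset : pset V := @PSet V mterm mact _ _.
Next Obligation.
apply: (munfold_uniq (g := mout)) => t; last by rewrite muT_map_id.
by rewrite mout_mact.
Qed.
Next Obligation.
move=> s s'; apply: (munfold_uniq
  (g := fun t => muT_map (pmul s s') id (mout t))) => t.
  by rewrite mout_mact muT_map_comp.
by rewrite !mout_mact !muT_map_comp.
Qed.

Fixpoint term_out (t : term) : muT term :=
  match t with
  | Var x => MVar x
  | Node c xs ts => MNode xs (fun i _ => term_out (ts i)) (fun i _ => ts i)
  end.

Definition emb : term -> mterm := munfold term_out.

Program Definition emb_hom : nhom term_nom mterm_pset :=
  @Hom V term_nom mterm_pset emb _.
Next Obligation.
move=> s; apply: (munfold_uniq (g := fun t => muT_map s id (term_out t))) => t.
  rewrite /emb mout_munfold muT_map_comp; elim: t => //= c xs ts IH.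
  by apply: MNode_ext => // i; apply: val_inj; rewrite /= -map_comp.
rewrite -[mout _]/(mout (mact s (emb t))) mout_mact /emb mout_munfold.
by rewrite !muT_map_comp.
Qed.

Inductive free_in (x : V) : muT mterm -> Prop :=
| free_var : free_in x (MVar x)
| free_ind c xs ts us (i : slot c) (e : ~~ coind i) :
    x \notin xs i -> free_in x (ts i e) -> free_in x (MNode xs ts us)
| free_coi c xs ts us (i : slot c) (e : coind i) :
    x \notin xs i -> free_in x (mout (us i e)) -> free_in x (MNode xs ts us).

Definition fv (t : mterm) : set V := [set x | free_in x (mout t)].

Definition ffv_mterm := {t : mterm | finite_set (fv t)}.
End Signature.

Definition star_mbs (Sg : mbs) : mbs :=
  @Mbs (option Sg) (fun c => if c is Some c' then ar c' else [::]).

Section Truncation.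
Context (V : eqType) (Sg : mbs).

Definition no_slot (T : 'I_0 -> Type) (i : 'I_0) : T i :=
  False_rect _ (notF (ltn_ord i)).

Definition star : term V (star_mbs Sg) :=
  @Node V (star_mbs Sg) None (no_slot _) (no_slot _).

Fixpoint trunc (t : term V Sg) (n : nat) : term V (star_mbs Sg) :=
  if n is 0 then star else
  match t with
  | Var x => Var _ x
  | Node c xs ts =>
      @Node V (star_mbs Sg) (Some c) xs (fun i => trunc (ts i) (n - coind i))
  end.

Definition coind_case (U : Type) (b : bool) (f : ~~ b -> U) (g : b -> U) : U :=
  match b return (~~ b -> U) -> (b -> U) -> U with
  | true => fun _ g => g isT
  | false => fun f _ => f isT
  end f g.

Fixpoint muT_trunc (Y : Type) (f : Y -> term V (star_mbs Sg)) (p : muT V Sg Y) :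
    term V (star_mbs Sg) :=
  match p with
  | MVar x => Var _ x
  | MNode c xs ts us =>
      @Node V (star_mbs Sg) (Some c) xs (fun i =>
        coind_case (fun e => muT_trunc f (ts i e)) (fun e => f (us i e)))
  end.

(* [t]_n: the index is unchanged below inductive positions, and decremented
   below coinductive ones. *)
Fixpoint mtrunc (t : mterm V Sg) (n : nat) {struct n} : term V (star_mbs Sg) :=
  if n is m.+1 then muT_trunc (fun u => mtrunc u m) (mout t) else star.

Definition maeq (t u : mterm V Sg) : Prop :=
  forall n, aeq (mtrunc t n) (mtrunc u n).

Definition ffv_maeq (t u : ffv_mterm V Sg) : Prop := maeq (sval t) (sval u).

Lemma trunc_act (s : vperm V) (t : term V Sg) n :
  trunc (term_act s t) n = term_act s (trunc t n).
Proof.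
have star_act : star = term_act s star :> term V (star_mbs Sg) by apply: Node_ext => -[].
elim: t n => [x|c xs ts IH] [|n] //.
by rewrite /=; apply: Node_ext => i //; rewrite IH.
Qed.

End Truncation.

Local Open Scope ring_scope.

Section Metric.
Context {R : realType}.

Definition inf_dist (P : nat -> Prop) : R :=
  inf [set 2 ^- n | n in [set n | P n]].

Lemma inf_dist_total (P : nat -> Prop) : (forall n, P n) -> inf_dist P = 0.
Proof.
move=> PT; apply/eqP; rewrite eq_le; apply/andP; split; last first.
  apply: lb_le_inf; first by exists (2 ^- 0), 0%N => //; apply: PT.
  by move=> _ [n _ <-]; rewrite invr_ge0 exprn_ge0.
apply/ler_addgt0Pr => e e0; rewrite add0r.
have [n ne] : exists n : nat, (2 ^- n : R) < e.
  exists (Num.bound e^-1); rewrite -[ltRHS]invrK ltf_pV2 ?qualifE/= ?exprn_gt0//.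
    exact: upper_nthrootP.
  by rewrite invr_gt0.
apply: le_trans (ltW ne); apply: ge_inf; last by exists n => //; apply: PT.
by exists 0 => _ [k _ <-]; rewrite invr_ge0 exprn_ge0.
Qed.

Definition is_metric (A : Type) (d : A -> A -> R) : Prop :=
  [/\ forall x y, 0 <= d x y,
      forall x y, d x y = 0 <-> x = y,
      forall x y, d x y = d y x &
      forall x y z, d x z <= d x y + d y z].

Definition cauchy_seq (A : Type) (d : A -> A -> R) (u : nat -> A) : Prop :=
  forall e, 0 < e -> exists N, forall m n, (N <= m)%N -> (N <= n)%N ->
    d (u m) (u n) < e.

Definition limit_of (A : Type) (d : A -> A -> R) (u : nat -> A) (a : A) : Prop :=
  d (u n) a @[n --> \oo] --> (0 : R).

Definition is_completion (A B : Type) (dA : A -> A -> R) (dB : B -> B -> R)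
    (i : A -> B) : Prop :=
  [/\ is_metric dA, is_metric dB,
      forall x y, dB (i x) (i y) = dA x y,
      forall u, cauchy_seq dB u -> exists b, limit_of dB u b &
      forall b, exists u : nat -> A, limit_of dB (i \o u) b].

Section Nominal.
Context {V : eqType}.

Definition is_equivariant_metric (A : pset V) (d : A -> A -> R) : Prop :=
  is_metric d /\ forall s x y, d (act s x) (act s y) = d x y.

Definition fs_seq (A : pset V) (u : nat -> A) : Prop :=
  exists S : seq V, forall n x, supp (u n) x -> x \in S.

Definition is_nominal_completion (A B : nom V) (dA : A -> A -> R)
    (dB : B -> B -> R) (i : nhom A B) : Prop :=
  [/\ is_equivariant_metric dA, is_equivariant_metric dB,
      forall x y, dB (i x) (i y) = dA x y,
      forall u, fs_seq u -> cauchy_seq dA u -> exists b, limit_of dB (i \o u) b &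
      forall b, exists u : nat -> A,
        [/\ fs_seq u, cauchy_seq dA u & limit_of dB (i \o u) b]].

Section Completion.
Context (A : pset V) (d : A -> A -> R).
Context (dE : forall s x y, d (act s x) (act s y) = d x y).
Context (d0 : forall x, d x x = 0).

Definition cseq_type := {u : nat -> A | cauchy_seq d u}.

Lemma cseq_act_subproof (s : vperm V) (u : cseq_type) :
  cauchy_seq d (fun n => act s (sval u n)).
Proof.
case: u => u uP e /uP[N NP]; exists N => m n Nm Nn; rewrite dE; exact: NP.
Qed.

Program Definition cseq : pset V :=
  @PSet V cseq_type (fun s u => exist _ _ (cseq_act_subproof s u)) _ _.
Next Obligation.
by move=> u; apply: sig_ext; apply/funext => n; rewrite /= act1.
Qed.
Next Obligation.
by move=> s t u; apply: sig_ext; apply/funext => n; rewrite /= actM.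
Qed.

Definition cseq_rel (u v : cseq) : Prop :=
  d (sval u n) (sval v n) @[n --> \oo] --> (0 : R).

Lemma cseq_relP s u v : cseq_rel u v -> cseq_rel (act s u) (act s v).
Proof.
have E : (fun n => d (sval (act s u) n) (sval (act s v) n)) =
    (fun n => d (sval u n) (sval v n)) by apply/funext => n; rewrite /= dE.
by rewrite /cseq_rel E.
Qed.

Definition completion : pset V := quot_pset cseq_relP.

Definition completion_dist (p q : completion) : R :=
  limn (fun n => d (sval (qrepr p) n) (sval (qrepr q) n)).

Lemma cst_cauchy (a : A) : cauchy_seq d (fun=> a).
Proof. by move=> e e0; exists 0%N => m n _ _; rewrite d0. Qed.

Program Definition completion_in : nhom A completion :=
  @Hom V A completion (fun a => qpi cseq_rel (exist _ _ (cst_cauchy a))) _.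
Next Obligation.
move=> s a; rewrite /= qactE; last exact: cseq_relP.
by congr (qpi _ _); apply: sig_ext.
Qed.

End Completion.

End Nominal.

Section TermMetrics.
Context (V : eqType) (Sg : mbs).

Definition term_dist (t u : term V Sg) : R :=
  inf_dist (fun n => trunc t n = trunc u n).

Definition mterm_dist (t u : mterm V Sg) : R :=
  inf_dist (fun n => mtrunc t n = mtrunc u n).

Definition aterm_dist (p q : aterm_nom V Sg) : R :=
  inf_dist (fun n => exists t u : term_nom V Sg,
    [/\ p = aclass V Sg t, q = aclass V Sg u & aeq (trunc t n) (trunc u n)]).

Lemma aterm_dist_act s p q :
  aterm_dist (act s p) (act s q) = aterm_dist p q.
Proof.
have E s' p' q' n : (exists t u : term_nom V Sg,
      [/\ p' = aclass V Sg t, q' = aclass V Sg u & aeq (trunc t n) (trunc u n)]) ->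
    (exists t u : term_nom V Sg, [/\ act s' p' = aclass V Sg t,
      act s' q' = aclass V Sg u & aeq (trunc t n) (trunc u n)]).
  move=> [t [u [-> -> tu]]]; exists (act s' t), (act s' u); rewrite !homP.
  by split=> //; rewrite !trunc_act; apply: aeqP.
rewrite /aterm_dist; congr inf_dist; apply/funext => n; apply/propext.
split; last exact: E.
have [s' [_ s's]] := vperm_inv s.
by move=> /(E s'); rewrite !actK.
Qed.

Lemma aterm_dist0 (Vinf : infinite_set [set: V]) p : aterm_dist p p = 0.
Proof.
apply: inf_dist_total => n; have [t <-] := qpi_surj p.
by exists t, t; split=> //; apply: aeq_refl.
Qed.

Definition acomp : pset V := completion aterm_dist_act.

Definition acomp_dist : acomp -> acomp -> R :=
  @completion_dist V (aterm_nom V Sg) aterm_dist aterm_dist_act.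

Definition acomp_in (Vinf : infinite_set [set: V]) : nhom (aterm_nom V Sg) acomp :=
  completion_in aterm_dist_act (aterm_dist0 Vinf).

(* z is the canonical coalgebra structure on the finitely supported mixed
   terms: z (c(xs1.t1,...)) = c(xs1.t1',...), where ti' is ti if argument i is
   coinductive and z ti otherwise. *)
Definition mterm_unfolding (M : mu_of (term_functor V Sg))
    (z : nhom (fs (mterm_pset V Sg)) (M (fs (mterm_pset V Sg)))) : Prop :=
  (forall (t : fs (mterm_pset V Sg)) x, mout (sval t) = MVar _ _ x ->
     z t = mu_in M _ (inl x)) /\
  (forall (t : fs (mterm_pset V Sg)) (c : Sg)
       (xs : forall i : slot c, (nbind i).-tuple V)
       (ts : forall i : slot c, fs (mterm_pset V Sg)),
     mout (sval t) =
       MNode xs (fun i _ => mout (sval (ts i))) (fun i _ => sval (ts i)) ->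
     z t = mu_in M _ (inr (existT _ c (fun i =>
             (xs i, sel_elt (coind i) (z (ts i)) (ts i)))))).

(* The same for the completion of T_Sigma modulo alpha-equivalence, on which
   the constructors are extended by continuity. *)
Definition acomp_unfolding (Vinf : infinite_set [set: V])
    (M : mu_of (alpha_functor V Sg)) (z : nhom (fs acomp) (M (fs acomp))) : Prop :=
  let lim (u : nat -> term_nom V Sg) (p : fs acomp) :=
    limit_of acomp_dist (fun n => acomp_in Vinf (aclass V Sg (u n))) (sval p) in
  (forall (p : fs acomp) x, lim (fun=> Var Sg x) p -> z p = mu_in M _ (inl x)) /\
  (forall (p : fs acomp) (c : Sg) (xs : forall i : slot c, (nbind i).-tuple V)
       (ts : slot c -> nat -> term_nom V Sg) (ps : slot c -> fs acomp),
     (forall i, lim (ts i) (ps i)) -> lim (fun n => Node xs (fun i => ts i n)) p ->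
     z p = mu_in M _ (inr (existT _ c (fun i =>
             abstn (xs i) (sel_elt (coind i) (z (ps i)) (ps i)))))).

End TermMetrics.
End Metric.

Definition is_pullback (P A B C : Type) (p : P -> A) (q : P -> B) (f : A -> C)
    (g : B -> C) : Prop :=
  f \o p = g \o q /\
  forall (Z : Type) (a : Z -> A) (b : Z -> B), f \o a = g \o b ->
    exists! h : Z -> P, p \o h = a /\ q \o h = b.

(* Main.v *)
Require Import Defs.
From mathcomp Require Import all_boot all_order all_algebra.
From mathcomp Require Import all_classical all_reals.
From mathcomp Require Import topology normedtype sequences.
From mathcomp Require Import lra.

Set Implicit Arguments.
Unset Strict Implicit.
Unset Printing Implicit Defensive.

Import Order.TTheory GRing.Theory Num.Theory.
Import numFieldNormedType.Exports.

Local Open Scope classical_set_scope.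
Local Open Scope ring_scope.

(* All four metrics have the form d(a,b) = inf {2^-n : lv n a = lv n b} for some
   observations lv n, the truncations at level n, with values in terms over
   Sigma + star or in their alpha-classes; being Cauchy, limits and completeness
   are then statements about eventually constant observations.  Since the
   truncations are equivariant, a limit is supported by S as soon as all its
   truncations are.

   The functor T^alpha is a quotient of T, so mu X. T^alpha(X,Y) is a quotient of
   mu X. T(X,Y).  Truncations at level n on Y induce, by initiality, maps on
   mu X. T^alpha(X,Y), which are jointly injective when the truncations on Y are:
   one choice of bound names, fresh for the two finite supports, serves all levels
   at once.  Hence the unfolding of a finitely supported limit p is the unique
   element of mu X. T^alpha(X, limits) with the same truncations as p, and
   coalgebra maps into the limits are determined by their truncations.  For
   existence, p is unfolded down to its coinductive positions along a finite term
   representing its truncation at level 1, using bound names outside the support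
   of p.  Iterating the unfolding shows that p is the class of a mixed term, whose
   free variables are those of its truncations. *)

(** The map from mixed terms to the completion of the alpha-classes need not be surjective: if the
    free variables of a limit exhaust a countable V, fresh bound names exist at each level, but no
    name serves all levels. Finite support removes this obstacle; unfolding, surjectivity onto the
    finitely supported limits and the pullback all hinge on it. A second obstacle is induction on
    terms: alpha-equivalence compares renamings of subterms, which are not subterms, so several
    inductions are stated for a term moved by an arbitrary permutation [s]. Third, the abstraction
    functor is itself a quotient that uses the nominal structure of its argument, so its initial
    algebra is not written as an inductive type but obtained from an impredicative relation. That
    relation yields initiality directly, yet says little about when two elements are equal; joint
    injectivity of the folds supplies this, and with it the equivariance of unfoldings that were
    merely chosen. *)

(** * Distances given by infima over levels of agreement *)

Section InfDist.
Context {R : realType}.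
Implicit Types (P : nat -> Prop).

Lemma exp2V_lt (e : R) : 0 < e -> exists n : nat, 2 ^- n < e.
Proof.
move=> e0; exists (Num.bound e^-1).
rewrite -[ltRHS]invrK ltf_pV2 ?qualifE/= ?exprn_gt0//; last by rewrite invr_gt0.
exact: upper_nthrootP.
Qed.

Lemma exp2V_gt0 n : 0 < 2 ^- n :> R.
Proof. by rewrite invr_gt0 exprn_gt0. Qed.

Lemma inf_dist_ge0 P : P 0%N -> 0 <= inf_dist P :> R.
Proof.
move=> P0; apply: lb_le_inf; first by exists (2 ^- 0), 0%N.
by move=> _ [n _ <-]; apply/ltW/exp2V_gt0.
Qed.

Lemma inf_dist_sub P P' : (forall n, P n -> P' n) -> P 0%N ->
  inf_dist P' <= inf_dist P :> R.
Proof.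
move=> PP' P0; apply: lb_le_inf; first by exists (2 ^- 0), 0%N.
move=> _ [n Pn <-]; apply: ge_inf; last by exists n => //; apply: PP'.
by exists 0 => _ [k _ <-]; apply/ltW/exp2V_gt0.
Qed.

Definition down_closed P := P 0%N /\ forall m n, (m <= n)%N -> P n -> P m.

(** By downward closure, a failure at [n.+1] leaves only levels at most [n], so the infimum is at
    least 2^-n, which exceeds 2^-(n+1). Failure at 0 is excluded. *)
Lemma inf_dist_le P n : down_closed P -> inf_dist P <= 2 ^- n :> R <-> P n.
Proof.
move=> [P0 Pm]; split=> [Pn|Pn]; last first.
  apply: ge_inf; last by exists n.
  by exists 0 => _ [k _ <-]; apply/ltW/exp2V_gt0.
apply: contrapT => nPn; case: n => [|n] // in Pn nPn *.
suff : 2 ^- n <= inf_dist P :> R.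
  move=> /le_trans/(_ Pn); rewrite lef_pV2 ?qualifE/= ?exprn_gt0//.
  by rewrite exprS ger_pMl ?exprn_gt0// leNgt ltr1n.
apply: lb_le_inf; first by exists (2 ^- 0), 0%N.
move=> _ [m Pm' <-]; rewrite lef_pV2 ?qualifE/= ?exprn_gt0// ler_eXn2l ?ltr1n//.
by rewrite leqNgt; apply/negP => /Pm/(_ Pm').
Qed.

(** If both predicates reach [n], both infima lie in [0, 2^-n]; otherwise both stop before [n] and
    they coincide. This controls the limit defining [completion_dist]. *)
Lemma inf_dist_near P P' n : down_closed P -> down_closed P' ->
  (forall m, (m <= n)%N -> P m <-> P' m) -> `|inf_dist P - inf_dist P'| <= 2 ^- n :> R.
Proof.
move=> dP dP' PP'; have [Pn|nPn] := pselect (P n).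
  have Pn' : P' n by apply/PP'.
  have l1 : inf_dist P <= 2 ^- n :> R by apply/(inf_dist_le n dP).
  have l2 : inf_dist P' <= 2 ^- n :> R by apply/(inf_dist_le n dP').
  have g1 := @inf_dist_ge0 P dP.1; have g2 := @inf_dist_ge0 P' dP'.1.
  by rewrite ler_norml; apply/andP; split; lra.
have lt (X : nat -> Prop) : down_closed X -> ~ X n -> forall m, X m -> (m <= n)%N.
  by move=> [_ dX] nX m Xm; rewrite leqNgt; apply/negP => /ltnW/dX/(_ Xm).
have -> : P = P'.
  apply/funext => m; apply/propext; split=> Pm.
    exact/PP'/Pm/(lt P).
  by apply/PP'; [apply: (lt P') => // /(PP' _ (leqnn n))|].
by rewrite subrr normr0 ltW// exp2V_gt0.
Qed.

Lemma inf_dist_eq0 P : down_closed P -> inf_dist P = 0 :> R <-> forall n, P n.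
Proof.
move=> dP; split=> [P0 n|]; last exact: inf_dist_total.
by apply/(inf_dist_le n dP); rewrite P0 ltW// exp2V_gt0.
Qed.

End InfDist.

(* A family of observations lv n : A -> Q of increasing precision induces an
   ultrametric on A. *)
Section Levels.
Context {R : realType} {A Q : Type}.

Definition refining (lv : nat -> A -> Q) := (forall a b, lv 0%N a = lv 0%N b) /\
  forall m n a b, (m <= n)%N -> lv n a = lv n b -> lv m a = lv m b.

Definition lv_dist (lv : nat -> A -> Q) (a b : A) : R :=
  inf_dist (fun n => lv n a = lv n b).

Context (lv : nat -> A -> Q) (rlv : refining lv).

Lemma refining_down a b : down_closed (fun n => lv n a = lv n b).
Proof. by split=> [|m n mn]; [apply: rlv.1|apply: rlv.2]. Qed.

Lemma lv_dist_le n a b : lv_dist lv a b <= 2 ^- n <-> lv n a = lv n b.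
Proof. exact/inf_dist_le/refining_down. Qed.

Lemma lv_dist_ge0 a b : 0 <= lv_dist lv a b.
Proof. exact/inf_dist_ge0/(rlv.1 a b). Qed.

Lemma lv_dist_metric :
  (forall a b, (forall n, lv n a = lv n b) -> a = b) -> is_metric (lv_dist lv).
Proof.
move=> sep; split=> [||x y|x y z]; first exact: lv_dist_ge0.
- move=> x y; rewrite (inf_dist_eq0 (refining_down x y)).
  by split=> [/sep//|->].
- by congr inf_dist; apply/funext => n; apply/propext; split=> ->.
(* The ultrametric inequality holds: two agreements pass to the smaller of their levels, where they
   compose. *)
suff : lv_dist lv x z <= Num.max (lv_dist lv x y) (lv_dist lv y z).
  by move=> /le_trans; apply; rewrite ge_max lerDl lerDr !lv_dist_ge0.
rewrite leNgt gt_max; apply/negP => /andP[].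
have lt (b c : A) e : lv_dist lv b c < e -> exists2 n, lv n b = lv n c & 2 ^- n < e.
  by case/inf_lt=> [|_ [n bc <-] ne]; [exists (2 ^- 0), 0%N => //; apply: rlv.1|exists n].
move=> /lt[n xy nxz] /lt[m yz mxz].
have xz k : (k <= n)%N -> (k <= m)%N -> lv_dist lv x z <= 2 ^- k.
  by move=> kn km; apply/lv_dist_le; rewrite (rlv.2 _ _ _ _ kn xy) (rlv.2 _ _ _ _ km yz).
have [nm|/ltnW mn] := leqP n m.
  by have := lt_le_trans nxz (xz n (leqnn n) nm); rewrite ltxx.
by have := lt_le_trans mxz (xz m mn (leqnn m)); rewrite ltxx.
Qed.

Lemma lv_cauchyP (u : nat -> A) : cauchy_seq (lv_dist lv) u <->
  forall n, exists N, forall k l, (N <= k)%N -> (N <= l)%N -> lv n (u k) = lv n (u l).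
Proof.
split=> [cu n|cu e /exp2V_lt[n ne]].
  have [N NP] := cu _ (exp2V_gt0 n).
  by exists N => k l kN lN; apply/lv_dist_le/ltW/NP.
have [N NP] := cu n; exists N => k l kN lN; apply: le_lt_trans ne.
exact/lv_dist_le/NP.
Qed.

Lemma lv_limitP (u : nat -> A) a : limit_of (lv_dist lv) u a <->
  forall n, exists N, forall k, (N <= k)%N -> lv n (u k) = lv n a.
Proof.
rewrite /limit_of; split=> [/cvgrPdist_le cu n|cu].
  have [N _ NP] := cu _ (exp2V_gt0 n); exists N => k /NP /=.
  by rewrite sub0r normrN ger0_norm ?lv_dist_ge0// => /lv_dist_le.
apply/cvgrPdist_le => e /exp2V_lt[n ne].
have [N NP] := cu n; exists N => // k /= /NP/lv_dist_le kN.
by rewrite sub0r normrN ger0_norm ?lv_dist_ge0// (le_trans kN)// ltW.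
Qed.

End Levels.

(** * Completions of ultrametrics given by observations *)

Section LevelCompletion.
Context {R : realType} {A B Q : Type}.
Context (lvA : nat -> A -> Q) (lvB : nat -> B -> Q).
Context (rA : refining lvA) (rB : refining lvB).

(** Only sequences whose level [n] is settled from index [n] on are tested; [lv_cauchy_limit]
    reindexes an arbitrary Cauchy sequence into this form. *)
Definition lv_complete := forall v : nat -> B,
  (forall n k, (n <= k)%N -> lvB n (v k) = lvB n (v n)) ->
  exists b, forall n, lvB n b = lvB n (v n).

Lemma lv_cauchy_limit (u : nat -> B) : lv_complete ->
  cauchy_seq (lv_dist (R := R) lvB) u -> exists b, limit_of (lv_dist (R := R) lvB) u b.
Proof.
move=> cB /(lv_cauchyP rB)/choice[N NP].
(* The maximum over all levels up to [k] makes the index [M k] late enough for every level n <=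
   k. *)
pose M n := (\max_(m < n.+1) N m)%N.
have NM m n : (m <= n)%N -> (N m <= M n)%N.
  by rewrite -ltnS => mn; apply: (leq_bigmax (Ordinal mn)).
have [n k nk|b bP] := cB (fun n => u (M n)); first by apply: NP; apply: NM.
exists b; apply/(lv_limitP rB) => n; exists (M n) => k kM.
by rewrite bP; apply: NP; [apply: leq_trans kM|]; apply: NM.
Qed.

Lemma lv_completion (i : A -> B) :
  (forall a b, (forall n, lvA n a = lvA n b) -> a = b) ->
  (forall a b, (forall n, lvB n a = lvB n b) -> a = b) ->
  (forall n a, lvB n (i a) = lvA n a) ->
  (forall b n, exists a, lvA n a = lvB n b) -> lv_complete ->
  is_completion (lv_dist (R := R) lvA) (lv_dist lvB) i.
Proof.
move=> sA sB iE dense cB; split; try exact: lv_dist_metric.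
- by move=> x y; congr inf_dist; apply/funext => n; rewrite !iE.
- by move=> u; apply: lv_cauchy_limit.
move=> b; have [u uP] := choice (dense b); exists u; apply/(lv_limitP rB) => n.
by exists n => k nk /=; apply: rB.2 nk _; rewrite iE uP.
Qed.

End LevelCompletion.

Section LevelNominalCompletion.
Context {R : realType} {V : eqType} (Vinf : infinite_set [set: V]).
Context {A : nom V} {B Q : pset V} (i : nhom A B).
Context (lvA : nat -> nhom A Q) (lvB : nat -> nhom B Q).
Context (rA : refining lvA) (rB : refining lvB).

Lemma lv_equivariant_metric (C : pset V) (lv : nat -> C -> Q) :
  (forall n s a, lv n (act s a) = act s (lv n a)) -> refining lv ->
  (forall a b, (forall n, lv n a = lv n b) -> a = b) ->
  is_equivariant_metric (lv_dist (R := R) lv).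
Proof.
move=> lvE rlv sep; split=> [|s x y]; first exact: lv_dist_metric.
congr inf_dist; apply/funext => n; apply/propext; rewrite !lvE.
split=> [|-> //]; have [t [_ ts]] := vperm_inv s.
by move=> /(congr1 (act t)); rewrite !actK.
Qed.

Lemma lv_nominal_completion :
  (forall a b, (forall n, lvA n a = lvA n b) -> a = b) ->
  (forall a b, (forall n, lvB n a = lvB n b) -> a = b) ->
  (forall n a, lvB n (i a) = lvA n a) ->
  (forall b : fs B, exists u : nat -> A,
     fs_seq u /\ forall n, lvA n (u n) = lvB n (sval b)) ->
  lv_complete lvB ->
  is_nominal_completion (lv_dist (R := R) lvA)
    (fun x y : fs B => lv_dist lvB (sval x) (sval y)) (fs_hom i).
Proof.
move=> sA sB iE dense cB.
pose lvF n (b : fs B) := lvB n (sval b).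
have rF : refining lvF by split=> [a b|m n a b mn]; [apply: rB.1|apply: rB.2].
split.
- apply: lv_equivariant_metric => // n s a; exact: homP.
- apply: (@lv_equivariant_metric (fs B) lvF) => // [n s a|a b ab].
    exact: (homP (lvB n)).
  by apply: sig_ext; apply: sB.
- by move=> x y; congr inf_dist; apply/funext => n /=; rewrite !iE.
- move=> u [S uS] /(lv_cauchyP rA) cu.
  have [|b bl] := lv_cauchy_limit (R := R) rB (u := i \o u) cB.
    apply/(lv_cauchyP rB) => n; have [N NP] := cu n; exists N => k l kN lN /=.
    by rewrite !iE; apply: NP.
  have Sb : supports S b.
    move=> s sS; apply: sB => n.
    have [N NP] := (lv_limitP rB _ _).1 bl n; rewrite homP -(NP N)//= -!homP.
    (* [fs_seq] bounds [supp], which is a genuine support because there are infinitely many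
       names. *)
    congr (lvB n (i _)); have [S0 S0u] := nomP (u N).
    have [S' S'u S'E] := supp_supports Vinf S0u; apply: S'u => x /S'E /uS; exact: sS.
  by exists (exist _ b (ex_intro _ S Sb)).
move=> b; have [u [fu uP]] := dense b; exists u; split=> //.
- apply/(lv_cauchyP rA) => n; exists n => k l nk nl.
  have E m : (n <= m)%N -> lvA n (u m) = lvB n (sval b).
    by move=> nm; rewrite -iE; apply: rB.2 nm _; rewrite iE.
  by rewrite !E.
apply/(lv_limitP rF) => n; exists n => k nk; rewrite /lvF /= iE -iE.
by apply: rB.2 nk _; rewrite iE.
Qed.

End LevelNominalCompletion.

(** * Observations on the Cauchy completion *)

Section Completion.
Context {R : realType} {V : eqType} {A : pset V} {Q : Type}.
Context (d : A -> A -> R) (dE : forall s x y, d (act s x) (act s y) = d x y).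
Context (lv : nat -> A -> Q) (rlv : refining lv) (dlv : d = lv_dist lv).

Lemma dlvE x y : d x y = lv_dist lv x y.
Proof. by rewrite dlv. Qed.

Lemma cseq_relE (u v : cseq dE) : cseq_rel u v <->
  forall n, exists N, forall k, (N <= k)%N -> lv n (sval u k) = lv n (sval v k).
Proof.
have E : (fun n => d (sval u n) (sval v n)) = (fun n => lv_dist lv (sval u n) (sval v n)).
  by apply/funext => n; rewrite dlvE.
rewrite /cseq_rel E {E}; split=> [/cvgrPdist_le uv n|uv].
  have [N _ NP] := uv _ (exp2V_gt0 n); exists N => k /NP /=.
  by rewrite sub0r normrN ger0_norm ?lv_dist_ge0// => /(lv_dist_le rlv).
apply/cvgrPdist_le => e /exp2V_lt[n ne].
have [N NP] := uv n; exists N => // k /= /NP/(lv_dist_le (R := R) rlv) kN.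
by rewrite sub0r normrN ger0_norm ?lv_dist_ge0// (le_trans kN)// ltW.
Qed.

Lemma clv_exists (p : completion dE) n : exists q, exists N,
  forall k, (N <= k)%N -> lv n (sval (qrepr p) k) = q.
Proof.
case: (qrepr p) => u /= cu; rewrite dlv in cu.
have [N NP] := (lv_cauchyP rlv u).1 cu n.
by exists (lv n (u N)), N => k kN; apply: NP.
Qed.

(* The eventual value of lv n along a Cauchy sequence representing p. *)
Definition clv n (p : completion dE) : Q := sval (cid (clv_exists p n)).

(** [qrepr] returns a representative tied to [u] only by a chain of [cseq_rel] steps; each step
    preserves eventual values, hence the induction on the generated equivalence. *)
Lemma clv_pi (u : cseq dE) n : exists N, forall k, (N <= k)%N ->
  lv n (sval u k) = clv n (qpi _ u).
Proof.
rewrite /clv; case: cid => q [N NP] /=.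
have /qpi_eqP := qreprK (qpi (@cseq_rel R V A d dE) u).
move: (qrepr _) NP => v NP vu.
have [M MP] : exists M, forall k, (M <= k)%N -> lv n (sval v k) = lv n (sval u k).
  elim: vu {NP} => {u v} [u v /cseq_relE//|u|u v _ [M MP]|u v w _ [M MP] _ [M' MP']].
  - by exists 0%N.
  - by exists M => k /MP.
  exists (maxn M M') => k; rewrite geq_max => /andP[/MP -> /MP'//].
exists (maxn M N) => k; rewrite geq_max => /andP[/MP <- /NP//].
Qed.

Lemma clv_refining : refining clv.
Proof.
split=> [p q|m n p q mn]; have [u <-] := qpi_surj p; have [v <-] := qpi_surj q.
  have [N NP] := clv_pi u 0; have [M MP] := clv_pi v 0.
  rewrite -(NP (maxn N M)) ?leq_maxl// -(MP (maxn N M)) ?leq_maxr//; exact: rlv.1.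
have [N NP] := clv_pi u n; have [M MP] := clv_pi v n.
have [N' NP'] := clv_pi u m; have [M' MP'] := clv_pi v m.
pose K := maxn (maxn N M) (maxn N' M').
rewrite -(NP K) ?leq_max ?leqnn// -(MP K) ?leq_max ?leqnn ?orbT//.
rewrite -(NP' K) ?leq_max ?leqnn ?orbT// -(MP' K) ?leq_max ?leqnn ?orbT//.
exact: rlv.2.
Qed.

Lemma clv_sep p q : (forall n, clv n p = clv n q) -> p = q.
Proof.
have [u <-] := qpi_surj p; have [v <-] := qpi_surj q => uv.
apply: qpi_eq; apply/cseq_relE => n.
have [N NP] := clv_pi u n; have [M MP] := clv_pi v n.
by exists (maxn N M) => k; rewrite geq_max => /andP[/NP -> /MP ->].
Qed.

(** Once the levels up to [n] have settled along both representatives, their distance is within 2^-n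
    of the right-hand side, by [inf_dist_near]. *)
Lemma completion_distE : completion_dist (dE := dE) = lv_dist clv.
Proof.
apply/funext => p; apply/funext => q; apply/cvg_lim => //.
apply/cvgrPdist_le => e /exp2V_lt[n ne].
have H (r : completion dE) : exists N, forall m k, (m <= n)%N -> (N <= k)%N ->
    lv m (sval (qrepr r) k) = clv m r.
  have /choice[N NP] := fun m => clv_pi (qrepr r) m.
  exists (\max_(m < n.+1) N m)%N => m k; rewrite -ltnS => mn.
  move=> /(leq_trans (leq_bigmax (Ordinal mn))) /= /NP ->.
  by rewrite qreprK.
have [N NP] := H p; have [M MP] := H q; exists (maxn N M) => // k /=.
rewrite geq_max => /andP[Nk Mk]; apply: le_trans (ltW ne).
rewrite dlvE; apply: inf_dist_near.
- exact: (refining_down clv_refining).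
- exact: (refining_down rlv).
by move=> m mn; rewrite NP// MP.
Qed.

Lemma clv_in (d0 : forall x, d x x = 0) a n : clv n (completion_in dE d0 a) = lv n a.
Proof.
by have [N /(_ N (leqnn N)) <-] := clv_pi (exist _ _ (cst_cauchy d0 a)) n.
Qed.

Lemma clv_lift (a : nat -> A) :
  (forall n k, (n <= k)%N -> lv n (a k) = lv n (a n)) ->
  exists p, forall n, clv n p = lv n (a n).
Proof.
move=> aP; have ca : cauchy_seq d a.
  by rewrite dlv; apply/(lv_cauchyP rlv) => n; exists n => k l nk nl; rewrite !aP.
exists (qpi _ (exist _ a ca : cseq dE)) => n.
have [N NP] := clv_pi (exist _ a ca) n.
by rewrite -(NP (maxn N n)) ?leq_maxl//= aP// leq_maxr.
Qed.

Lemma clv_dense p n : exists a, lv n a = clv n p.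
Proof.
have [u <-] := qpi_surj p; have [N NP] := clv_pi u n.
by exists (sval u N); apply: NP.
Qed.

(** Diagonal argument: [a n] approximates [v n] at level [n], and the sequence [a] itself represents
    the limit. *)
Lemma clv_complete : lv_complete clv.
Proof.
move=> v vP; have /choice[a aP] := fun n => clv_dense (v n) n.
have [n k nk|p pP] := clv_lift (a := a); last by exists p => n; rewrite pP aP.
have d0 x : d x x = 0 by rewrite dlvE; apply: inf_dist_total.
transitivity (clv n (v k)); last by rewrite aP vP.
by rewrite -(clv_in d0); apply: clv_refining.2 nk _; rewrite clv_in aP.
Qed.

End Completion.

Lemma clv_act {R : realType} {V : eqType} {A Q : pset V} (d : A -> A -> R)
    (dE : forall s x y, d (act s x) (act s y) = d x y)
    (lv : nat -> nhom A Q) (rlv : refining lv) (dlv : d = lv_dist lv) n s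
    (p : completion dE) :
  clv rlv dlv n (act s p) = act s (clv rlv dlv n p).
Proof.
have [u <-] := qpi_surj p; rewrite /= qactE; last exact: cseq_relP.
have [N NP] := clv_pi rlv dlv (act s u) n; have [M MP] := clv_pi rlv dlv u n.
by rewrite -(NP (maxn N M)) ?leq_maxl//= homP MP// leq_maxr.
Qed.

(** * Name abstraction and alpha-equivalence *)

(** No decidable equality is assumed on the index type; proof irrelevance makes the transport along
    [e] trivial. *)
Lemma existT_inj (I : Type) (P : I -> Type) (i : I) (a b : P i) :
  existT P i a = existT P i b -> a = b.
Proof.
have h (u : {i : I & P i}) : u = existT P i b ->
    forall e : projT1 u = i, eq_rect _ P (projT2 u) _ e = b.
  by move=> -> /= e; rewrite (Prop_irrelevance e erefl).
by move=> E; apply: (h _ E erefl).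
Qed.

Section Abstraction.
Context {V : eqType} (Vinf : infinite_set [set: V]).
Implicit Types (A B : nom V) (x y z : V).

Lemma fresh_var (S : seq V) : exists z, z \notin S.
Proof.
by have [zs [_ zP]] := fresh_seq Vinf S 1; exists (thead zs); apply/zP/mem_tnth.
Qed.

Lemma suppP A (a : A) : exists2 S, supports S a & forall x, x \in S <-> supp a x.
Proof. by have [S /(supp_supports Vinf)] := nomP a. Qed.

Lemma act_supp A (a : A) (s t : vperm V) :
  (forall x, supp a x -> s x = t x) -> act s a = act t a.
Proof.
move=> st; have [S Sa SE] := suppP a; have [t' [tt' t't]] := vperm_inv t.
rewrite -[LHS](actK _ tt'); congr (act t _); rewrite -actM Sa// => x /SE/st /= ->.
exact: (vperm_app x t't).
Qed.

Lemma act_inj (A : pset V) (s : vperm V) : injective (act s : A -> A).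
Proof.
by have [t [_ ts]] := vperm_inv s; apply: (can_inj (g := act t)) => a; apply: actK.
Qed.

Lemma supports_supp A (a : A) S : (forall x, supp a x -> x \in S) -> supports S a.
Proof.
move=> aS; have [S' Sa SE] := suppP a.
by apply: supports_sub Sa => x /SE/aS.
Qed.

Lemma transpD x y z : z != x -> z != y -> transp x y z = z.
Proof. by rewrite /transp => /negbTE -> /negbTE ->. Qed.

Lemma transpL x y : transp x y x = y.
Proof. by rewrite /transp eqxx. Qed.

Lemma supp_neq A (a : A) x z : supp a x -> ~ supp a z -> x != z.
Proof. by move=> ax az; apply/eqP => xz; apply: az; rewrite -xz. Qed.

(** The some/any principle for fresh names: applying the transposition of [w] and [z] turns the
    equation at the witness [w] into the one at [z]. *)
Lemma abs_rel_fresh A (xa yb : prod_nom var_nom A) z : abs_rel xa yb ->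
  ~ supp xa.2 z -> ~ supp yb.2 z -> z != xa.1 -> z != yb.1 ->
  act (pswap xa.1 z) xa.2 = act (pswap yb.1 z) yb.2.
Proof.
case: xa yb => [x a] [y b] [w /= [wa wb wx wy E]] za zb zx zy.
have swap u (c : A) : w != u -> z != u -> ~ supp c w -> ~ supp c z ->
    act (pswap w z) (act (pswap u w) c) = act (pswap u z) c.
  move=> wu zu wc zc; rewrite -actM; apply: act_supp => v vc /=.
  have [->|vu] := eqVneq v u; first by rewrite !transpL.
  by rewrite !transpD// (supp_neq vc).
by rewrite -(swap x)// E swap.
Qed.

(** [abs_nom] divides by the generated equivalence, so [abs_rel] must be seen to be an equivalence
    already; transitivity takes a name fresh for all three pairs. *)
Lemma abst_rel A x y (a b : A) : abst x a = abst y b -> abs_rel (x, a) (y, b).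
Proof.
move/qpi_eqP; elim=> {x y a b} [//|[x a]|xa yb _|xa yb wc _ r _ r'].
- have [S Sa SE] := suppP a; have [z] := fresh_var (x :: S).
  by rewrite inE negb_or => /andP[zx /negP/SE az]; exists z.
- by move=> [z [za zb zx zy E]]; exists z.
have [S _ SE] := suppP xa.2; have [S' _ SE'] := suppP yb.2.
have [S'' _ SE''] := suppP wc.2.
have [z] := fresh_var ([:: xa.1; yb.1; wc.1] ++ S ++ S' ++ S'').
rewrite !mem_cat !inE !negb_or => /and4P[/and3P[zx zy zw]].
move=> /negP/SE za /negP/SE' zb /negP/SE'' zc; exists z; split=> //.
by rewrite (abs_rel_fresh r)// (abs_rel_fresh r').
Qed.

Lemma abst_eqP A x y (a b : A) z : z != x -> z != y -> ~ supp a z -> ~ supp b z ->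
  abst x a = abst y b <-> act (pswap x z) a = act (pswap y z) b.
Proof.
move=> zx zy za zb; split; last by move=> E; apply: qpi_eq; exists z.
by move/abst_rel/abs_rel_fresh; apply.
Qed.

Lemma abst_inj A x (a b : A) : abst x a = abst x b -> a = b.
Proof.
have [S _ SE] := suppP a; have [S' _ SE'] := suppP b.
have [z] := fresh_var (x :: S ++ S').
rewrite !inE mem_cat !negb_or => /and3P[zx /negP/SE za /negP/SE' zb].
by move/(abst_eqP zx zx za zb)/act_inj.
Qed.

Lemma supp_abst A x (a : A) y : supp (abst x a) y <-> supp a y /\ y != x.
Proof.
split=> [|[ay yx] S Sxa]; last first.
  suff /ay : supports (x :: S) a by rewrite inE (negbTE yx).
  move=> s sS; apply: (@abst_inj _ x).
  rewrite -[in LHS](sS x) ?inE ?eqxx// -abst_act Sxa// => v vS.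
  by rewrite sS// inE vS orbT.
have [S _ SE] := suppP a.
suff H : supports [seq v <- S | v != x] (abst x a).
  by move/(_ _ H); rewrite mem_filter => /andP[? /SE].
move=> s sS; rewrite abst_act.
have [S' _ SE'] := suppP (act s a).
have [z] := fresh_var ([:: x; s x] ++ S ++ S').
rewrite !mem_cat !inE !negb_or => /and3P[/andP[zx zsx] /negP/SE za /negP/SE' zsa].
apply/(abst_eqP zsx zx zsa za); rewrite -actM; apply: act_supp => v va /=.
have [->|vx] := eqVneq v x; first by rewrite !transpL.
rewrite (sS v); last by rewrite mem_filter vx; apply/SE.
rewrite !transpD// ?(supp_neq va za)//.
apply/eqP => vsx; move/eqP: (vx); apply; apply: (@vperm_inj _ s).
by rewrite -vsx sS// mem_filter vx; apply/SE.
Qed.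

Lemma abst_rename A x (a : A) z : z != x -> ~ supp a z ->
  abst x a = abst z (act (pswap x z) a).
Proof.
move=> zx za; have [S _ SE] := suppP a; have [S' _ SE'] := suppP (act (pswap x z) a).
have [w] := fresh_var ([:: x; z] ++ S ++ S').
rewrite !mem_cat !inE !negb_or => /and3P[/andP[wx wz] /negP/SE wa /negP/SE' wa'].
apply/(abst_eqP wx wz wa wa'); rewrite -actM; apply: act_supp => v va /=.
have [->|vx] := eqVneq v x; first by rewrite !transpL.
by rewrite !transpD// (supp_neq va).
Qed.

Lemma abst_concretion A (p : abs_nom A) z : ~ supp p z -> exists a, p = abst z a.
Proof.
have [x [a ->]] := abst_surj p; rewrite supp_abst => nz.
have [->|zx] := eqVneq z x; first by exists a.
by exists (act (pswap x z) a); apply: abst_rename => // za; apply: nz.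
Qed.

Lemma abst_orbit A x y (a b : A) : abst x a = abst y b -> exists s, b = act s a.
Proof.
move/abst_rel => [z /= [_ _ _ _ E]]; exists (pmul (pswap y z) (pswap x z)).
rewrite actM E actK//; apply: vperm_ext => v; exact: swapK.
Qed.

Lemma abstn_surj n A (p : absn_nom n A) : exists xs a, p = abstn xs a.
Proof.
elim: n p => [|n IH] p; first by exists [tuple], p.
have [x [q ->]] := abst_surj p; have [xs [a ->]] := IH q.
exists [tuple of x :: xs], a => /=; rewrite theadE; congr (abst _ (abstn _ _)).
exact: val_inj.
Qed.

Lemma abstn_act n A (s : vperm V) (xs : n.-tuple V) (a : A) :
  act s (abstn xs a) = abstn [tuple of map s xs] (act s a).
Proof.
elim: n xs => [//|n IH] xs.
transitivity (act s (abst (A := absn_nom n A) (thead xs) (abstn [tuple of behead xs] a))).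
  by [].
rewrite abst_act IH; case/tupleP: xs => x xs /=.
by rewrite !theadE; congr (abst _ (abstn _ _)); apply: val_inj.
Qed.

Lemma absn_map_abstn n A B (f : nhom A B) (xs : n.-tuple V) (a : A) :
  absn_map n f (abstn xs a) = abstn xs (f a).
Proof. by elim: n xs => [//|n IH] xs /=; rewrite abs_funE IH. Qed.

Lemma abstn_inj n A (xs : n.-tuple V) : injective (@abstn V n A xs).
Proof. by elim: n xs => [|n IH] xs a b //= /abst_inj/IH. Qed.

Lemma supp_abstn n A (xs : n.-tuple V) (a : A) y :
  supp (abstn xs a) y <-> supp a y /\ y \notin xs.
Proof.
elim: n xs => [xs|n IH xs]; first by rewrite tuple0; split=> [|[]].
rewrite supp_abst IH; case/tupleP: xs => x xs.
rewrite theadE inE negb_or.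
have -> : (y \notin [tuple of behead [tuple of x :: xs]]) = (y \notin xs) by [].
by split=> [[[ay yxs] yx]|[ay /andP[yx yxs]]]; rewrite ?yx.
Qed.

(** Used to transfer permutation-invariant facts, such as being a truncation, from one body of an
    abstraction to another. *)
Lemma abstn_orbit n A (xs ys : n.-tuple V) (a b : A) :
  abstn xs a = abstn ys b -> exists s, b = act s a.
Proof.
elim: n xs ys a => [|n IH] xs ys a /=; first by move=> ->; exists pid; rewrite act1.
move/abst_orbit => [s]; rewrite abstn_act => /esym/IH[t ->].
by exists (pmul t s); rewrite actM.
Qed.

Lemma abstn_concretion n A (p : absn_nom n A) (zs : n.-tuple V) : uniq zs ->
  (forall z, z \in zs -> ~ supp p z) -> exists a, p = abstn zs a.
Proof.
elim: n p zs => [p zs _ _|n IH p]; first by exists p.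
case/tupleP=> z zs /= /andP[zzs uzs] zP.
have [|q pq] := abst_concretion (p := p) (z := z); first by apply: zP; rewrite inE eqxx.
have [//|w wzs|a qa] := IH q zs.
  have := zP w; rewrite inE wzs orbT pq => /(_ isT) nw qw.
  by apply: nw; apply/supp_abst; split=> //; apply: contraNneq zzs => <-.
exists a; rewrite theadE pq qa; congr (abst _ (abstn _ _)); exact: val_inj.
Qed.

Lemma act_pswaps_cons (A : pset V) x z (xs zs : seq V) (a : A) :
  act (pswaps (x :: xs) (z :: zs)) a = act (pswap x z) (act (pswaps xs zs) a).
Proof. by rewrite -actM; congr act; apply: vperm_ext. Qed.

Definition fresh_for n A (zs xs : n.-tuple V) (a : A) :=
  uniq zs /\ forall z, z \in zs -> z \notin xs /\ ~ supp a z.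

Lemma fresh_for_exists n A B (xs ys : n.-tuple V) (a : A) (b : B) :
  exists zs, fresh_for zs xs a /\ fresh_for zs ys b.
Proof.
have [S1 _ S1E] := suppP a; have [S2 _ S2E] := suppP b.
have [zs [uzs zsP]] := fresh_seq Vinf (S1 ++ S2 ++ xs ++ ys) n.
exists zs; split; split=> // z /zsP; rewrite !mem_cat !negb_or;
  by case/and4P => /negP/S1E ? /negP/S2E ? ? ?; split.
Qed.

(** [xs] may have repetitions. The last entry then wins on both sides: it is the innermost
    abstraction, and its transposition is the first one applied. *)
Lemma abstn_rename n A (xs zs : n.-tuple V) (a : A) : fresh_for zs xs a ->
  abstn xs a = abstn zs (act (pswaps xs zs) a).
Proof.
elim: n xs zs => [|n IH] xs zs; first by
  move=> _; rewrite (tuple0 xs) (tuple0 zs) (_ : pswaps _ _ = pid) ?act1//; apply: vperm_ext.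
case/tupleP: xs => x xs; case/tupleP: zs => z zs [/= /andP[zzs uzs] zP].
rewrite !theadE act_pswaps_cons.
have [] := zP z; first by rewrite inE eqxx.
rewrite inE negb_or => /andP[zx zxs] za.
rewrite (abst_rename (z := z))//; last by move/supp_abstn => [].
congr (abst z _); rewrite (IH _ zs); last first.
  split=> // w wzs; have [] := zP w; first by rewrite inE wzs orbT.
  by rewrite inE negb_or => /andP[_ wxs] wa; split.
rewrite abstn_act; congr abstn.
apply: val_inj => /=; rewrite -[RHS]map_id; apply/eq_in_map => w wzs /=.
have [] := zP w; first by rewrite inE wzs orbT.
rewrite inE negb_or => /andP[wx _] _; rewrite transpD//.
by apply: contraNneq zzs => <-.
Qed.

Lemma abstn_eqP n A (xs ys zs : n.-tuple V) (a b : A) :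
  fresh_for zs xs a -> fresh_for zs ys b ->
  abstn xs a = abstn ys b <-> act (pswaps xs zs) a = act (pswaps ys zs) b.
Proof.
move=> fa fb; rewrite (abstn_rename fa) (abstn_rename fb).
by split=> [/abstn_inj|->].
Qed.

Lemma supports_abstn n A (xs : n.-tuple V) (a : A) (S : seq V) :
  supports S (abstn xs a) -> supports (S ++ xs) a.
Proof.
move=> Sa; apply: supports_supp => x ax; rewrite mem_cat orbC.
by case: (boolP (x \in xs)) => //= xxs; apply: (_ : supp (abstn xs a) x) => //; apply/supp_abstn.
Qed.

(** Both sides are the body of the same abstraction with bound names [ws], so injectivity of
    [abstn ws] replaces a computation with products of transpositions. *)
Lemma act_pswaps_trans n A (xs zs ws : n.-tuple V) (a : A) :
  fresh_for zs xs a -> fresh_for ws xs a -> {in ws, forall w, w \notin zs} ->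
  act (pswaps zs ws) (act (pswaps xs zs) a) = act (pswaps xs ws) a.
Proof.
move=> fz fw wz; apply: (@abstn_inj _ _ ws).
rewrite -(abstn_rename fw) (abstn_rename fz) -abstn_rename//.
split=> [|w wws]; first by case: fw.
split; [exact: wz|move=> sw].
have : supp (abstn zs (act (pswaps xs zs) a)) w.
  by apply/supp_abstn; split=> //; apply: wz.
by rewrite -abstn_rename// => /supp_abstn[wa _]; have [_ /(_ w wws)[]] := fw.
Qed.

End Abstraction.

Lemma dep_choice (I : Type) (T : I -> Type) (P : forall i, T i -> Prop) :
  (forall i, exists x, P i x) -> exists f : forall i, T i, forall i, P i (f i).
Proof. by move=> H; exists (fun i => sval (cid (H i))) => i; case: cid. Qed.

(** * Alpha-equivalence of finite terms as equality of abstractions *)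

Section AlphaEquivalence.
Context {V : eqType} (Vinf : infinite_set [set: V]) {Sg : mbs}.
Notation term := (term V Sg).
Notation Q := (aterm_nom V Sg).
Notation cl := (aclass V Sg).

Lemma aeq_inv (t w : term) : aeq t w ->
  match t with
  | Var x => w = Var Sg x
  | Node c xs ts => exists ys us (zs : forall i : slot c, (nbind i).-tuple V),
      [/\ w = Node ys us, forall i, fresh_tuple (zs i) (xs i) (ys i) (ts i) (us i) &
       forall i, aeq (term_act (pswaps (xs i) (zs i)) (ts i))
                     (term_act (pswaps (ys i) (zs i)) (us i))]
  end.
Proof. by case=> // c xs ys zs ts us fr h; exists ys, us, zs. Qed.

Lemma Node_inj (c : Sg) (xs ys : forall i : slot c, (nbind i).-tuple V)
    (ts us : slot c -> term) : Node xs ts = Node ys us -> xs = ys /\ ts = us.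
Proof.
case=> Ex Et; split; first exact: (existT_inj Ex).
exact: (existT_inj (P := fun c : Sg => slot c -> term) Et).
Qed.

Lemma aeq_sym (t u : term) : aeq t u -> aeq u t.
Proof.
elim=> [x|c xs ys zs ts us fr _ IH]; first exact: aeq_var.
apply: (aeq_node (zs := zs)) => // i; have [uz zP] := fr i; split=> // z /zP[].
by split.
Qed.

Lemma fresh_tupleP n (zs xs ys : n.-tuple V) (t u : term_nom V Sg) :
  fresh_tuple zs xs ys t u <-> fresh_for zs xs t /\ fresh_for zs ys u.
Proof.
split=> [[uz zP]|[[uz zP] [_ zP']]].
  by split; split=> // z /zP[].
by split=> // z zz; have [? ?] := zP z zz; have [? ?] := zP' z zz; split.
Qed.

Lemma fresh_for_sub (A B : nom V) n (zs xs : n.-tuple V) (a : A) (b : B) :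
  (forall x, supp b x -> supp a x) -> fresh_for zs xs a -> fresh_for zs xs b.
Proof.
move=> ba [uz zP]; split=> // z /zP[zx za]; split=> //; exact: contra_not (ba z) za.
Qed.

(** The names witnessing alpha-equivalence at a binder are exchanged by a further multiple
    transposition; transitivity needs this to give two derivations common names. *)
Lemma aeq_refresh n (xs ys zs ws : n.-tuple V) (t u : term_nom V Sg) :
  fresh_for zs xs t -> fresh_for zs ys u -> fresh_for ws xs t -> fresh_for ws ys u ->
  {in ws, forall w, w \notin zs} ->
  aeq (term_act (pswaps xs zs) t) (term_act (pswaps ys zs) u) ->
  aeq (term_act (pswaps xs ws) t) (term_act (pswaps ys ws) u).
Proof.
move=> zx zy wx wy wz /(aeqP (pswaps zs ws)).
have E (vs : n.-tuple V) (v : term_nom V Sg) :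
    fresh_for zs vs v -> fresh_for ws vs v ->
    term_act (pswaps zs ws) (term_act (pswaps vs zs) v) = term_act (pswaps vs ws) v.
  by move=> zv wv; apply: (act_pswaps_trans Vinf zv wv).
by rewrite !E.
Qed.

Lemma term_actM s s' (t : term) : term_act s (term_act s' t) = term_act (pmul s s') t.
Proof. by symmetry; apply: (actM (p := term_pset V Sg)). Qed.

Lemma aeq_trans (t u v : term) : aeq t u -> aeq u v -> aeq t v.
Proof.
(* The induction hypothesis has to apply to renamed subterms, hence the permutation [s]. *)
suff H s : aeq (term_act s t) u -> aeq u v -> aeq (term_act s t) v.
  by move: (H pid); rewrite -[term_act pid t]/(act (p := term_pset V Sg) pid t) act1.
elim: t s u v => [x|c xs ts IH] s u v /=; first by move=> /aeq_inv ->.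
move=> /aeq_inv[ys [us [zs [-> fz tu]]]] /aeq_inv[ws [vs [zs' [-> fz' uv]]]].
have H (i : slot c) : exists zz : (nbind i).-tuple V,
    [/\ fresh_tuple zz [tuple of map s (xs i)] (ys i) (term_act s (ts i)) (us i),
        fresh_tuple zz (ys i) (ws i) (us i) (vs i) &
        {in zz, forall z, z \notin zs i /\ z \notin zs' i}].
  have [S1 _ S1E] := suppP Vinf (term_act s (ts i) : term_nom V Sg).
  have [S2 _ S2E] := suppP Vinf (us i : term_nom V Sg).
  have [S3 _ S3E] := suppP Vinf (vs i : term_nom V Sg).
  have [zz [uzz zzP]] := fresh_seq Vinf (S1 ++ S2 ++ S3 ++ map s (xs i) ++ ys i ++
    ws i ++ zs i ++ zs' i) (nbind i).
  exists zz; split; [split=> //|split=> //|] => z /zzP; rewrite !mem_cat !negb_or;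
    by case/and5P => /negP/S1E ? /negP/S2E ? /negP/S3E ? ? /and4P[? ? ? ?]; split.
have [zz zzP] := dep_choice H.
apply: (aeq_node (zs := zz)) => i; have [f1 f2 zd] := zzP i.
  by apply/fresh_tupleP; split; [case/fresh_tupleP: f1|case/fresh_tupleP: f2].
have [fx fy] := (fresh_tupleP _ _ _ _ _).1 (fz i).
have [fy' fw] := (fresh_tupleP _ _ _ _ _).1 (fz' i).
have [gx gy] := (fresh_tupleP _ _ _ _ _).1 f1.
have [_ gw] := (fresh_tupleP _ _ _ _ _).1 f2.
have zd1 : {in zz i, forall w, w \notin zs i} by move=> w /zd[].
have zd2 : {in zz i, forall w, w \notin zs' i} by move=> w /zd[].
have := aeq_refresh fx fy gx gy zd1 (tu i); rewrite term_actM => /IH; apply.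
exact: (aeq_refresh fy' fw gy gw zd2 (uv i)).
Qed.

Lemma aclassP (t u : term) : cl t = cl u <-> aeq t u.
Proof.
split; last exact: qpi_eq.
move/qpi_eqP; elim=> [//|x|x y _|x y z _ xy _]; first exact: aeq_refl.
- exact: aeq_sym.
- exact: aeq_trans.
Qed.

Lemma aclass_surj (p : Q) : exists t, cl t = p.
Proof. exact: qpi_surj. Qed.

Lemma aclass_act s (t : term) : cl (term_act s t) = act s (cl t).
Proof. exact: (homP cl). Qed.

(** Turns the fresh-name rule of [aeq] into equality of abstractions of classes. Names fresh for a
    term are fresh for its class, so the same names serve both readings. *)
Lemma aclass_nodeP (c : Sg) xs ys ts us :
  cl (Node xs ts) = cl (@Node V Sg c ys us) <->
  forall i, abstn (xs i) (cl (ts i)) = abstn (ys i) (cl (us i)).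
Proof.
rewrite aclassP; split=> [/aeq_inv[ys' [us' [zs [E fz tu]]]] i|E].
  have [eys eus] := Node_inj E; subst ys' us'.
  have [fx fy] := (fresh_tupleP _ _ _ _ _).1 (fz i).
  apply/(abstn_eqP Vinf (zs := zs i)); try by apply: fresh_for_sub; last eassumption;
    move=> x /supp_hom.
  by rewrite -!aclass_act; apply/aclassP.
have H (i : slot c) : exists zs : (nbind i).-tuple V,
    fresh_tuple zs (xs i) (ys i) (ts i) (us i).
  have [zs fr] := fresh_for_exists Vinf (A := term_nom V Sg) (B := term_nom V Sg)
    (xs i) (ys i) (ts i) (us i).
  by exists zs; apply/fresh_tupleP.
have [zs zsP] := dep_choice H.
apply: (aeq_node (zs := zs)) => // i.
have [fx fy] := (fresh_tupleP _ _ _ _ _).1 (zsP i).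
apply/aclassP; rewrite !aclass_act; apply/abstn_eqP => //;
  by apply: fresh_for_sub; last eassumption; move=> x /supp_hom.
Qed.

Definition avar x : Q := cl (Var Sg x).

Lemma absn_repr n (p : absn_nom n Q) : exists xt : n.-tuple V * term,
  abstn xt.1 (cl xt.2) = p.
Proof.
have [xs [q ->]] := abstn_surj p; have [t <-] := aclass_surj q.
by exists (xs, t).
Qed.

(* The constructors of T_Sigma/alpha, as operations on abstractions. *)
Definition anode (c : Sg) (b : forall i : slot c, absn_nom (nbind i) Q) : Q :=
  cl (Node (fun i => (sval (cid (absn_repr (b i)))).1)
           (fun i => (sval (cid (absn_repr (b i)))).2)).

Lemma anodeE (c : Sg) (xs : forall i : slot c, (nbind i).-tuple V)
    (ts : slot c -> term) :
  anode (fun i => abstn (xs i) (cl (ts i))) = cl (Node xs ts).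
Proof.
by apply/aclass_nodeP => i; case: (cid (absn_repr _)).
Qed.

Lemma anode_repr (c : Sg) (b : forall i : slot c, absn_nom (nbind i) Q) :
  exists xs (ts : slot c -> term),
    (forall i, b i = abstn (xs i) (cl (ts i))) /\ anode b = cl (Node xs ts).
Proof.
exists (fun i => (sval (cid (absn_repr (b i)))).1).
exists (fun i => (sval (cid (absn_repr (b i)))).2).
by split=> // i; case: (cid (absn_repr _)).
Qed.

Lemma anode_inj (c : Sg) : injective (@anode c).
Proof.
move=> b b'; have [xs [ts [bE ->]]] := anode_repr b.
have [xs' [ts' [bE' ->]]] := anode_repr b' => /aclass_nodeP E.
by apply/functional_extensionality_dep => i; rewrite bE bE'.
Qed.

Lemma anode_constr (c c' : Sg) (b : forall i : slot c, absn_nom (nbind i) Q)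
    (b' : forall i : slot c', absn_nom (nbind i) Q) : anode b = anode b' -> c = c'.
Proof.
have [xs [ts [_ ->]]] := anode_repr b; have [xs' [ts' [_ ->]]] := anode_repr b'.
by move=> /aclassP/aeq_inv[ys [us [zs [[]]]]].
Qed.

Lemma avar_anode x (c : Sg) (b : forall i : slot c, absn_nom (nbind i) Q) :
  avar x <> anode b.
Proof. by have [xs [ts [_ ->]]] := anode_repr b => /aclassP/aeq_inv. Qed.

Lemma avar_inj : injective avar.
Proof. by move=> x y /aclassP/aeq_inv[]. Qed.

Lemma anode_act s (c : Sg) (b : forall i : slot c, absn_nom (nbind i) Q) :
  act s (anode b) = anode (fun i => act s (b i)).
Proof.
have [xs [ts [bE ->]]] := anode_repr b.
rewrite -aclass_act -anodeE; congr anode.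
apply/functional_extensionality_dep => i; rewrite bE.
by rewrite [RHS]abstn_act aclass_act.
Qed.

Lemma avar_act s x : act s (avar x) = avar (s x).
Proof. by rewrite -aclass_act. Qed.

Lemma supports_anode (c : Sg) (b : forall i : slot c, absn_nom (nbind i) Q) S :
  supports S (anode b) <-> forall i, supports S (b i).
Proof.
split=> [Sb i s sS|Sb s sS].
  have := Sb s sS; rewrite anode_act => /anode_inj E.
  exact: (congr1 (fun g => g i) E).
rewrite anode_act; congr anode; apply/functional_extensionality_dep => i; exact: Sb.
Qed.

Lemma supp_anode (c : Sg) (b : forall i : slot c, absn_nom (nbind i) Q) x :
  supp (anode b) x <-> exists i, supp (b i) x.
Proof.
split=> [sx|[i bx] S /supports_anode/(_ i)]; last exact: bx.
have /choice[S SP] : forall i, exists S : seq V,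
    supports S (b i) /\ forall x, x \in S <-> supp (b i) x.
  by move=> i; have [S bS SE] := suppP Vinf (b i); exists S.
have : x \in flatten [seq S i | i <- enum (slot c)].
  apply: sx; apply/supports_anode => i; apply: supports_sub (SP i).1 => y yS.
  by apply/flattenP; exists (S i) => //; apply: map_f; rewrite mem_enum.
by case/flattenP => _ /mapP[i _ ->] /(SP i).2; exists i.
Qed.

Lemma supp_avar x y : supp (avar x) y -> y = x.
Proof.
move=> /(_ [:: x]); rewrite inE => h; apply/eqP/h => s sS.
by rewrite avar_act sS// inE.
Qed.

Lemma supp_avarx x : supp (avar x) x.
Proof.
move=> S Sx; apply: contrapT => /negP xS.
have [z] := fresh_var Vinf (x :: S); rewrite inE negb_or => /andP[zx zS].
have := Sx (pswap x z); rewrite avar_act /= transpL => h.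
have /avar_inj/eqP : avar z = avar x; last by rewrite (negbTE zx).
apply: h => y yS; rewrite transpD//; first by apply: contraNneq xS => <-.
by apply: contraNneq zS => <-.
Qed.

Lemma aeq_hom (Sg' : mbs) (f : nhom (term_nom V Sg) (term_nom V Sg')) :
  (forall t u, aeq t u -> aeq (f t) (f u)) ->
  exists g : nhom Q (aterm_nom V Sg'), forall t, g (cl t) = aclass V Sg' (f t).
Proof.
move=> fE; pose g : Q -> aterm_nom V Sg' := qlift (fun t => aclass V Sg' (f t)).
have gE t : g (cl t) = aclass V Sg' (f t).
  by rewrite /g [LHS]qliftE// => x y xy; apply/qpi_eq/fE.
suff gP s p : g (act s p) = act s (g p) by exists (Defs.Hom gP).
have [t <-] := aclass_surj p.
by rewrite -aclass_act !gE -[term_act s t]/(act (p := term_pset V Sg) s t) !homP.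
Qed.

End AlphaEquivalence.

(** * Truncations of finite terms, raw and modulo alpha *)

Section Truncation.
Context {V : eqType} (Vinf : infinite_set [set: V]) {Sg : mbs}.
Notation term := (term V Sg).
Notation sterm := (Defs.term V (star_mbs Sg)).
Notation Q := (aterm_nom V Sg).
Notation sQ := (aterm_nom V (star_mbs Sg)).
Notation cl := (aclass V Sg).
Notation scl := (aclass V (star_mbs Sg)).
Notation star := (star V Sg).

(** Truncation of terms that may already contain [star]: it recomputes lower levels from higher
    ones, which gives [refining] and expresses the coherence of a sequence of truncations. *)
Fixpoint strunc (t : sterm) (n : nat) : sterm :=
  if n is 0 then star else
  match t with
  | Var x => Var _ x
  | Node c xs ts => @Node V (star_mbs Sg) c xs (fun i => strunc (ts i) (n - coind i))
  end.

Lemma term_act_star s : term_act s star = star.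
Proof. by apply: Node_ext => -[]. Qed.

Lemma strunc_act s t n : strunc (term_act s t) n = term_act s (strunc t n).
Proof.
elim: t n => [x|c xs ts IH] [|n]; try by rewrite [RHS]term_act_star.
  by [].
by apply: Node_ext => // i; apply: IH.
Qed.

Definition strunc_hom n : nhom (term_nom V (star_mbs Sg)) (term_nom V (star_mbs Sg)) :=
  @Defs.Hom V (term_nom V (star_mbs Sg)) (term_nom V (star_mbs Sg)) (strunc^~ n)
    (fun s t => strunc_act s t n).

Definition trunc_hom n : nhom (term_nom V Sg) (term_nom V (star_mbs Sg)) :=
  @Defs.Hom V (term_nom V Sg) (term_nom V (star_mbs Sg)) ((@trunc V Sg)^~ n)
    (fun s t => trunc_act s t n).

Lemma strunc_aeq n t u : aeq t u -> aeq (strunc t n) (strunc u n).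
Proof.
move=> tu; elim: tu n => [x|c xs ys zs ts us fr _ IH] [|n] /=;
  try exact: aeq_refl.
apply: (aeq_node (zs := zs)) => i; last by rewrite -!strunc_act.
have [uz zP] := fr i; split=> // z /zP[? ? h1 h2]; split=> //.
  by apply: contra_not h1; apply: (supp_hom (f := strunc_hom _)).
by apply: contra_not h2; apply: (supp_hom (f := strunc_hom _)).
Qed.

Lemma trunc_aeq n t u : aeq t u -> aeq (@trunc V Sg t n) (trunc u n).
Proof.
move=> tu; elim: tu n => [x|c xs ys zs ts us fr _ IH] [|n] /=;
  try exact: aeq_refl.
apply: (@aeq_node V (star_mbs Sg) (Some c) _ _ zs) => i; last by rewrite -!trunc_act; apply: IH.
have [uz zP] := fr i; split=> // z /zP[? ? h1 h2]; split=> //.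
  by apply: contra_not h1; apply: (supp_hom (f := trunc_hom _)).
by apply: contra_not h2; apply: (supp_hom (f := trunc_hom _)).
Qed.

Lemma strunc_trunc m n t : (m <= n)%N -> strunc (@trunc V Sg t n) m = trunc t m.
Proof.
elim: t m n => [x|c xs ts IH] [|m] [|n] //= mn.
by apply: Node_ext => // i; apply: IH; apply: leq_sub2r.
Qed.

Definition rho n : nhom sQ sQ :=
  sval (cid (aeq_hom (f := strunc_hom n) (fun t u => @strunc_aeq n t u))).

Definition alv n : nhom Q sQ :=
  sval (cid (aeq_hom (f := trunc_hom n) (fun t u => @trunc_aeq n t u))).

Lemma rhoE n t : rho n (scl t) = scl (strunc t n).
Proof. by rewrite /rho; case: cid. Qed.

Lemma alvE n t : alv n (cl t) = scl (trunc t n).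
Proof. by rewrite /alv; case: cid. Qed.

Lemma rho_alv m n p : (m <= n)%N -> rho m (alv n p) = alv m p.
Proof.
by move=> mn; have [t <-] := aclass_surj p; rewrite !alvE rhoE strunc_trunc.
Qed.

Lemma rho_anode n (c : Sg)
    (b : forall i : slot (Some c : star_mbs Sg), absn_nom (nbind i) sQ) :
  rho n.+1 (anode b) = @anode V (star_mbs Sg) (Some c)
    (fun i => absn_map (nbind i) (rho (n.+1 - coind i)) (b i)).
Proof.
have [xs [ts [bE ->]]] := anode_repr b.
rewrite rhoE; have -> : strunc (Node xs ts) n.+1 =
  Node xs (fun i => strunc (ts i) (n.+1 - coind i)) by [].
rewrite -(anodeE Vinf); congr anode; apply/functional_extensionality_dep => i.
by rewrite bE absn_map_abstn rhoE.
Qed.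

Lemma alv_node n (c : Sg) xs ts : alv n.+1 (cl (@Node V Sg c xs ts)) =
  @anode V (star_mbs Sg) (Some c)
    (fun i => abstn (xs i) (alv (n.+1 - coind (i : slot c)) (cl (ts i)))).
Proof.
rewrite alvE; have -> : trunc (Node xs ts) n.+1 = @Node V (star_mbs Sg) (Some c)
  xs (fun i => trunc (ts i) (n.+1 - coind (i : slot c))) by [].
rewrite -(anodeE Vinf); congr anode; apply/functional_extensionality_dep => i.
by rewrite alvE.
Qed.

Lemma alv0 p : alv 0 p = scl star.
Proof. by have [t <-] := aclass_surj p; rewrite alvE; case: t. Qed.

Lemma alv_refining : refining alv.
Proof.
split=> [p q|m n p q mn pq]; first by rewrite !alv0.
by rewrite -(rho_alv _ mn) pq rho_alv.
Qed.

Lemma trunc_refining : refining (fun n t => @trunc V Sg t n).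
Proof.
split=> [[x|c xs ts] [y|c' ys us]//|m n t u mn tu].
by rewrite -(strunc_trunc _ mn) tu strunc_trunc.
Qed.

Lemma trunc_sep t u : (forall n, @trunc V Sg t n = trunc u n) -> t = u.
Proof.
elim: t u => [x|c xs ts IH] [y|c' ys us] tu; try by have := tu 1%N.
  by have [->] := tu 1%N.
have ec : c = c' by have [] := tu 1%N.
subst c'; have E n : xs = ys /\ (fun i => trunc (ts i) (n.+1 - coind i)) =
    (fun i => trunc (us i) (n.+1 - coind i)).
  exact: (Node_inj (tu n.+1)).
have [-> _] := E 0%N; apply: Node_ext => // i; apply: IH => m.
have /(congr1 (fun g => g i)) := (E m).2.
by apply: trunc_refining.2; case: coind; rewrite ?subn1// subn0.
Qed.

Lemma alv_sep p q : (forall n, alv n p = alv n q) -> p = q.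
Proof.
have [t <-] := aclass_surj p; have [u <-] := aclass_surj q.
suff H s : (forall n, alv n (cl (term_act s t)) = alv n (cl u)) ->
    cl (term_act s t) = cl u.
  have -> : t = term_act pid t by symmetry; apply: (act1 (p := term_pset V Sg)).
  exact: H.
elim: t s u {p q} => [x|c xs ts IH] s [y|c' ys us] E.
- have := E 1%N; rewrite !alvE /=.
  by move=> /(avar_inj Vinf (Sg := star_mbs Sg)) /= ->.
- by have := E 1%N; rewrite alv_node alvE => /(avar_anode Vinf).
- have := E 1%N; rewrite [in LHS]/= alv_node alvE.
  by move=> /esym/(avar_anode Vinf (Sg := star_mbs Sg)).
have ec : c = c'.
  have := E 1%N; rewrite [in LHS]/= !alv_node.
  by move/(anode_constr Vinf) => [].
subst c'; apply/(aclass_nodeP Vinf) => i.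
have {}E n : abstn [tuple of map s (xs i)] (alv n (cl (term_act s (ts i)))) =
    abstn (ys i) (alv n (cl (us i))).
  rewrite -!absn_map_abstn.
  have := E n.+1; rewrite [in LHS]/= !alv_node => /(anode_inj Vinf).
  move/(congr1 (fun g => g i)); rewrite -!absn_map_abstn.
  move=> /(congr1 (absn_map _ (rho n))).
  (* An argument is seen at level [n.+1] or [n]; [rho n] brings both cases down to level [n]. *)
  have nc : (n <= n.+1 - coind i)%N by case: coind; rewrite ?subn1// subn0.
  by rewrite !absn_map_abstn !rho_alv.
(* Equivariant maps do not enlarge supports, so names fresh for the two classes are fresh for all
   their truncations. *)
have [zs [f1 f2]] := fresh_for_exists Vinf [tuple of map s (xs i)] (ys i)
  (cl (term_act s (ts i))) (cl (us i)).
apply/(abstn_eqP Vinf f1 f2); rewrite -!aclass_act term_actM; apply: IH => n.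
rewrite -term_actM 2![cl (term_act (pswaps _ _) _)]aclass_act.
move: (cl (term_act s (ts i))) (cl (us i)) f1 f2 (E n) => p q f1 f2 {}E.
rewrite !homP; apply/(abstn_eqP Vinf) => //;
  by apply: fresh_for_sub; last eassumption; move=> x /supp_hom.
Qed.

Lemma aterm_distE {R : realType} : aterm_dist (R := R) (V := V) (Sg := Sg) = lv_dist alv.
Proof.
apply/funext => p; apply/funext => q; congr inf_dist; apply/funext => n.
apply/propext; split=> [[t [u [-> -> tu]]]|].
  by rewrite !alvE; apply/aclassP.
have [t <-] := aclass_surj p; have [u <-] := aclass_surj q; rewrite !alvE.
by move=> /(aclassP Vinf) tu; exists t, u.
Qed.

Section Fill.
Context (x0 : V).

(** The signature may have no constants, so [star] is replaced by a variable. One fixed [x0] adds at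
    most one name to the supports of all approximations. *)
Fixpoint sfill (t : sterm) : term :=
  match t with
  | Var x => Var _ x
  | Node c xs ts =>
    match c return (forall i : slot (c : star_mbs Sg), (nbind i).-tuple V) ->
        (slot (c : star_mbs Sg) -> term) -> term with
    | None => fun _ _ => Var _ x0
    | Some c => fun xs ts => @Node V Sg c xs ts
    end xs (fun i => sfill (ts i))
  end.

Lemma supp_sfill t x : supp (sfill t : term_nom V Sg) x ->
  x = x0 \/ supp (t : term_nom V (star_mbs Sg)) x.
Proof.
move=> tx; have [|xx0] := eqVneq x x0; [by left|right => S St].
suff : supports (x0 :: S) (sfill t : term_nom V Sg).
  by move/tx; rewrite inE (negbTE xx0).
move=> s sS; have {}St := St s (fun y yS => sS y (mem_behead (s := x0 :: S) yS)).
have {sS}s0 : s x0 = x0 by apply: sS; rewrite inE eqxx.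
elim: t {tx} St => [y [ey]|[c|] xs ts IH E] /=; first by rewrite ey.
  have [Ex Et] := Node_inj E; apply: Node_ext => i.
    exact: (congr1 (fun g => g i) Ex).
  apply: IH; exact: (congr1 (fun g => g i) Et).
by rewrite s0.
Qed.

End Fill.
End Truncation.

(** * Mixed terms *)

Lemma hom_supports (V : eqType) (A B : pset V) (f : nhom A B) S a :
  supports S a -> supports S (f a).
Proof. by move=> Sa s sS; rewrite -homP Sa. Qed.

Section MixedTerms.
Context {V : eqType} {Sg : mbs}.
Notation muT := (muT V Sg).
Notation mterm := (mterm V Sg).
Notation sterm := (term V (star_mbs Sg)).

Lemma coind_caseF (U : Type) b (f : ~~ b -> U) (g : b -> U) (e : ~~ b) :
  coind_case f g = f e.
Proof. by case: b f g e => // f g e; rewrite (bool_irrelevance e isT). Qed.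

Lemma coind_caseT (U : Type) b (f : ~~ b -> U) (g : b -> U) (e : b) :
  coind_case f g = g e.
Proof. by case: b f g e => // f g e; rewrite (bool_irrelevance e isT). Qed.

Lemma coind_case_eq (U : Type) b (f f' : ~~ b -> U) (g g' : b -> U) :
  (forall e, f e = f' e) -> (forall e, g e = g' e) -> coind_case f g = coind_case f' g'.
Proof. by case: b f f' g g' => f f' g g' ff' gg' /=. Qed.

Lemma MNode_inj Y (c : Sg) (xs xs' : forall i : slot c, (nbind i).-tuple V)
    (ts ts' : forall i, ~~ coind i -> muT Y) (us us' : forall i, coind i -> Y) :
  MNode xs ts us = MNode xs' ts' us' -> [/\ xs = xs', ts = ts' & us = us'].
Proof.
case=> Ex Et Eu; split.
- exact: (existT_inj Ex).
- exact: (existT_inj (P := fun c : Sg => forall i : slot c, ~~ coind i -> muT Y) Et).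
- exact: (existT_inj (P := fun c : Sg => forall i : slot c, coind i -> Y) Eu).
Qed.

Fixpoint muT_all Y (P : Y -> Prop) (p : muT Y) : Prop :=
  match p with
  | MVar _ => True
  | MNode c xs ts us =>
      (forall i e, muT_all P (ts i e)) /\ (forall i e, P (us i e))
  end.

Lemma muT_all_lift Y (P : Y -> Prop) p : muT_all P p ->
  exists p' : muT {y | P y}, muT_map id sval p' = p.
Proof.
elim: p => [x _|c xs ts IH us [tsP usP]]; first by exists (MVar _ _ x).
have /dep_choice[ts' ts'P] : forall i, exists q : ~~ coind i -> muT {y | P y},
    forall e, muT_map id sval (q e) = ts i e.
  by move=> i; apply: (dep_choice (P := fun e q => muT_map id sval q = ts i e)) => e;
    apply: IH; apply: tsP.
exists (MNode xs ts' (fun i e => exist _ _ (usP i e))); apply: MNode_ext => // i.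
by apply: val_inj; rewrite /= map_id.
Qed.

Lemma muT_map_eqP Y Z (v w : V -> V) (f g : Y -> Z) p :
  muT_map v f p = muT_map w g p -> muT_all (fun y => f y = g y) p.
Proof.
elim: p => // c xs ts IH us /= /MNode_inj[_ Et Eu]; split=> i e.
  by apply: IH; have := congr1 (fun k => k i e) Et.
exact: (congr1 (fun k => k i e) Eu).
Qed.

Lemma muT_all_forall (I Y : Type) (P : I -> Y -> Prop) p :
  (forall i, muT_all (P i) p) -> muT_all (fun y => forall i, P i y) p.
Proof.
elim: p => // c xs ts IH us /= H; split=> j e; first by apply: IH => i; apply: (H i).1.
by move=> i; apply: (H i).2.
Qed.

Lemma muT_allT Y (P : Y -> Prop) p : (forall y, P y) -> muT_all P p.
Proof. by move=> H; elim: p => //= c xs ts IH us; split. Qed.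

Lemma muT_all_impl Y (P P' : Y -> Prop) p : (forall y, P y -> P' y) ->
  muT_all P p -> muT_all P' p.
Proof.
by move=> H; elim: p => //= c xs ts IH us [Pt Pu]; split=> i e; [apply: IH|apply: H].
Qed.

Lemma muT_trunc_map Y Z (f : Z -> sterm) (g : Y -> Z) p :
  muT_trunc f (muT_map id g p) = muT_trunc (f \o g) p.
Proof.
elim: p => //= c xs ts IH us; apply: Node_ext => i.
  by apply: val_inj; rewrite /= map_id.
by apply: coind_case_eq.
Qed.

Lemma eq_muT_trunc Y (f g : Y -> sterm) p :
  (forall y, f y = g y) -> muT_trunc f p = muT_trunc g p.
Proof. by move=> /funext ->. Qed.

Lemma muT_trunc_node_inj Y Z (f : Y -> sterm) (g : Z -> sterm) (c : Sg)
    (xs xs' : forall i : slot c, (nbind i).-tuple V) ts ts' us us' :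
  muT_trunc f (MNode xs ts us) = muT_trunc g (MNode xs' ts' us') ->
  [/\ xs = xs', forall i e, muT_trunc f (ts i e) = muT_trunc g (ts' i e) &
      forall i e, f (us i e) = g (us' i e)].
Proof.
move=> /(@Node_inj V (star_mbs Sg) (Some c))[Ex Et]; split=> // i e.
  have := congr1 (fun k => k i) Et.
  by rewrite (coind_caseF _ _ e) (coind_caseF _ _ e).
have := congr1 (fun k => k i) Et.
by rewrite (coind_caseT _ _ e) (coind_caseT _ _ e).
Qed.

Lemma muT_trunc_eqP Y (f g : Y -> sterm) p :
  muT_trunc f p = muT_trunc g p -> muT_all (fun y => f y = g y) p.
Proof.
elim: p => // c xs ts IH us /muT_trunc_node_inj[_ Et Eu]; split=> // i e.
exact/IH/Et.
Qed.

(** Whatever is observed at the coinductive positions, the tree above them stays visible, bound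
    names included; so level 1 already fixes the shape of a mixed term. *)
Lemma muT_trunc_shape Y Z (f : Y -> sterm) (g : Z -> sterm) p q :
  muT_trunc f p = muT_trunc g q -> Defs.shape p = Defs.shape q.
Proof.
elim: p q => [x|c xs ts IH us] [y|c' xs' ts' us'] //; first by case=> ->.
move=> E; have ec : c = c' by case: E.
subst c'; have [-> Et _] := muT_trunc_node_inj E.
by apply: MNode_ext => // i e; apply/IH/Et.
Qed.

Lemma shape_node_inv Y (w : muT Y) (c : Sg) (xs : forall i : slot c, (nbind i).-tuple V)
    ss uu : Defs.shape w = MNode xs ss uu ->
  exists ts us, w = MNode xs ts us /\ forall i e, Defs.shape (ts i e) = ss i e.
Proof.
case: w => // c' xs' ts us E; have ec : c' = c by case: E.
subst c'; have [Ex Et _] := MNode_inj E; exists ts, us; split.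
  rewrite -Ex; apply: MNode_ext => // i; apply: val_inj.
  by rewrite /= map_id.
by move=> i e; rewrite -Et.
Qed.

(** A family of trees of one shape becomes one tree filled with families. Applied to pairs and to
    sequences of mixed terms, this makes them states of a coalgebra. *)
Lemma muT_zip (I Y : Type) (i0 : I) (w : I -> muT Y) :
  (forall i, Defs.shape (w i) = Defs.shape (w i0)) ->
  exists p : muT (I -> Y), forall i, muT_map id (fun y => y i) p = w i.
Proof.
move: (Defs.shape _) => s; elim: s w => [x|c xs ss IH uu] w ws.
  exists (MVar _ _ x) => i; move: (ws i); by case: (w i) => //= y [->].
have /dep_choice[ts tsP] := fun i => shape_node_inv (ws i).
have /dep_choice[us usP] := tsP.
have /dep_choice[P PP] : forall j, exists q : ~~ coind j -> muT (I -> Y),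
    forall e i, muT_map id (fun y => y i) (q e) = ts i j e.
  move=> j; apply: (dep_choice (P := fun e q => forall i,
    muT_map id (fun y => y i) q = ts i j e)) => e; apply: (IH j e) => i.
  by have [_ ->] := usP i.
exists (MNode xs P (fun j e i => us i j e)) => i; have [-> _] := usP i.
apply: MNode_ext => // j.
by apply: val_inj; rewrite /= map_id.
Qed.

Lemma mtruncS (t : mterm) n :
  mtrunc t n.+1 = muT_trunc (fun u => mtrunc u n) (mout t).
Proof. by []. Qed.

Lemma strunc_mtrunc m n (t : mterm) : (m <= n)%N -> strunc (mtrunc t n) m = mtrunc t m.
Proof.
elim: n m t => [|n IH] [|m] t //; try by rewrite ?mtruncS; case: (mout t).
move=> mn; rewrite !mtruncS; elim: (mout t) => [//|c xs ts IHt us].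
apply: Node_ext => // i.
case E : (coind i); last first.
  have e : ~~ coind i by rewrite E.
  rewrite (coind_caseF _ _ e) (coind_caseF _ _ e).
  by rewrite subn0; apply: IHt.
rewrite (coind_caseT _ _ E) (coind_caseT _ _ E).
by rewrite subn1; apply: IH.
Qed.

Lemma mtrunc_refining : refining (fun n (t : mterm) => mtrunc t n).
Proof.
split=> // m n t u mn tu.
by rewrite -(strunc_mtrunc _ mn) tu strunc_mtrunc.
Qed.

Lemma mtrunc_munfold Y (g : Y -> muT Y) (f : nat -> Y -> sterm) :
  (forall y, f 0%N y = star V Sg) ->
  (forall y n, f n.+1 y = muT_trunc (f n) (g y)) ->
  forall y n, mtrunc (munfold g y) n = f n y.
Proof.
move=> f0 fS y n; elim: n y => [|n IH] y; first by rewrite f0.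
by rewrite mtruncS mout_munfold muT_trunc_map fS; apply: eq_muT_trunc.
Qed.

(** Coinduction: pairs agreeing at all levels form a coalgebra for which both projections are
    coalgebra maps, so these are equal by [munfold_uniq]. *)
Lemma mtrunc_sep (t u : mterm) : (forall n, mtrunc t n = mtrunc u n) -> t = u.
Proof.
move=> tu.
pose Y := {v : bool -> mterm | forall n, mtrunc (v true) n = mtrunc (v false) n}.
have /choice[g gE] : forall y : Y, exists p : muT Y,
    forall b, mout (sval y b) = muT_map id (fun z : Y => sval z b) p.
  move=> [v vE] /=; have [|p pE] := muT_zip (w := fun b => mout (v b)) (i0 := true).
    by case=> //=; have := vE 1%N; rewrite !mtruncS => /esym/muT_trunc_shape.
  have [q qE] : exists q : muT Y, muT_map id sval q = p.
    apply: muT_all_lift; apply: muT_all_forall => n; apply: muT_trunc_eqP.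
    have := vE n.+1; rewrite !mtruncS -[mout (v true)]pE -[mout (v false)]pE.
    by rewrite !muT_trunc_map.
  by exists q => b; rewrite -[LHS]pE -qE muT_map_comp.
pose y0 : Y := exist _ (fun b => if b then t else u) tu.
apply: (munfold_uniq (g := g) (h := fun y => sval y true) (h' := fun y => sval y false)
  _ _ y0); by move=> y; rewrite gE.
Qed.

(** The limit is unfolded from a coalgebra whose states are the coherent sequences. *)
Lemma mterm_complete : lv_complete (fun n (t : mterm) => mtrunc t n).
Proof.
move=> v vP.
pose Y := {v : nat -> mterm | forall n k, (n <= k)%N -> mtrunc (v k) n = mtrunc (v n) n}.
(* The shift to [k.+1] is essential: level 0 carries no information, whereas from index 1 on all
   shapes agree. Level [n] of a state is then read off the [n]-th entry of its sequence. *)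
have /choice[g gE] : forall y : Y, exists p : muT Y,
    forall k, mout (sval y k.+1) = muT_map id (fun z : Y => sval z k) p.
  move=> [{vP}v vP] /=.
  have [|p pE] := muT_zip (w := fun k => mout (v k.+1)) (i0 := 0%N).
    by move=> k; have := vP 1%N k.+1 isT; rewrite !mtruncS => /muT_trunc_shape.
  have [q qE] : exists q : muT Y, muT_map id sval q = p.
    apply: muT_all_lift; apply: muT_all_forall => n; apply: muT_all_forall => k.
    have [nk|kn] := leqP n k; last by apply: muT_allT.
    apply: (muT_all_impl (P := fun y : nat -> mterm => mtrunc (y k) n = mtrunc (y n) n)).
      by move=> y E _.
    apply: muT_trunc_eqP; have := vP n.+1 k.+1 nk.
    by rewrite !mtruncS -(pE k) -(pE n) !muT_trunc_map.
  by exists q => b; rewrite -[LHS]pE -qE muT_map_comp.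
exists (munfold g (exist _ v vP : Y)) => n.
rewrite (mtrunc_munfold (f := fun n (y : Y) => mtrunc (sval y n) n))// => y m.
by rewrite mtruncS gE muT_trunc_map.
Qed.

Lemma mtrunc_act s (t : mterm) n : mtrunc (mact s t) n = term_act s (mtrunc t n).
Proof.
elim: n t => [|n IH] t; first by rewrite [RHS]term_act_star.
rewrite !mtruncS mout_mact; elim: (mout t) => [//|c xs ts IHt us].
apply: Node_ext => // i; case E : (coind i); last first.
  have e : ~~ coind i by rewrite E.
  by rewrite (coind_caseF _ _ e) (coind_caseF _ _ e); apply: IHt.
by rewrite (coind_caseT _ _ E) (coind_caseT _ _ E); apply: IH.
Qed.

Definition mtrunc_hom n : nhom (mterm_pset V Sg) (term_nom V (star_mbs Sg)) :=
  @Defs.Hom V (mterm_pset V Sg) (term_nom V (star_mbs Sg)) ((@mtrunc V Sg)^~ n)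
    (fun s t => mtrunc_act s t n).

Lemma mtrunc_emb (t : term V Sg) n : mtrunc (emb t) n = trunc t n.
Proof.
elim: n t => [|n IH] t; first by case: t.
rewrite mtruncS mout_munfold muT_trunc_map; elim: t => [//|c xs ts IHt].
apply: Node_ext => // i; case E : (coind i); last first.
  have e : ~~ coind i by rewrite E.
  by rewrite (coind_caseF _ _ e) subn0; apply: IHt.
by rewrite (coind_caseT _ _ E) subn1; apply: IH.
Qed.

Lemma trunc_sfill x0 m n (t : mterm) : (m <= n)%N ->
  trunc (sfill x0 (mtrunc t n)) m = mtrunc t m.
Proof.
elim: n m t => [|n IH] [|m] t //; try by case: (sfill _ _).
move=> mn; rewrite !mtruncS; elim: (mout t) => [//|c xs ts IHt us].
apply: Node_ext => // i.
case E : (coind i); last first.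
  have e : ~~ coind i by rewrite E.
  by rewrite (coind_caseF _ _ e) (coind_caseF _ _ e) subn0; apply: IHt.
by rewrite (coind_caseT _ _ E) (coind_caseT _ _ E) subn1; apply: IH.
Qed.

End MixedTerms.

Lemma term_completion {R : realType} {V : eqType} (Vinf : infinite_set [set: V])
    {Sg : mbs} :
  is_completion (@term_dist R V Sg) (@mterm_dist R V Sg) (emb_hom V Sg).
Proof.
apply: (lv_completion (lvA := fun n t => @trunc V Sg t n)
    (lvB := fun n t => @mtrunc V Sg t n)).
- exact: trunc_refining.
- exact: mtrunc_refining.
- exact: trunc_sep.
- exact: mtrunc_sep.
- by move=> n a; apply: mtrunc_emb.
- have [x0 _] := fresh_var Vinf [::].
  by move=> t n; exists (sfill x0 (mtrunc t n)); apply: trunc_sfill.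
exact: mterm_complete.
Qed.

Lemma term_nominal_completion {R : realType} {V : eqType}
    (Vinf : infinite_set [set: V]) {Sg : mbs} :
  is_nominal_completion (A := term_nom V Sg) (B := fs (mterm_pset V Sg))
    (@term_dist R V Sg) (fun t u : fs (mterm_pset V Sg) => mterm_dist (R := R) (sval t) (sval u))
    (fs_hom (emb_hom V Sg)).
Proof.
apply: (lv_nominal_completion Vinf (lvA := trunc_hom) (lvB := mtrunc_hom)).
- exact: trunc_refining.
- exact: mtrunc_refining.
- exact: trunc_sep.
- exact: mtrunc_sep.
- by move=> n a; apply: mtrunc_emb.
- have [x0 _] := fresh_var Vinf [::].
  move=> [t [S St]]; exists (fun n => sfill x0 (mtrunc t n)).
  split=> [|n]; last exact: trunc_sfill.
  exists (x0 :: S) => n x /supp_sfill[->|tx].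
    by rewrite inE eqxx.
  by rewrite inE (tx S (hom_supports (mtrunc_hom n) St)) orbT.
exact: mterm_complete.
Qed.

(** * Initial algebras *)

Lemma hom_app (V : eqType) (A B : pset V) (f g : nhom A B) :
  f = g -> forall a, f a = g a.
Proof. by move=> ->. Qed.

Section TermAlgebra.
Context {V : eqType} {Sg : mbs}.
Notation muT := (muT V Sg).

Program Definition muT_pset (Y : pset V) : pset V :=
  @PSet V (muT Y) (fun s => muT_map s (act s)) _ _.
Next Obligation.
move=> Y p; rewrite -[RHS](muT_map_id p); congr muT_map.
by apply/funext => y; rewrite act1.
Qed.
Next Obligation.
move=> Y s t p; rewrite [RHS]muT_map_comp; congr muT_map.
by apply/funext => y; rewrite /= actM.
Qed.

Lemma muT_actN (Y : pset V) s (c : Sg) (xs : forall i : slot c, (nbind i).-tuple V)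
    (ts : forall i, ~~ coind i -> muT Y) (us : forall i, coind i -> Y) :
  act (p := muT_pset Y) s (MNode xs ts us) =
  MNode (fun i => [tuple of map s (xs i)])
    (fun i e => act (p := muT_pset Y) s (ts i e)) (fun i e => act s (us i e)).
Proof. by []. Qed.

(** The arguments of [MNode] are indexed by proofs of a Boolean, so each fibre [D i] has at most one
    element and only finitely many supports are joined. *)
Lemma fin_supports_dep (I : finType) (D : I -> Type) (H : forall i, D i -> nom V)
    (dec : forall i, {d : D i | forall d', d' = d} + {D i -> False})
    (a : forall i d, H i d) :
  exists S : seq V, forall i d, supports S (a i d).
Proof.
have /choice[S SP] : forall i, exists S : seq V, forall d, supports S (a i d).
  move=> i; case: (dec i) => [[d dP]|nd]; last by exists [::] => d; case: (nd d).
  by have [S Sa] := nomP (a i d); exists S => d'; rewrite (dP d').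
exists (flatten [seq S i | i <- enum I]) => i d; apply: supports_sub (SP i d) => x xS.
by apply/flattenP; exists (S i) => //; apply/map_f; rewrite mem_enum.
Qed.

Lemma bool_dec (b : bool) : {d : b | forall d' : b, d' = d} + {b -> False}.
Proof.
case: b; last by right.
by left; exists isT => d'; apply: bool_irrelevance.
Qed.

Program Definition muT_nom (Y : nom V) : nom V := @Nom V (muT_pset Y) _.
Next Obligation.
move=> Y; elim=> [x|c xs ts IH us].
  by exists [:: x] => s sS /=; rewrite sS// inE.
have [S1 h1] := fin_supports (H := fun i : slot c => vars_nom (nbind i)) xs.
have [S2 h2] := fin_supports_dep (D := fun i : slot c => coind i)
  (H := fun _ _ => Y) (fun i => bool_dec (coind i)) us.
have /choice[S3 h3] : forall i : slot c, exists S : seq V,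
    forall e, supports (A := muT_pset Y) S (ts i e).
  move=> i; case: (bool_dec (~~ coind i)) => [[e eP]|ne].
    by have [S Se] := IH i e; exists S => e'; rewrite (eP e').
  by exists [::] => e; case: (ne e).
exists (S1 ++ S2 ++ flatten [seq S3 i | i <- enum (slot c)]) => s sS.
apply: MNode_ext => i.
- by apply: (h1 i) => x xS; rewrite sS// mem_cat xS.
- move=> e; apply: (h3 i e) => x xS; rewrite sS// !mem_cat; apply/orP; right.
  apply/orP; right; apply/flattenP; exists (S3 i) => //; apply: map_f.
  by rewrite mem_enum.
by move=> e; apply: (h2 i e) => x xS; rewrite sS// !mem_cat xS orbT.
Qed.

(** [MNode] keeps inductive and coinductive arguments in two families guarded by proofs, whereas the
    functor has a single [sel]-valued family; [sel_ind], [sel_coi] and [sel_case] pass between the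
    two forms. *)
Definition sel_ind (b : bool) (X Y : nom V) : ~~ b -> sel b X Y -> X :=
  match b with true => fun e => False_rect _ (notF e) | false => fun _ => id end.

Definition sel_coi (b : bool) (X Y : nom V) : b -> sel b X Y -> Y :=
  match b with true => fun _ => id | false => fun e => False_rect _ (notF e) end.

Definition sel_case (b : bool) (X Y : nom V) : (~~ b -> X) -> (b -> Y) -> sel b X Y :=
  match b with true => fun _ g => g isT | false => fun f _ => f isT end.

Lemma sel_caseK (b : bool) (X Y : nom V) (a : sel b X Y) :
  sel_case (fun e => sel_ind e a) (fun e => sel_coi e a) = a.
Proof. by case: b a. Qed.

Lemma sel_case_eq (b : bool) (X Y : nom V) (f f' : ~~ b -> X) (g g' : b -> Y) :
  (forall e, f e = f' e) -> (forall e, g e = g' e) -> sel_case f g = sel_case f' g'.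
Proof. by case: b f f' g g' => f f' g g' ff' gg' /=. Qed.

Lemma sel_caseF (b : bool) (X Y : nom V) (f : ~~ b -> X) (g : b -> Y) e :
  sel_ind e (sel_case f g) = f e.
Proof. by case: b f g e => // f g e; rewrite (bool_irrelevance e isT). Qed.

Lemma sel_caseT (b : bool) (X Y : nom V) (f : ~~ b -> X) (g : b -> Y) e :
  sel_coi e (sel_case f g) = g e.
Proof. by case: b f g e => // f g e; rewrite (bool_irrelevance e isT). Qed.

Lemma sel_map_case (b : bool) (X X' Y Y' : nom V) (h : nhom X X') (k : nhom Y Y')
    (f : ~~ b -> X) (g : b -> Y) :
  sel_map b h k (sel_case f g) = sel_case (fun e => h (f e)) (fun e => k (g e)).
Proof. by case: b f g. Qed.

Lemma sel_elt_case (b : bool) (X Y : nom V) x y :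
  sel_elt b x y = @sel_case b X Y (fun=> x) (fun=> y).
Proof. by case: b. Qed.

Lemma sel_ind_act (b : bool) (X Y : nom V) (e : ~~ b) s (a : sel b X Y) :
  sel_ind e (act s a) = act s (sel_ind e a).
Proof. by case: b e a. Qed.

Lemma sel_coi_act (b : bool) (X Y : nom V) (e : b) s (a : sel b X Y) :
  sel_coi e (act s a) = act s (sel_coi e a).
Proof. by case: b e a. Qed.

Notation T := (term_functor V Sg).

Definition term_in_fun (Y : nom V) (a : T (muT_nom Y) Y) : muT_nom Y :=
  match a with
  | inl x => MVar _ _ x
  | inr (existT c t) => MNode (fun i => (t i).1)
      (fun i e => sel_ind e (t i).2) (fun i e => sel_coi e (t i).2)
  end.

Lemma term_in_subproof (Y : nom V) s a :
  @term_in_fun Y (act s a) = act s (term_in_fun a).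
Proof.
case: a => [x//|[c t]].
apply: MNode_ext => // i e.
  exact: (sel_ind_act (X := muT_nom Y) (Y := Y) e s (t i).2).
exact: (sel_coi_act (X := muT_nom Y) (Y := Y) e s (t i).2).
Qed.

Definition term_in (Y : nom V) : nhom (T (muT_nom Y) Y) (muT_nom Y) :=
  Defs.Hom (@term_in_subproof Y).

Definition term_node (X Y : nom V) (c : Sg) (xs : forall i : slot c, (nbind i).-tuple V)
    (ts : forall i : slot c, ~~ coind i -> X) (us : forall i : slot c, coind i -> Y) :
    T X Y :=
  inr (existT _ c (fun i => (xs i, sel_case (ts i) (us i)))).

Lemma term_in_node (Y : nom V) (c : Sg) (xs : forall i : slot c, (nbind i).-tuple V)
    (ts : forall i : slot c, ~~ coind i -> muT_nom Y) (us : forall i : slot c, coind i -> Y) :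
  term_in Y (term_node xs ts us) = MNode xs ts us.
Proof.
apply: MNode_ext => // i e.
  exact: (sel_caseF (X := muT_nom Y) (Y := Y) (ts i) (us i) e).
exact: (sel_caseT (X := muT_nom Y) (Y := Y) (ts i) (us i) e).
Qed.

Lemma term_node_eta (X Y : nom V) (a : T X Y) : (exists x, a = inl x) \/
  exists (c : Sg) xs ts us, a = @term_node X Y c xs ts us.
Proof.
case: a => [x|[c t]]; [by left; exists x|right].
exists c, (fun i => (t i).1), (fun i e => sel_ind e (t i).2),
  (fun i e => sel_coi e (t i).2).
congr (inr (existT _ _ _)); apply/functional_extensionality_dep => i.
by rewrite sel_caseK; case: (t i).
Qed.

Lemma term_map_node (X X' Y Y' : nom V) (h : nhom X X') (k : nhom Y Y') (c : Sg)
    (xs : forall i : slot c, (nbind i).-tuple V)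
    (ts : forall i : slot c, ~~ coind i -> X) (us : forall i : slot c, coind i -> Y) :
  bmap T h k (term_node xs ts us) =
  term_node xs (fun i e => h (ts i e)) (fun i e => k (us i e)).
Proof.
congr (inr (existT _ _ _)); apply/functional_extensionality_dep => i.
by congr pair; apply: sel_map_case.
Qed.

Lemma term_node_act (X Y : nom V) (c : Sg) (xs : forall i : slot c, (nbind i).-tuple V)
    (ts : forall i : slot c, ~~ coind i -> X) (us : forall i : slot c, coind i -> Y) s :
  act s (term_node xs ts us) = term_node (fun i => [tuple of map s (xs i)])
    (fun i e => act s (ts i e)) (fun i e => act s (us i e)).
Proof.
congr (inr (existT _ _ _)); apply/functional_extensionality_dep => i.
by congr pair => /=; case: (coind i) (ts i) (us i).
Qed.

Fixpoint muT_fold (Y B : nom V) (b : nhom (T B Y) B) (p : muT Y) : B :=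
  match p with
  | MVar x => b (inl x)
  | MNode c xs ts us => b (term_node xs (fun i e => muT_fold b (ts i e)) us)
  end.

Lemma muT_fold_act (Y B : nom V) (b : nhom (T B Y) B) s (p : muT_nom Y) :
  muT_fold b (act s p) = act s (muT_fold b p).
Proof.
elim: p => [x|c xs ts IH us]; first by rewrite -homP.
rewrite muT_actN /= -homP term_node_act; congr (b _).
congr (inr (existT _ _ _)); apply/functional_extensionality_dep => i.
by congr pair; apply: sel_case_eq => // e; apply: IH.
Qed.

Lemma term_initial (Y : nom V) :
  @initial_algebra V (slice T Y) (muT_nom Y) (term_in Y).
Proof.
move=> B b; exists (Defs.Hom (muT_fold_act b)); split.
  apply: hom_ext => a; have [[x ->//]|[c [xs [ts [us ->]]]]] := term_node_eta a.
  transitivity (muT_fold b (term_in Y (term_node xs ts us))); first by [].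
  transitivity (b (bmap T (Defs.Hom (muT_fold_act b)) (hid Y) (term_node xs ts us)));
    last by [].
  by rewrite term_map_node term_in_node.
move=> h hE; apply: hom_ext => p; symmetry; elim: p => [x|c xs ts IH us] /=.
  exact: (hom_app hE (inl x)).
rewrite -[in LHS](term_in_node (Y := Y) xs ts us).
transitivity (b (bmap T h (hid Y) (term_node (X := muT_nom Y) xs ts us))).
  exact: (hom_app hE (term_node (X := muT_nom Y) xs ts us)).
rewrite term_map_node; congr (b _).
congr (inr (existT _ _ _)); apply/functional_extensionality_dep => i.
by congr pair; apply: sel_case_eq => // e; apply: IH.
Qed.

Definition term_mu : mu_of T := @MuOf V T muT_nom term_in term_initial.

Lemma term_mu_map (Y Y' : nom V) (g : nhom Y Y') p :
  mu_map term_mu g p = muT_map id g p.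
Proof.
have H s (q : muT_nom Y) : muT_map id g (act s q) =
    act (p := muT_nom Y') s (muT_map id g q).
  rewrite /= !muT_map_comp; congr muT_map.
  by apply/funext => y /=; rewrite homP.
pose k := @Defs.Hom V (muT_nom Y) (muT_nom Y') (muT_map id g) H.
rewrite (@mu_map_uniq V T term_mu Y Y' g k)//.
apply: hom_ext => a; have [[x ->//]|[c [xs [ts [us ->]]]]] := term_node_eta a.
transitivity (muT_map id g (term_in Y (term_node (X := muT_nom Y) xs ts us))); first by [].
rewrite term_in_node.
transitivity (term_in Y' (bmap T k g (term_node (X := muT_nom Y) xs ts us))); last by [].
rewrite term_map_node term_in_node; apply: MNode_ext => // i.
by apply: val_inj; rewrite /= map_id.
Qed.

End TermAlgebra.

(* An algebra for a quotient F of G is a G-algebra; identifying the elements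
   of mu G which are not separated by any F-algebra gives mu F. *)
Section QuotientAlgebra.
Context {V : eqType} (G F : bifunctor V) (MG : mu_of G).
Context (eta : forall X Y : nom V, nhom (G X Y) (F X Y)).
Context (eta_nat : forall (X X' Y Y' : nom V) (f : nhom X X') (g : nhom Y Y') a,
  eta X' Y' (bmap G f g a) = bmap F f g (eta X Y a)).
Context (eta_surj : forall (X X' Y : nom V) (f : nhom X X'),
  (forall x, exists y, f y = x) ->
  forall a, exists u, eta X' Y (bmap G f (hid Y) u) = a).

Definition mu_fold (Y B : nom V) (b : nhom (F B Y) B) : nhom (MG Y) B :=
  sval (cid (mu_init MG (Y := Y) (hcomp b (eta B Y)))).

Lemma mu_foldE (Y B : nom V) (b : nhom (F B Y) B) u :
  mu_fold b (mu_in MG Y u) = b (eta B Y (bmap G (mu_fold b) (hid Y) u)).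
Proof.
rewrite /mu_fold; case: cid => h [hE _] /=.
exact: (hom_app hE u).
Qed.

Lemma mu_fold_uniq (Y B : nom V) (b : nhom (F B Y) B) (h : nhom (MG Y) B) :
  (forall u, h (mu_in MG Y u) = b (eta B Y (bmap G h (hid Y) u))) -> mu_fold b = h.
Proof.
by move=> hE; rewrite /mu_fold; case: cid => k [_ kU] /=; apply: kU; apply: hom_ext.
Qed.

Definition muq_rel (Y : nom V) (p q : MG Y) : Prop :=
  forall (B : nom V) (b : nhom (F B Y) B), mu_fold b p = mu_fold b q.

Lemma muq_relP (Y : nom V) s (p q : MG Y) : muq_rel p q -> muq_rel (act s p) (act s q).
Proof. by move=> pq B b; rewrite !homP pq. Qed.

Definition muq (Y : nom V) : nom V := quot_nom (@muq_relP Y).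

Definition muq_pi (Y : nom V) : nhom (MG Y) (muq Y) := qpi_hom (@muq_relP Y).

Lemma muq_pi_surj (Y : nom V) (m : muq Y) : exists p, muq_pi Y p = m.
Proof. exact: qpi_surj. Qed.

Lemma muq_fold_subproof (Y B : nom V) (b : nhom (F B Y) B) s (m : muq Y) :
  qlift (mu_fold b) (act s m) = act s (qlift (mu_fold b) m).
Proof.
have [p <-] := muq_pi_surj m; rewrite -homP.
have E (x y : MG Y) : muq_rel x y -> mu_fold b x = mu_fold b y by apply.
by rewrite [in LHS](qliftE E) (qliftE E) homP.
Qed.

Definition muq_fold (Y B : nom V) (b : nhom (F B Y) B) : nhom (muq Y) B :=
  Defs.Hom (muq_fold_subproof b).

Lemma muq_foldE (Y B : nom V) (b : nhom (F B Y) B) p :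
  muq_fold b (muq_pi Y p) = mu_fold b p.
Proof. by apply: qliftE => x y; apply. Qed.

Lemma muq_in_exists (Y : nom V) (a : F (muq Y) Y) :
  exists u, eta _ _ (bmap G (muq_pi Y) (hid Y) u) = a.
Proof. exact/eta_surj/muq_pi_surj. Qed.

Definition muq_in_fun (Y : nom V) (a : F (muq Y) Y) : muq Y :=
  muq_pi Y (mu_in MG Y (sval (cid (muq_in_exists a)))).

Lemma mu_fold_in (Y B : nom V) (b : nhom (F B Y) B) u :
  mu_fold b (mu_in MG Y u) =
  b (bmap F (muq_fold b) (hid Y) (eta _ _ (bmap G (muq_pi Y) (hid Y) u))).
Proof.
rewrite mu_foldE -eta_nat; congr (b (eta _ _ _)).
have -> : mu_fold b = hcomp (muq_fold b) (muq_pi Y).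
  by apply: hom_ext => p; rewrite -muq_foldE.
rewrite -[in LHS](_ : hcomp (hid Y) (hid Y) = hid Y); last exact: hom_ext.
by rewrite bmapM.
Qed.

(** Independence of the chosen preimage: by [mu_fold_in], the fold of [mu_in MG Y u] into any
    algebra depends on [u] only through its image in [F (muq Y) Y], and folds are all that [muq_rel]
    compares. *)
Lemma muq_inE (Y : nom V) u :
  muq_in_fun (eta _ _ (bmap G (muq_pi Y) (hid Y) u)) = muq_pi Y (mu_in MG Y u).
Proof.
rewrite /muq_in_fun; case: cid => v /= vE.
by apply: qpi_eq => B b; rewrite !mu_fold_in vE.
Qed.

Lemma muq_in_subproof (Y : nom V) s (a : F (muq Y) Y) :
  muq_in_fun (act s a) = act s (muq_in_fun a).
Proof. by 
by have [u <-] := muq_in_exists a; rewrite muq_inE -[in LHS]homP -[in LHS]homP muq_inE !homP.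
Qed.

Definition muq_in (Y : nom V) : nhom (F (muq Y) Y) (muq Y) :=
  Defs.Hom (@muq_in_subproof Y).

Lemma muq_initial (Y : nom V) : @initial_algebra V (slice F Y) (muq Y) (muq_in Y).
Proof.
move=> B b; exists (muq_fold b); split.
  apply: hom_ext => a; have [u <-] := muq_in_exists a.
  transitivity (muq_fold b (muq_in_fun (eta _ _ (bmap G (muq_pi Y) (hid Y) u)))).
    by [].
  by rewrite muq_inE muq_foldE mu_fold_in.
move=> h hE; apply: hom_ext => m; have [p <-] := muq_pi_surj m.
symmetry; rewrite muq_foldE (mu_fold_uniq (h := hcomp h (muq_pi Y)))// => u.
transitivity (h (muq_pi Y (mu_in MG Y u))); first by [].
rewrite -muq_inE.
rewrite [LHS](hom_app hE (eta _ _ (bmap G (muq_pi Y) (hid Y) u))).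
congr (b _); rewrite -[LHS]eta_nat; congr (eta _ _ _).
rewrite -[in RHS](_ : hcomp (hid Y) (hid Y) = hid Y); last exact: hom_ext.
by rewrite bmapM.
Qed.

Lemma mu_quotient : exists (M : mu_of F) (pi : forall Y, nhom (MG Y) (M Y)),
  forall Y, (forall m, exists p, pi Y p = m) /\
    forall u, pi Y (mu_in MG Y u) = mu_in M Y (eta _ _ (bmap G (pi Y) (hid Y) u)).
Proof.
exists (@MuOf V F muq muq_in muq_initial), muq_pi => Y; split=> [m|u].
  exact: muq_pi_surj.
by rewrite -[RHS]/(muq_in_fun _) muq_inE.
Qed.

End QuotientAlgebra.

(** * The terminal coalgebra of finitely supported raw mixed terms *)

Section MixedTermCoalgebra.
Context {V : eqType} {Sg : mbs}.
Notation muT := (muT V Sg).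
Notation T := (term_functor V Sg).
Notation Tinf := (mterm_pset V Sg).

Lemma muT_map_inj Y Z (f : Y -> Z) : injective f -> injective (muT_map (V := V) (Sg := Sg) id f).
Proof.
move=> finj; elim=> [x|c xs ts IH us] [y|c' xs' ts' us'] //; first by case=> ->.
move=> E; have ec : c = c' by case: E.
subst c'; have [Ex Et Eu] := MNode_inj E; apply: MNode_ext => i.
- by have /(congr1 val) := congr1 (fun k => k i) Ex; rewrite /= !map_id => /val_inj.
- by move=> e; apply: IH; apply: (congr1 (fun k => k i e) Et).
by move=> e; apply: finj; apply: (congr1 (fun k => k i e) Eu).
Qed.

(** Raw trees carry their names, so a permutation fixing [p] fixes every entry at a coinductive
    position; hence [S] supports all entries. *)
Lemma muT_fs_lift (A : pset V) S (p : muT A) : supports (A := muT_pset A) S p ->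
  exists p' : muT (fs A), muT_map id sval p' = p.
Proof.
move=> Sp; apply: (muT_all_lift (P := fun a : A => exists S, supports S a)).
have H : muT_all (fun a => forall s : {s : vperm V | forall x, x \in S -> s x = x},
    act (sval s) a = a) p.
  apply: muT_all_forall => -[s sS] /=.
  apply: (muT_map_eqP (v := s) (w := id) (f := act s) (g := id)).
  by rewrite muT_map_id; apply: Sp.
by apply: muT_all_impl H => a aS; exists S => s sS; apply: (aS (exist _ s sS)).
Qed.

Lemma fs_out_exists (t : fs Tinf) : exists p : muT (fs Tinf),
  muT_map id sval p = mout (sval t).
Proof.
have [S St] := svalP t; apply: (@muT_fs_lift Tinf S) => s sS.
by rewrite -[LHS]mout_mact -[mact s _]/(act s (sval t)) St.
Qed.

Definition fs_out_fun (t : fs Tinf) : muT_nom (fs Tinf) := sval (cid (fs_out_exists t)).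

Lemma fs_outE t : muT_map id sval (fs_out_fun t) = mout (sval t).
Proof. by rewrite /fs_out_fun; case: cid. Qed.

Lemma sval_inj (A : Type) (P : A -> Prop) : injective (sval : {x | P x} -> A).
Proof. by move=> a b; apply: sig_ext. Qed.

Lemma fs_out_subproof s t : fs_out_fun (act s t) = act s (fs_out_fun t).
Proof.
apply: (muT_map_inj (@sval_inj _ _)); rewrite fs_outE [LHS]mout_mact -fs_outE.
by rewrite !muT_map_comp.
Qed.

Definition fs_out : nhom (fs Tinf) (muT_nom (fs Tinf)) := Defs.Hom fs_out_subproof.

Lemma munfold_act (C : nom V) (c : nhom C (muT_nom (Sg := Sg) C)) s x :
  munfold c (act s x) = mact s (munfold c x).
Proof.
apply: (munfold_uniq (g := fun x => muT_map s id (c x)) (h := fun x => munfold c (act s x))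
  (h' := fun x => mact s (munfold c x))) => {}x.
  by rewrite mout_munfold homP /= !muT_map_comp.
by rewrite mout_mact mout_munfold !muT_map_comp.
Qed.

Lemma fs_out_terminal : terminal_coalgebra (F := mu_functor (term_mu (Sg := Sg))) fs_out.
Proof.
move=> C c; pose h := fs_hom (@Defs.Hom V C Tinf (munfold c) (munfold_act c)).
exists h; split.
  apply: hom_ext => x; apply: (muT_map_inj (@sval_inj _ _)).
  rewrite [LHS]fs_outE [LHS]mout_munfold.
  rewrite -[fobj _ _]/(muT_nom _) [RHS](congr1 _ (term_mu_map h (c x))).
  by rewrite muT_map_comp.
move=> k kE; apply: hom_ext => x; apply: sig_ext.
apply: (munfold_uniq (g := c) (h := munfold c) (h' := fun x => sval (k x))) => {}x.
  exact: mout_munfold.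
have E : fs_out (k x) = muT_map id k (c x).
  by rewrite -term_mu_map; apply: (hom_app kE x).
by rewrite -fs_outE [fs_out_fun _]E muT_map_comp.
Qed.

Lemma fs_out_unfolding : mterm_unfolding (M := term_mu) fs_out.
Proof.
split=> [t x tx|t c xs ts tE]; apply: (muT_map_inj (@sval_inj _ _)); rewrite fs_outE.
  by rewrite tx.
rewrite tE.
transitivity (muT_map id sval (MNode xs (fun i _ => fs_out (ts i)) (fun i _ => ts i))).
  apply: MNode_ext => // i.
    by apply: val_inj; rewrite /= map_id.
  by move=> _; symmetry; apply: fs_outE.
rewrite -[X in muT_map id sval X](term_in_node (Y := fs Tinf)).
apply: (congr1 (fun g => muT_map id sval (term_in (fs Tinf) (inr (existT _ c g))))).
apply/functional_extensionality_dep => i; congr pair; symmetry; exact: sel_elt_case.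
Qed.

End MixedTermCoalgebra.

(** * The initial algebras for name abstraction *)

Section AlphaAlgebra.
Context {V : eqType} {Sg : mbs}.
Notation T := (term_functor V Sg).
Notation Ta := (alpha_functor V Sg).

Definition abstn_hom n (A : nom V) : nhom (prod_nom (vars_nom n) A) (absn_nom n A) :=
  @Defs.Hom V (prod_nom (vars_nom n) A) (absn_nom n A) (fun xa => abstn xa.1 xa.2)
    (fun s xa => esym (abstn_act s xa.1 xa.2)).

Definition alpha_quot (X Y : nom V) : nhom (T X Y) (Ta X Y) :=
  sp_map (fun c (i : slot c) => abstn_hom (nbind i) (sel (coind i) X Y)).

Definition alpha_node (X Y : nom V) (c : Sg) (xs : forall i : slot c, (nbind i).-tuple V)
    (ts : forall i : slot c, ~~ coind i -> X) (us : forall i : slot c, coind i -> Y) :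
    Ta X Y :=
  inr (existT _ c (fun i => abstn (xs i) (sel_case (ts i) (us i)))).

Lemma alpha_quot_node (X Y : nom V) (c : Sg) (xs : forall i : slot c, (nbind i).-tuple V)
    (ts : forall i : slot c, ~~ coind i -> X) (us : forall i : slot c, coind i -> Y) :
  alpha_quot X Y (term_node xs ts us) = alpha_node xs ts us.
Proof. by []. Qed.

Lemma alpha_map_node (X X' Y Y' : nom V) (h : nhom X X') (k : nhom Y Y') (c : Sg)
    (xs : forall i : slot c, (nbind i).-tuple V)
    (ts : forall i : slot c, ~~ coind i -> X) (us : forall i : slot c, coind i -> Y) :
  bmap Ta h k (alpha_node xs ts us) =
  alpha_node xs (fun i e => h (ts i e)) (fun i e => k (us i e)).
Proof.
congr (inr (existT _ _ _)); apply/functional_extensionality_dep => i.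
by rewrite -sel_map_case; apply: absn_map_abstn.
Qed.

Lemma alpha_node_eq (X Y : nom V) (c : Sg)
    (xs xs' : forall i : slot c, (nbind i).-tuple V)
    (ts ts' : forall i : slot c, ~~ coind i -> X)
    (us us' : forall i : slot c, coind i -> Y) :
  (forall i, abstn (xs i) (sel_case (ts i) (us i)) =
             abstn (xs' i) (sel_case (ts' i) (us' i))) ->
  alpha_node xs ts us = alpha_node xs' ts' us'.
Proof.
by move=> E; congr (inr (existT _ _ _)); apply/functional_extensionality_dep.
Qed.

Lemma alpha_quot_nat (X X' Y Y' : nom V) (f : nhom X X') (g : nhom Y Y') a :
  alpha_quot X' Y' (bmap T f g a) = bmap Ta f g (alpha_quot X Y a).
Proof.
have [[x ->//]|[c [xs [ts [us ->]]]]] := term_node_eta a.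
by rewrite term_map_node !alpha_quot_node alpha_map_node.
Qed.

Lemma alpha_quot_surj (X X' Y : nom V) (f : nhom X X') :
  (forall x, exists y, f y = x) ->
  forall a, exists u, alpha_quot X' Y (bmap T f (hid Y) u) = a.
Proof.
move=> fsurj [x|[c t]]; first by exists (inl x).
have /dep_choice[u uP] : forall i : slot c, exists xa : (nbind i).-tuple V * sel (coind i) X Y,
    abstn xa.1 (sel_map (coind i) f (hid Y) xa.2) = t i.
  move=> i; have [xs [a ->]] := abstn_surj (t i).
  suff [b <-] : exists b, sel_map (coind i) f (hid Y) b = a by exists (xs, b).
  by case: (coind i) a => // a; exists a.
exists (inr (existT _ c u)); congr (inr (existT _ _ _)).
by apply/functional_extensionality_dep => i; apply: uP.
Qed.

Lemma alpha_mu_exists :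
  exists (M : mu_of Ta) (pi : forall Y : nom V, nhom (muT_nom Y) (M Y)),
  forall Y, (forall m, exists p, pi Y p = m) /\
    forall u, pi Y (term_in Y u) = mu_in M Y (alpha_quot _ _ (bmap T (pi Y) (hid Y) u)).
Proof. exact: (mu_quotient term_mu alpha_quot_nat alpha_quot_surj). Qed.

End AlphaAlgebra.

(** * Observing the initial algebra through alpha-classes *)

Section AlphaFold.
Context {V : eqType} (Vinf : infinite_set [set: V]) {Sg : mbs}.
Notation muT := (muT V Sg).
Notation T := (term_functor V Sg).
Notation Ta := (alpha_functor V Sg).
Notation sQ := (aterm_nom V (star_mbs Sg)).
Notation scl := (aclass V (star_mbs Sg)).
Context (M : mu_of Ta) (pi : forall Y : nom V, nhom (muT_nom (Sg := Sg) Y) (M Y)).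
Context (pi_surj : forall Y m, exists p, pi Y p = m).
Context (pi_in : forall Y u,
  pi Y (term_in Y u) = mu_in M Y (alpha_quot _ _ (bmap T (pi Y) (hid Y) u))).

Lemma pi_var Y x : pi Y (MVar _ _ x) = mu_in M Y (inl x).
Proof. exact: (pi_in (inl x)). Qed.

Lemma pi_node (Y : nom V) (c : Sg) (xs : forall i : slot c, (nbind i).-tuple V)
    (ts : forall i : slot c, ~~ coind i -> muT_nom Y) (us : forall i : slot c, coind i -> Y) :
  pi Y (MNode xs ts us) =
  mu_in M Y (alpha_node xs (fun i e => pi Y (ts i e)) us).
Proof. by rewrite -term_in_node pi_in term_map_node alpha_quot_node. Qed.

Lemma mu_map_pi (Y Y' : nom V) (g : nhom Y Y') (p : muT_nom Y) :
  mu_map M g (pi Y p) = pi Y' (muT_map id g p).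
Proof.
have E a : mu_map M g (mu_in M Y a) = mu_in M Y' (bmap Ta (mu_map M g) g a).
  exact: (hom_app (mu_mapE M g)).
elim: p => [x|c xs ts IH us] /=; first by rewrite !pi_var E.
rewrite !pi_node E alpha_map_node; congr (mu_in M Y' _).
apply: alpha_node_eq => i; congr abstn.
  by apply: val_inj; rewrite /= map_id.
by apply: sel_case_eq => // e; apply: IH.
Qed.

Lemma coind_case_app (U W : Type) (h : U -> W) b (f : ~~ b -> U) (g : b -> U) :
  h (coind_case f g) = coind_case (fun e => h (f e)) (fun e => h (g e)).
Proof. by case: b f g. Qed.

(** This is [fold f] computed on raw representatives ([fold_pi]) and, for classes of terms, the
    class of [muT_trunc] ([shape_fold_trunc]); it links raw unfoldings to both. *)
Fixpoint shape_fold (Y : Type) (f : Y -> sQ) (p : muT Y) : sQ :=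
  match p with
  | MVar x => avar x
  | MNode c xs ts us => @anode V (star_mbs Sg) (Some c) (fun i =>
      abstn (xs i) (coind_case (fun e => shape_fold f (ts i e)) (fun e => f (us i e))))
  end.

Lemma shape_fold_trunc (Y : Type) (f : Y -> term V (star_mbs Sg)) p :
  scl (muT_trunc f p) = shape_fold (fun y => scl (f y)) p.
Proof.
elim: p => [//|c xs ts IH us].
rewrite [RHS]/= -[LHS](anodeE Vinf); congr anode.
apply/functional_extensionality_dep => i; congr abstn.
by rewrite (coind_case_app (aclass V (star_mbs Sg))); apply: coind_case_eq => // e; apply: IH.
Qed.

Lemma shape_fold_map (Y Z : Type) (f : Z -> sQ) (g : Y -> Z) p :
  shape_fold f (muT_map id g p) = shape_fold (fun y => f (g y)) p.
Proof.
elim: p => [//|c xs ts IH us] /=; congr anode.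
apply/functional_extensionality_dep => i; congr abstn.
  by apply: val_inj; rewrite /= map_id.
by apply: coind_case_eq.
Qed.

Definition sel_elim (b : bool) (X Y : nom V) (f : nhom Y X) : nhom (sel b X Y) X :=
  match b return nhom (sel b X Y) X with true => f | false => hid X end.

Lemma sel_elim_case (b : bool) (X Y : nom V) (f : nhom Y X) (g : ~~ b -> X) (k : b -> Y) :
  sel_elim b f (sel_case g k) = coind_case g (fun e => f (k e)).
Proof. by case: b g k. Qed.

Definition fold_alg_fun (Y : nom V) (f : nhom Y sQ) (a : Ta sQ Y) : sQ :=
  match a with
  | inl x => avar x
  | inr (existT c t) => @anode V (star_mbs Sg) (Some c)
      (fun i => absn_map (nbind i) (sel_elim (coind i) f) (t i))
  end.

Lemma fold_alg_subproof (Y : nom V) (f : nhom Y sQ) s a :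
  fold_alg_fun f (act s a) = act s (fold_alg_fun f a).
Proof.
case: a => [x|[c t]]; first by rewrite avar_act.
rewrite [RHS](anode_act Vinf); congr anode.
by apply/functional_extensionality_dep => i; rewrite -homP.
Qed.

Definition fold_alg (Y : nom V) (f : nhom Y sQ) : nhom (Ta sQ Y) sQ :=
  Defs.Hom (fold_alg_subproof f).

(** If [f] observes [Y] at level [n], this observes mu X. T^alpha(X,Y) at level n+1, since inductive
    layers do not lower the level. *)
Definition fold (Y : nom V) (f : nhom Y sQ) : nhom (M Y) sQ :=
  sval (cid (mu_init M (Y := Y) (fold_alg f))).

Lemma fold_node (Y : nom V) (f : nhom Y sQ) (c : Sg)
    (xs : forall i : slot c, (nbind i).-tuple V)
    (ts : forall i : slot c, ~~ coind i -> M Y) (us : forall i : slot c, coind i -> Y) :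
  fold f (mu_in M Y (alpha_node xs ts us)) = @anode V (star_mbs Sg) (Some c) (fun i =>
    abstn (xs i) (coind_case (fun e => fold f (ts i e)) (fun e => f (us i e)))).
Proof.
rewrite /fold; case: cid => h [hE _] /=; rewrite [LHS](hom_app hE).
transitivity (fold_alg_fun f (bmap Ta h (hid Y) (alpha_node xs ts us))); first by [].
rewrite alpha_map_node; congr anode; apply/functional_extensionality_dep => i.
by rewrite absn_map_abstn sel_elim_case.
Qed.

Lemma fold_var (Y : nom V) (f : nhom Y sQ) x : fold f (mu_in M Y (inl x)) = avar x.
Proof. by rewrite /fold; case: cid => h [hE _] /=; rewrite [LHS](hom_app hE). Qed.

Lemma fold_pi (Y : nom V) (f : nhom Y sQ) p : fold f (pi Y p) = shape_fold f p.
Proof.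
elim: p => [x|c xs ts IH us]; first by rewrite pi_var fold_var.
rewrite pi_node fold_node; congr anode; apply/functional_extensionality_dep => i.
by congr abstn; apply: coind_case_eq.
Qed.

Lemma fold_map (Y Z : nom V) (f : nhom Z sQ) (g : nhom Y Z) m :
  fold f (mu_map M g m) = fold (hcomp f g) m.
Proof.
by have [p <-] := pi_surj m; rewrite mu_map_pi !fold_pi shape_fold_map.
Qed.

Lemma fold_separates (I : Type) (i0 : I) (Y : nom V) (f : I -> nhom Y sQ) :
  (forall y y', (forall i, f i y = f i y') -> y = y') ->
  forall m m', (forall i, fold (f i) m = fold (f i) m') -> m = m'.
Proof.
move=> fsep m m'; have [p <-] := pi_surj m; have [q <-] := pi_surj m'.
suff H s : (forall i, fold (f i) (pi Y (act s p)) = fold (f i) (pi Y q)) ->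
    pi Y (act s p) = pi Y q.
  by move: (H pid); rewrite act1.
elim: p s q {m m'} => [x|c xs ts IH us] s [y|c' xs' ts' us'] E.
(* A single index already reveals a variable or the constructor at the root; [i0] provides one. *)
- by have := E i0; rewrite !fold_pi => /(avar_inj Vinf) /= <-.
- by have := E i0; rewrite !fold_pi => /(avar_anode Vinf).
- by have := E i0; rewrite !fold_pi => /esym/(avar_anode Vinf).
have ec : c = c'.
  by have := E i0; rewrite !fold_pi => /(anode_constr Vinf) [].
subst c'; rewrite muT_actN !pi_node; congr (mu_in M Y _).
apply: alpha_node_eq => j.
have {}E i : abstn [tuple of map s (xs j)]
      (coind_case (fun e => fold (f i) (pi Y (act (p := muT_nom Y) s (ts j e))))
                  (fun e => f i (act s (us j e)))) =
    abstn (xs' j) (coind_case (fun e => fold (f i) (pi Y (ts' j e)))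
                  (fun e => f i (us' j e))).
  have := E i; rewrite muT_actN !pi_node !fold_node => /(anode_inj Vinf).
  exact: (congr1 (fun g => g j)).
(* After renaming to common bound names, the bodies are compared by [fsep] at a coinductive position
   and by the induction hypothesis at an inductive one. *)
case jE : (coind j) (ts j) (us j) (ts' j) (us' j) (IH j) E => /= t u t' u' IHj E.
  have [zs [f1 f2]] := fresh_for_exists Vinf [tuple of map s (xs j)] (xs' j)
    (act s (u isT)) (u' isT).
  apply/(abstn_eqP Vinf f1 f2); apply: fsep => i; rewrite !(homP (f i) (pswaps _ _)).
  have g1 := fresh_for_sub (@supp_hom V Y sQ (f i) _) f1.
  have g2 := fresh_for_sub (@supp_hom V Y sQ (f i) _) f2.
  exact/(abstn_eqP Vinf g1 g2).
have [zs [f1 f2]] := fresh_for_exists Vinf [tuple of map s (xs j)] (xs' j)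
  (pi Y (act (p := muT_nom Y) s (t isT))) (pi Y (t' isT)).
apply/(abstn_eqP Vinf f1 f2); rewrite -!(homP (pi Y) (pswaps _ _)).
have {}IHj s' q : (forall i, fold (f i) (pi Y (act (p := muT_nom Y) s' (t isT))) =
    fold (f i) (pi Y q)) -> pi Y (act (p := muT_nom Y) s' (t isT)) = pi Y q.
  exact: IHj.
have := IHj (pmul (pswaps [tuple of map s (xs j)] zs) s)
  (act (p := muT_nom Y) (pswaps (xs' j) zs) (t' isT)).
rewrite actM; apply => i; rewrite !(homP (pi Y) (pswaps _ _)) !(homP (fold (f i)) (pswaps _ _)).
have g1 := fresh_for_sub (@supp_hom V (M Y) sQ (fold (f i)) _) f1.
have g2 := fresh_for_sub (@supp_hom V (M Y) sQ (fold (f i)) _) f2.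
exact/(abstn_eqP Vinf g1 g2).
Qed.

End AlphaFold.

(** * The completion of terms modulo alpha-equivalence *)

Section AlphaCompletion.
Context {R : realType} {V : eqType} (Vinf : infinite_set [set: V]) {Sg : mbs}.
Notation term := (term V Sg).
Notation Q := (aterm_nom V Sg).
Notation sQ := (aterm_nom V (star_mbs Sg)).
Notation cl := (aclass V Sg).
Notation Tainf := (acomp (R := R) V Sg).

Definition tlv n : nhom Tainf sQ := @Defs.Hom V Tainf sQ
  (clv (dE := @aterm_dist_act R V Sg) (alv_refining Vinf) (aterm_distE Vinf) n)
  (clv_act (alv_refining Vinf) (aterm_distE Vinf) n).

Lemma tlv_refining : refining (fun n => tlv n : Tainf -> sQ).
Proof. exact: (clv_refining _ (alv_refining Vinf) (aterm_distE Vinf)). Qed.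

Lemma tlv_sep p q : (forall n, tlv n p = tlv n q) -> p = q.
Proof. exact: clv_sep. Qed.

Lemma acomp_distE : @acomp_dist R V Sg = lv_dist tlv.
Proof. exact: (completion_distE _ (alv_refining Vinf) (aterm_distE Vinf)). Qed.

Lemma tlv_in n p : tlv n (@acomp_in R V Sg Vinf p) = alv Vinf n p.
Proof. exact: clv_in. Qed.

Lemma tlv_dense p n : exists a : Q, alv Vinf n a = tlv n p.
Proof. exact: clv_dense. Qed.

Lemma tlv_complete : lv_complete tlv.
Proof. exact: (@clv_complete _ _ _ _ _ _ _ (alv_refining Vinf) (aterm_distE Vinf)). Qed.

Lemma rho_tlv m n p : (m <= n)%N -> rho Vinf m (tlv n p) = tlv m p.
Proof.
move=> mn; have [a ap] := tlv_dense p n; rewrite -ap rho_alv// -tlv_in.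
by apply: tlv_refining.2 mn _; rewrite tlv_in.
Qed.

Lemma tlv_lift (a : nat -> sQ) : (forall n, exists p : Q, a n = alv Vinf n p) ->
  (forall m n, (m <= n)%N -> rho Vinf m (a n) = a m) ->
  exists p, forall n, tlv n p = a n.
Proof.
move=> /choice[u uP] aP.
have [n k nk|p pP] := clv_lift (@aterm_dist_act R V Sg) (alv_refining Vinf)
    (aterm_distE Vinf) (a := u); last by exists p => n; rewrite [LHS]pP uP.
by rewrite -(rho_alv Vinf _ nk) -!uP aP.
Qed.

Definition flv n : nhom (fs Tainf) sQ := @Defs.Hom V (fs Tainf) sQ
  (fun p => tlv n (sval p)) (fun s p => homP (tlv n) s (sval p)).

Lemma flv_sep p q : (forall n, flv n p = flv n q) -> p = q.
Proof. by move=> pq; apply: sig_ext; apply: tlv_sep. Qed.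

Lemma supports_tlv S p : (forall n, supports S (tlv n p)) -> supports S p.
Proof. by move=> Sp s sS; apply: tlv_sep => n; rewrite homP Sp. Qed.

Lemma flv_lift (a : nat -> sQ) S : (forall n, exists p : Q, a n = alv Vinf n p) ->
  (forall m n, (m <= n)%N -> rho Vinf m (a n) = a m) ->
  (forall n, supports S (a n)) ->
  exists p, forall n, flv n p = a n.
Proof.
move=> aQ ac aS; have [p pa] := tlv_lift aQ ac.
have Sp : supports S p by apply: supports_tlv => n; rewrite pa.
by exists (exist _ p (ex_intro _ S Sp)).
Qed.

Lemma coind_case_const (U : Type) b (f : ~~ b -> U) (g : b -> U) d :
  (forall e, f e = d) -> (forall e, g e = d) -> coind_case f g = d.
Proof. by case: b f g => f g Hf Hg; [apply: Hg|apply: Hf]. Qed.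

Lemma alv_node_repr n (p : Q) (c : Sg) xs (ts : slot c -> term) :
  alv Vinf 1 p = alv Vinf 1 (cl (Node xs ts)) ->
  exists ys (us : slot c -> Q), alv Vinf n.+1 p =
    @anode V (star_mbs Sg) (Some c)
      (fun i => abstn (ys i) (alv Vinf (n.+1 - coind (i : slot c)) (us i))).
Proof.
have [[x|c' ys us] <-] := aclass_surj p.
  by rewrite alv_node alvE => /(avar_anode Vinf).
move=> E; have ec : c' = c.
  by move: E; rewrite !alv_node => /(anode_constr Vinf) [].
by subst c'; exists ys, (fun i => cl (us i)); rewrite alv_node.
Qed.

(* The sequence b is the image of a limit at levels n + 1; its level-one
   approximation is a finite term, along which the limit is unfolded down to
   the coinductive positions. *)
Lemma shape_exists (t : term) s S (b : nat -> sQ) :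
  (forall n, exists p : Q, b n = alv Vinf n.+1 p) ->
  (forall m n, (m <= n)%N -> rho Vinf m.+1 (b n) = b m) ->
  (forall n, supports S (b n)) ->
  b 0%N = alv Vinf 1 (cl (term_act s t)) ->
  exists P : muT V Sg (fs Tainf), forall n, shape_fold (flv n) P = b n.
Proof.
elim: t s S b => [x|c xs ts IH] s S b bQ bc bS b0.
  exists (MVar _ _ (s x)) => n; have [p bp] := bQ n; rewrite bp /=.
  have : alv Vinf 1 p = avar (s x).
    by rewrite -(rho_alv Vinf p (ltn0Sn n)) -bp bc// b0 alvE.
  have [[y|c ys us] <-] := aclass_surj p; last first.
    by rewrite alv_node => /esym/(avar_anode Vinf).
  by rewrite !alvE => ->.
have /choice[yu yuP] n : exists yu : (forall i : slot c, (nbind i).-tuple V) * (slot c -> Q),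
    b n = @anode V (star_mbs Sg) (Some c)
      (fun i => abstn (yu.1 i) (alv Vinf (n.+1 - coind (i : slot c)) (yu.2 i))).
  have [p bp] := bQ n.
  have [|ys [us E]] := @alv_node_repr n p c (fun i => [tuple of map s (xs i)])
      (fun i => term_act s (ts i)); last by exists (ys, us); rewrite bp.
  by rewrite -(rho_alv Vinf p (ltn0Sn n)) -bp bc.
(* [S] supports every [b n], so the same names [zs] can be bound at all levels. *)
have /dep_choice[zs zsP] (i : slot c) := fresh_seq Vinf S (nbind i).
have bS' n : forall i : slot c, supports S
    (abstn ((yu n).1 i) (alv Vinf (n.+1 - coind i) ((yu n).2 i))).
  apply/(supports_anode Vinf (c := Some c : star_mbs Sg)); rewrite -yuP; exact: bS.
have /choice[d dP] (i : slot c) : exists d : nat -> sQ, forall n,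
    abstn ((yu n).1 i) (alv Vinf (n.+1 - coind i) ((yu n).2 i)) = abstn (zs i) (d n).
  apply: (dep_choice (P := fun n d =>
    abstn ((yu n).1 i) (alv Vinf (n.+1 - coind i) ((yu n).2 i)) = abstn (zs i) d)) => n.
  have [uz zP] := zsP i; apply: abstn_concretion => // z /zP zS sz.
  by move: zS; rewrite (sz _ (bS' n i)).
have bE n : b n = @anode V (star_mbs Sg) (Some c) (fun i => abstn (zs i) (d i n)).
  rewrite yuP; congr anode; apply/functional_extensionality_dep => i; exact: dP.
have dQ i n : exists p : Q, d i n = alv Vinf (n.+1 - coind i) p.
  have [s' ->] := abstn_orbit Vinf (dP i n).
  by exists (act s' ((yu n).2 i)); rewrite homP.
(* With the binders [zs] fixed, the coherence of [b] passes to the bodies by injectivity of the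
   constructors. *)
have dc i m n : (m <= n)%N -> rho Vinf (m.+1 - coind i) (d i n) = d i m.
  move=> /bc; rewrite !bE rho_anode => /(anode_inj Vinf)/(congr1 (fun g => g i)).
  by rewrite absn_map_abstn => /(abstn_inj Vinf).
have dS i n : supports (S ++ zs i) (d i n).
  by apply: supports_abstn => //; rewrite -dP; apply: bS'.
(* The body obtained is only a permuted copy of the one in the level-one term, which is why the
   statement carries [s]. *)
have d0 i : exists s', d i 0%N = alv Vinf (1 - coind i) (cl (term_act s' (ts i))).
  have E : abstn [tuple of map s (xs i)] (alv Vinf (1 - coind i) (cl (term_act s (ts i)))) =
      abstn (zs i) (d i 0%N).
    have := b0; rewrite bE alv_node => /(anode_inj Vinf) E.
    exact: (esym (congr1 (fun g => g i) E)).
  have [s' ->] := abstn_orbit Vinf E; exists (pmul s' s).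
  by rewrite -term_actM [cl (term_act s' _)]aclass_act; symmetry; apply: homP.
(* At an inductive position [d i] starts at level 1, as [b] does, and the recursion continues; at a
   coinductive one it starts at level 0 and is the full record of a limit. *)
have /dep_choice[P PP] i : exists P : ~~ coind i -> muT V Sg (fs Tainf),
    forall e n, shape_fold (flv n) (P e) = d i n.
  apply: (dep_choice (P := fun e P => forall n, shape_fold (flv n) P = d i n)) => e.
  have [s' d0'] := d0 i.
  apply: (IH i s' (S ++ zs i) (d i)); move: (dQ i) (dc i) (dS i) d0';
    by rewrite (negbTE e) ?subn0 => // H _ _ _ n; have := H n; rewrite subn0.
have /dep_choice[U UP] i : exists U : coind i -> fs Tainf,
    forall e n, flv n (U e) = d i n.
  apply: (dep_choice (P := fun e U => forall n, flv n U = d i n)) => e.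
  apply: (@flv_lift _ (S ++ zs i)) => [n|m n mn|n]; last exact: dS.
    by have := dQ i n; rewrite e subn1.
  by have := dc i m n mn; rewrite e subn1.
exists (MNode zs P U) => n; rewrite bE /=; congr anode.
apply/functional_extensionality_dep => i; congr abstn.
by apply: coind_case_const => e; [apply: PP|apply: UP].
Qed.

Lemma unfold_exists (p : fs Tainf) : exists P : muT V Sg (fs Tainf),
  forall n, shape_fold (flv n) P = flv n.+1 p.
Proof.
have [S Sp] := svalP p; have [a aE] := tlv_dense (sval p) 1.
have [t ta] := aclass_surj a.
apply: (@shape_exists t pid S) => [n|m n mn|n|].
- by have [q qE] := tlv_dense (sval p) n.+1; exists q.
- exact: rho_tlv.
- exact: (hom_supports (tlv n.+1) Sp).
rewrite -[LHS]aE -ta; congr (alv _ _ (cl _)).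
by symmetry; apply: (act1 (p := term_pset V Sg)).
Qed.

Lemma aterm_completion :
  is_completion (@aterm_dist R V Sg) (@acomp_dist R V Sg) (@acomp_in R V Sg Vinf).
Proof.
rewrite acomp_distE (aterm_distE Vinf).
apply: (lv_completion (alv_refining Vinf) tlv_refining).
- exact: alv_sep.
- exact: tlv_sep.
- exact: tlv_in.
- exact: tlv_dense.
exact: tlv_complete.
Qed.

End AlphaCompletion.

(** * Classes of mixed terms and the terminal coalgebra modulo alpha *)

Section AlphaCoalgebra.
Context {R : realType} {V : eqType} (Vinf : infinite_set [set: V]) {Sg : mbs}.
Notation muT := (muT V Sg).
Notation mterm := (mterm V Sg).
Notation Ta := (alpha_functor V Sg).
Notation sQ := (aterm_nom V (star_mbs Sg)).
Notation cl := (aclass V Sg).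
Notation scl := (aclass V (star_mbs Sg)).
Notation Tinf := (mterm_pset V Sg).
Notation Tainf := (acomp (R := R) V Sg).
Notation tlv := (tlv (R := R) Vinf (Sg := Sg)).
Notation flv := (flv (R := R) Vinf (Sg := Sg)).

Lemma mclass_exists (t : mterm) : exists p : Tainf, forall n, tlv n p = scl (mtrunc t n).
Proof.
apply: tlv_lift => [n|m n mn]; last by rewrite rhoE strunc_mtrunc.
have [x0 _] := fresh_var Vinf [::].
by exists (cl (sfill x0 (mtrunc t n))); rewrite alvE trunc_sfill.
Qed.

Definition mclass_fun (t : Tinf) : Tainf := sval (cid (mclass_exists t)).

Lemma tlv_mclass_fun n t : tlv n (mclass_fun t) = scl (mtrunc t n).
Proof. by rewrite /mclass_fun; case: cid. Qed.

Lemma mclass_subproof s t : mclass_fun (act s t) = act s (mclass_fun t).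
Proof.
apply: (tlv_sep (Vinf := Vinf)) => n.
by rewrite homP !tlv_mclass_fun -aclass_act -mtrunc_act.
Qed.

Definition mclass : nhom Tinf Tainf := Defs.Hom mclass_subproof.

Lemma tlv_mclass n t : tlv n (mclass t) = scl (mtrunc t n).
Proof. exact: tlv_mclass_fun. Qed.

Lemma mclass_eqP t u : mclass t = mclass u <-> maeq t u.
Proof.
split=> [tu n|tu]; first by apply/(aclassP Vinf); rewrite -!tlv_mclass tu.
by apply: (tlv_sep (Vinf := Vinf)) => n; rewrite !tlv_mclass; apply/(aclassP Vinf).
Qed.

Lemma mclass_emb t : mclass (emb t) = @acomp_in R V Sg Vinf (cl t).
Proof.
by apply: (tlv_sep (Vinf := Vinf)) => n; rewrite tlv_mclass mtrunc_emb tlv_in alvE.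
Qed.

Lemma mclass_dist t u : acomp_dist (mclass t) (mclass u) <= mterm_dist t u :> R.
Proof.
rewrite (acomp_distE Vinf); apply: inf_dist_sub => // n tu.
by rewrite !tlv_mclass tu.
Qed.

(** The recursion determines the truncations of an unfolding modulo alpha. It is used with [flv] for
    surjectivity and with [approx] for terminality. *)
Lemma scl_mtrunc_munfold Y (g : Y -> muT Y) (f : nat -> Y -> sQ) :
  (forall y, f 0%N y = scl (star V Sg)) ->
  (forall n y, f n.+1 y = shape_fold (f n) (g y)) ->
  forall n y, scl (mtrunc (munfold g y) n) = f n y.
Proof.
move=> f0 fS; elim=> [|n IH] y; first by rewrite f0.
rewrite mtruncS mout_munfold (shape_fold_trunc Vinf) shape_fold_map fS.
by congr shape_fold; apply/funext.
Qed.

Lemma tlv0 p : tlv 0 p = scl (star V Sg).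
Proof. by have [a <-] := tlv_dense Vinf p 0; rewrite alv0. Qed.

(** The raw unfoldings picked by [g] need not be equivariant, but they form a coalgebra in Set,
    which is enough to build a mixed term with the truncations of [p]. *)
Lemma mclass_fs_surj (p : fs Tainf) : exists t, mclass t = sval p.
Proof.
have [g gP] := choice (unfold_exists Vinf (R := R) (Sg := Sg)).
exists (munfold g p); apply: (tlv_sep (Vinf := Vinf)) => n; rewrite tlv_mclass.
apply: (scl_mtrunc_munfold (f := flv)) => [q|m q]; first exact: tlv0.
by rewrite gP.
Qed.

Section Coalgebra.
Context (M : mu_of Ta) (pi : forall Y : nom V, nhom (muT_nom (Sg := Sg) Y) (M Y)).
Context (pi_surj : forall Y m, exists p, pi Y p = m).
Context (pi_in : forall Y u,
  pi Y (term_in Y u) = mu_in M Y (alpha_quot _ _ (bmap (term_functor V Sg) (pi Y) (hid Y) u))).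
Notation fold := (fold Vinf M).

(** The raw unfolding is an arbitrary choice; its image under [pi] is not, because its folds are the
    truncations of [p] and folds separate. *)
Definition acomp_out_fun (p : fs Tainf) : M (fs Tainf) :=
  pi _ (sval (cid (unfold_exists Vinf p))).

Lemma fold_acomp_out_fun n p : fold (flv n) (acomp_out_fun p) = flv n.+1 p.
Proof. by rewrite /acomp_out_fun (fold_pi Vinf pi_in); case: cid. Qed.

Lemma fold_flv_sep (m m' : M (fs Tainf)) :
  (forall n, fold (flv n) m = fold (flv n) m') -> m = m'.
Proof.
apply: (fold_separates pi_surj pi_in 0%N (f := fun n => flv n)).
exact: (flv_sep (Vinf := Vinf)).
Qed.

Lemma acomp_out_subproof s p : acomp_out_fun (act s p) = act s (acomp_out_fun p).
Proof.
by apply: fold_flv_sep => n; rewrite homP !fold_acomp_out_fun homP.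
Qed.

Definition acomp_out : nhom (fs Tainf) (M (fs Tainf)) := Defs.Hom acomp_out_subproof.

Lemma fold_acomp_out n p : fold (flv n) (acomp_out p) = flv n.+1 p.
Proof. exact: fold_acomp_out_fun. Qed.

Lemma act_scl_star s : scl (star V Sg) = act s (scl (star V Sg)).
Proof. by rewrite -aclass_act term_act_star. Qed.

(** The level-[n] observation forced on any coalgebra map out of [c]. Built from equivariant maps,
    it shows that [mclass (munfold g x)] is equivariant in [x] although [g] is only chosen. *)
Fixpoint approx (C : nom V) (c : nhom C (M C)) (n : nat) : nhom C sQ :=
  if n is m.+1 then hcomp (fold (approx c m)) c
  else @Defs.Hom V C sQ (fun=> scl (star V Sg)) (fun s _ => act_scl_star s).

Lemma acomp_out_terminal : terminal_coalgebra (F := mu_functor M) acomp_out.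
Proof.
move=> C c; have /choice[g gP] : forall x, exists p, pi C p = c x by move=> x; apply: pi_surj.
have tE n x : tlv n (mclass (munfold g x)) = approx c n x.
  rewrite tlv_mclass; apply: (scl_mtrunc_munfold (f := fun n x => approx c n x)) => // m y.
  by rewrite /= -gP (fold_pi Vinf pi_in).
have hP s x : mclass (munfold g (act s x)) = act s (mclass (munfold g x)).
  by apply: (tlv_sep (Vinf := Vinf)) => n; rewrite homP !tE homP.
pose h := fs_hom (@Defs.Hom V C Tainf (fun x => mclass (munfold g x)) hP).
have hE n : hcomp (flv n) h = approx c n by apply: hom_ext => x; apply: tE.
exists h; split.
  apply: hom_ext => x; apply: fold_flv_sep => n.
  rewrite [LHS]fold_acomp_out [RHS](fold_map Vinf pi_surj pi_in) hE.
  exact: tE.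
move=> k kE; apply: hom_ext => x; apply: (flv_sep (Vinf := Vinf)) => n.
(* Any coalgebra map [k] satisfies the recursion of [approx], by its coalgebra equation and
   [fold_map]. *)
rewrite [LHS]tE; symmetry; suff -> : approx c n = hcomp (flv n) k by [].
elim: n => [|n IH] /=; apply: hom_ext => y; first by rewrite [RHS]tlv0.
rewrite IH; transitivity (flv n.+1 (k y)); last by [].
rewrite -fold_acomp_out -[acomp_out (k y)]/(hcomp acomp_out k y) kE.
by rewrite [RHS](fold_map Vinf pi_surj pi_in).
Qed.

Lemma acomp_limit_lv (u : nat -> term V Sg) p :
  limit_of (@acomp_dist R V Sg) (fun n => @acomp_in R V Sg Vinf (cl (u n))) p ->
  forall n, exists N, forall k, (N <= k)%N -> alv Vinf n (cl (u k)) = tlv n p.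
Proof.
rewrite (acomp_distE Vinf) => /(lv_limitP (tlv_refining Vinf)) H n.
by have [N NP] := H n; exists N => k /NP; rewrite tlv_in.
Qed.

Lemma acomp_out_unfolding : acomp_unfolding Vinf acomp_out.
Proof.
split=> [p x /acomp_limit_lv xp|p c xs ts ps tsps /acomp_limit_lv tp].
  apply: fold_flv_sep => n; rewrite fold_acomp_out fold_var.
  by have [N /(_ N (leqnn N)) pE] := xp n.+1; rewrite -[LHS]pE alvE.
apply: fold_flv_sep => n; rewrite fold_acomp_out.
have /choice[N NP] : forall i : slot c, exists N, forall k, (N <= k)%N ->
    alv Vinf (n.+1 - coind i) (cl (ts i k)) = tlv (n.+1 - coind i) (sval (ps i)).
  by move=> i; apply: acomp_limit_lv.
have [N' pE] := tp n.+1.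
(* Arities are finite, so one index lies past the stabilisation of the node and of all its
   arguments. *)
pose k := maxn N' (\max_(i : slot c) N i).
rewrite -[LHS](pE k) ?leq_maxl// alv_node.
transitivity (fold (flv n) (mu_in M _ (alpha_node (Y := fs Tainf) xs
    (fun i _ => acomp_out (ps i)) (fun i _ => ps i)))); last first.
  congr (fold _ (mu_in M _ _)); rewrite /alpha_node.
  congr (inr (existT _ _ _)); apply/functional_extensionality_dep => i.
  by rewrite sel_elt_case.
rewrite fold_node; congr anode; apply/functional_extensionality_dep => i; congr abstn.
rewrite (NP i); last by rewrite leq_max; apply/orP; right; apply: leq_bigmax.
symmetry; apply: coind_case_const => e.
  by rewrite fold_acomp_out (negbTE e) subn0.
by rewrite e subn1.
Qed.

End Coalgebra.

(** * Free variables and supports *)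

Lemma free_in_lv x (p : muT mterm) : free_in x p ->
  exists n, supp (scl (muT_trunc (fun u => mtrunc u n) p)) x.
Proof.
elim=> {p} [|c xs ts us i e xi _ [n IH]|c xs ts us i e xi _ [n IH]].
- by exists 0%N; apply: supp_avarx.
- exists n; rewrite -[X in supp X](anodeE Vinf); apply/(supp_anode Vinf); exists i.
  by apply/(supp_abstn Vinf); split=> //; rewrite (coind_caseF _ _ e).
(* [IH] concerns [mout (us i e)] with level [n] below it, that is, [us i e] at level [n.+1]. *)
exists n.+1; rewrite -[X in supp X](anodeE Vinf); apply/(supp_anode Vinf); exists i.
by apply/(supp_abstn Vinf); split=> //; rewrite (coind_caseT _ _ e).
Qed.

Lemma lv_free_in x n (t : mterm) : supp (scl (mtrunc t n)) x -> fv t x.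
Proof.
elim: n t => [|n IH] t.
  move=> /(_ [::]) h; suff : x \in [::] by [].
  by apply: h => s _; rewrite -aclass_act term_act_star.
rewrite mtruncS /fv /=; elim: (mout t) => [y /supp_avar ->|c xs ts IHt us].
  exact: free_var.
rewrite -[X in supp X](anodeE Vinf) => /(supp_anode Vinf)[i].
move=> /(supp_abstn Vinf)[sx xi]; case iE : (coind i).
  apply: (@free_coi V Sg x c xs ts us i iE xi); apply: IH; move: sx;
  by rewrite (coind_caseT _ _ iE).
have e : ~~ coind i by rewrite iE.
apply: (@free_ind V Sg x c xs ts us i e xi); apply: IHt; move: sx;
by rewrite (coind_caseF _ _ e).
Qed.

(** A free occurrence lies at finite depth, so some level shows it, and truncation deletes subterms
    without releasing bound names. The support of a class is thus read off the free variables. *)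
Lemma fvP x (t : mterm) : fv t x <-> exists n, supp (scl (mtrunc t n)) x.
Proof.
split=> [/free_in_lv[n tx]|[n]]; last exact: lv_free_in.
by exists n.+1.
Qed.

Lemma fv_supports (t : mterm) S : supports S (mclass t) -> forall x, fv t x -> x \in S.
Proof.
move=> St x /fvP[n]; apply; rewrite -tlv_mclass; exact: hom_supports.
Qed.

Lemma mclass_supports (t : mterm) S : (forall x, fv t x -> x \in S) -> supports S (mclass t).
Proof.
move=> tS; apply: (supports_tlv (Vinf := Vinf)) => n; rewrite tlv_mclass.
by apply: (supports_supp Vinf) => x tx; apply: tS; apply/fvP; exists n.
Qed.

Lemma ffv_fsP (t : mterm) : finite_set (fv t) <-> exists S, supports S (mclass t).
Proof.
split=> [/finite_seqP[S SE]|[S St]].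
  by exists S; apply: mclass_supports => x; rewrite SE.
by apply: sub_finite_set (finite_seq S) => x; apply: fv_supports.
Qed.

Lemma supp_scl_sfill x0 (r : term V (star_mbs Sg)) x :
  supp (cl (sfill x0 r)) x -> x != x0 -> supp (scl r) x.
Proof.
move=> sx xx0; elim: r sx => [y /supp_avar ->|[c|] xs ts IH].
- exact: supp_avarx.
- have E := anodeE Vinf (Sg := Sg) (c := c) xs (fun i => sfill x0 (ts i)).
  move=> sx; have {sx E} : supp (anode (Sg := Sg) (c := c)
      (fun i => abstn (xs i) (cl (sfill x0 (ts i))))) x by rewrite E.
  move=> /(supp_anode Vinf)[i /(supp_abstn Vinf)[sx xi]].
  rewrite -(anodeE Vinf); apply/(supp_anode Vinf).
  by exists i; apply/(supp_abstn Vinf); split=> //; apply: IH.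
by move=> /supp_avar E; move: xx0; rewrite E eqxx.
Qed.

Lemma aterm_nominal_completion :
  is_nominal_completion (A := aterm_nom V Sg) (B := fs Tainf) (@aterm_dist R V Sg)
    (fun p q : fs Tainf => acomp_dist (sval p) (sval q)) (fs_hom (@acomp_in R V Sg Vinf)).
Proof.
rewrite (acomp_distE Vinf) (aterm_distE Vinf).
apply: (lv_nominal_completion Vinf (alv_refining Vinf) (tlv_refining Vinf)).
- exact: alv_sep.
- exact: tlv_sep.
- exact: tlv_in.
(* Density alone would give approximations with uncontrolled supports. Filling the truncations of a
   single mixed term of class [p] keeps them inside [x0 :: S]. *)
- move=> p; have [t tp] := mclass_fs_surj p; have [S Sp] := svalP p.
  have [x0 _] := fresh_var Vinf [::].
  exists (fun n => cl (sfill x0 (mtrunc t n))); split=> [|n]; last first.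
    by rewrite alvE trunc_sfill// -tlv_mclass tp.
  exists (x0 :: S) => n x sx; rewrite inE.
  have [//|xx0 /=] := eqVneq x x0; apply: (fv_supports (t := t)); first by rewrite tp.
  by apply/fvP; exists n; apply: supp_scl_sfill xx0.
exact: tlv_complete.
Qed.

End AlphaCoalgebra.

(** * The quotient maps and the pullback square *)

Section Quotients.
Context {R : realType} {V : eqType} (Vinf : infinite_set [set: V]) {Sg : mbs}.
Notation Tinf := (mterm_pset V Sg).
Notation Tainf := (acomp (R := R) V Sg).
Notation mclass := (mclass (R := R) Vinf (Sg := Sg)).

Definition fs_val (A : pset V) : nhom (fs A) A :=
  @Defs.Hom V (fs A) A sval (fun s a => erefl).

Definition mclass_fs : nhom (fs Tinf) (fs Tainf) := fs_hom (hcomp mclass (fs_val Tinf)).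

Lemma fs_ffv_subproof (t : fs Tinf) : finite_set (fv (sval t)).
Proof.
apply/(ffv_fsP (R := R) Vinf); have [S St] := svalP t.
by exists S; apply: hom_supports.
Qed.

Definition fs_ffv (t : fs Tinf) : ffv_mterm V Sg := exist _ (sval t) (fs_ffv_subproof t).

Definition ffv_class (t : ffv_mterm V Sg) : fs Tainf :=
  exist _ (mclass (sval t)) ((ffv_fsP Vinf (sval t)).1 (svalP t)).

Definition ffv_quot_class : quot (@ffv_maeq V Sg) -> fs Tainf := qlift ffv_class.

Lemma ffv_quot_classE t : ffv_quot_class (qpi _ t) = ffv_class t.
Proof.
by apply: qliftE => x y xy; apply: sig_ext; apply/mclass_eqP.
Qed.

Lemma ffv_quot_class_inj : injective ffv_quot_class.
Proof.
move=> p q; have [t <-] := qpi_surj p; have [u <-] := qpi_surj q.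
rewrite !ffv_quot_classE => /(congr1 sval)/mclass_eqP tu.
exact: qpi_eq.
Qed.

Lemma ffv_quot_class_bij : bijective ffv_quot_class.
Proof.
have /choice[g gP] p : exists x, ffv_quot_class x = p.
  have [t tp] := mclass_fs_surj Vinf p; have ft : finite_set (fv t).
    by apply/(ffv_fsP (R := R) Vinf); rewrite tp; apply: (svalP p).
  exists (qpi _ (exist _ t ft)); rewrite ffv_quot_classE.
  exact: sig_ext.
by exists g => // x; apply: ffv_quot_class_inj.
Qed.

(** By [ffv_fsP], a mixed term whose class is finitely supported has finitely many free variables,
    so the first component of a matching pair lies in [ffv_mterm]; injectivity of [ffv_quot_class]
    then recovers the second. *)
Lemma ffv_pullback : is_pullback (sval : ffv_mterm V Sg -> Tinf) (qpi (@ffv_maeq V Sg))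
  mclass (fun p => sval (ffv_quot_class p)).
Proof.
split=> [|Z a b ab].
  by apply/funext => t; symmetry; apply: (congr1 sval (ffv_quot_classE t)).
have fa z : finite_set (fv (a z)).
  apply/(ffv_fsP (R := R) Vinf); have E : mclass (a z) = sval (ffv_quot_class (b z)) :=
    congr1 (fun g => g z) ab.
  rewrite E; exact: (svalP (ffv_quot_class (b z))).
exists (fun z => exist _ (a z) (fa z)); split.
  split; first by [].
  apply/funext => z; apply: ffv_quot_class_inj; apply: sig_ext.
  rewrite [ffv_quot_class _]ffv_quot_classE; apply: (congr1 (fun g => g z) ab).
move=> h [ha _]; apply/funext => z; apply: sig_ext => /=.
by rewrite -ha.
Qed.

End Quotients.

Theorem theorem2p1 (R : realType) (V : eqType) (Vinf : infinite_set [set: V])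
    (Sg : mbs) :
  let T : nom V := term_nom V Sg in
  let Tinf : pset V := mterm_pset V Sg in
  let Ta : nom V := aterm_nom V Sg in
  let Tainf : pset V := acomp (R := R) V Sg in
  let dT : T -> T -> R := @term_dist R V Sg in
  let dTinf : Tinf -> Tinf -> R := @mterm_dist R V Sg in
  let dTa : Ta -> Ta -> R := @aterm_dist R V Sg in
  let dTainf : Tainf -> Tainf -> R := @acomp_dist R V Sg in
  let iT : nhom T Tinf := emb_hom V Sg in
  let iTa : nhom Ta Tainf := @acomp_in R V Sg Vinf in
  let cls : nhom T Ta := aclass V Sg in
  (is_nominal_completion dT (fun t u : fs Tinf => dTinf (sval t) (sval u))
     (fs_hom iT)
   /\ exists (M : mu_of (term_functor V Sg)) (z : nhom (fs Tinf) (M (fs Tinf))),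
        terminal_coalgebra (F := mu_functor M) z /\ mterm_unfolding z)
  /\
  (is_nominal_completion dTa (fun p q : fs Tainf => dTainf (sval p) (sval q))
     (fs_hom iTa)
   /\ exists (M : mu_of (alpha_functor V Sg)) (z : nhom (fs Tainf) (M (fs Tainf))),
        terminal_coalgebra (F := mu_functor M) z /\ acomp_unfolding Vinf z)
  /\
  (is_completion dT dTinf iT /\ is_completion dTa dTainf iTa /\
   exists (j : fs Tinf -> ffv_mterm V Sg)
     (q : Tinf -> Tainf) (qfs : nhom (fs Tinf) (fs Tainf))
     (phi : quot (@ffv_maeq V Sg) -> fs Tainf),
     let incl : ffv_mterm V Sg -> Tinf := sval in
     let qffv : ffv_mterm V Sg -> quot (@ffv_maeq V Sg) := qpi (@ffv_maeq V Sg) in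
     (* q is the continuous extension of cls, and identifies exactly the
        alpha-equivalent terms *)
     ((forall t u, dTainf (q t) (q u) <= dTinf t u)
      /\ (forall t, q (iT t) = iTa (cls t))
      /\ (forall t u, q t = q u <-> maeq t u))
     /\ (forall t, incl (j t) = sval t)
     /\ (forall t, sval (qfs t) = q (sval t))
     /\ bijective phi
     /\ (forall t, qfs (fs_hom iT t) = fs_hom iTa (cls t))
     /\ (forall t, phi (qffv (j t)) = qfs t)
     /\ (forall s, sval (phi (qffv s)) = q (incl s))
     /\ is_pullback incl qffv q (fun p => sval (phi p))).
Proof.
move=> T Tinf Ta Tainf dT dTinf dTa dTainf iT iTa cls; split; [|split].
- split; first exact: term_nominal_completion.
  by exists term_mu, fs_out; split; [apply: fs_out_terminal|apply: fs_out_unfolding].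
- split; first exact: aterm_nominal_completion.
  have [M [pi piP]] := alpha_mu_exists (V := V) (Sg := Sg).
  have pi_surj Y := (piP Y).1; have pi_in Y := (piP Y).2.
  exists M, (acomp_out Vinf pi_surj pi_in).
  by split; [apply: acomp_out_terminal|apply: acomp_out_unfolding].
split; [exact: term_completion|split; [exact: aterm_completion|]].
exists (fs_ffv (R := R) Vinf), (mclass Vinf), (mclass_fs Vinf), (ffv_quot_class Vinf).
move=> incl qffv; split; [split; [|split]|].
- exact: mclass_dist.
- exact: mclass_emb.
- exact: mclass_eqP.
split=> //; split=> //; split; first exact: ffv_quot_class_bij.
split; first by move=> t; apply: sig_ext; apply: mclass_emb.
split; first by move=> t; rewrite ffv_quot_classE; apply: sig_ext.
split; first by move=> t; rewrite ffv_quot_classE.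
exact: ffv_pullback.
Qed.
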